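(* Let $\gamma$ be a chordal SLE$_\kappa$ curve in the upper half-plane $\mathbb{H}$ from $0$ to $\infty$ (with $\kappa\in(0,8)$) that satisfies the conformal restriction property with exponent $\alpha>0$. Let $B=(B_0,B_1,B_2,\dots)$ be the associated sequence of boundary correlation functions, let $\mathcal{L}_N$ and $l_N$ ($N\in\mathbb{Z}$) be the operators defined in the context, and let $V$ be the vector space generated by $B$ and all the vectors $l_{N_1}\cdots l_{N_r}(B)$ with $r\ge1$ and integers $N_1\le\cdots\le N_r<0$. Then: - For all integers $N_1\le\cdots\le N_r<0$ and every $n\ge 0$, the function of $n$ variables in $l_{N_1}\cdots l_{N_r}(B)$ is $\mathcal{L}_{N_1}\cdots\mathcal{L}_{N_r}B_n$. - $V$ is stable under $l_N$ for every $N\in\mathbb{Z}$. - $[l_M,l_N]\,w=(M-N)\,l_{M+N}\,w$ for all $w\in V$ and all $M,N\in\mathbb{Z}$.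
   Context: Chordal SLE$_\kappa$: let $(\beta_t)_{t\ge0}$ be a standard real Brownian motion with $\beta_0=0$ and $W_t=\sqrt{\kappa}\,\beta_t$. The chordal SLE$_\kappa$ curve $\gamma$ in $\mathbb{H}=\{\operatorname{Im} z>0\}$ from $0$ to $\infty$ is the random curve characterized as follows: the conformal maps $g_t$ from $\mathbb{H}\setminus\gamma[0,t]$ (for $\kappa>4$, from its unbounded connected component) onto $\mathbb{H}$ normalized by $g_t(z)=z+o(1)$ as $z\to\infty$ solve $\partial_t g_t(z)=\frac{2}{g_t(z)-W_t}$, $g_0(z)=z$. Conformal restriction property with exponent $\alpha>0$: for every simply connected open subset $H\subset\mathbb{H}$ such that $\mathbb{H}\setminus H$ is bounded and bounded away from $0$, let $\Phi$ be the conformal map from $\mathbb{H}$ onto $H$ fixing the boundary points $0$ and $\infty$ with $\Phi(z)\sim z$ as $z\to\infty$. The property requires that the law of $\gamma$ conditioned on $\{\gamma\subset H\}$ be identical to the law of $\Phi(\gamma)$, and that $\mathbf{P}[\gamma\subset H]=\Phi'(0)^{-\alpha}$. Correlation functions: let $s=\frac8\kappa-1$ (when the restriction property holds, $s=2$). Put $B_0=1$ (a function of $0$ variables) and, for $n\ge1$ and pairwise distinct $x_1,\dots,x_n\in\mathbb{R}\setminus\{0\}$, $$B_n(x_1,\dots,x_n)=\lim_{\varepsilon_1,\dots,\varepsilon_n\to0^+}\varepsilon_1^{-s}\cdots\varepsilon_n^{-s}\,\mathbf{P}\Big[\bigcap_{j=1}^n\{\gamma\cap[x_j,x_j+i\varepsilon_j\sqrt2]\ne\emptyset\}\Big],$$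 where $[x_j,x_j+i\varepsilon_j\sqrt2]$ is the vertical segment with these endpoints. The limits are taken to exist as part of the definition. Under the restriction property each $B_n$ is a rational function of $x_1,\dots,x_n$. Operators $\mathcal{L}_N$: for $N\in\mathbb{Z}$, acting on functions of $n$ variables $x_1,\dots,x_n$ (for any $n\ge0$, the sum being empty, hence zero, when $n=0$), $$\mathcal{L}_{-N}=\sum_{j=1}^n\left\{-x_j^{1-N}\partial_{x_j}+2(N-1)x_j^{-N}\right\}.$$ Operators $l_N$: let $w=(w_0,w_1,w_2,\dots)$ be a sequence in which $w_n$ is a rational function of $n$ variables $x_1,\dots,x_n$. For $N\in\mathbb{Z}$, $l_{-N}(w)$ is the sequence whose function of $n$ variables, $(l_{-N}(w))_n(x_1,\dots,x_n)$, is the coefficient of $x^{N-2}$ in the Laurent expansion of $w_{n+1}(x,x_1,\dots,x_n)$ in the variable $x$ as $x\to0$, i.e. $$w_{n+1}(x,x_1,\dots,x_n)=\sum_{N\in\mathbb{Z}}x^{N-2}\,(l_{-N}(w))_n(x_1,\dots,x_n).$$ $[l_M,l_N]=l_Ml_N-l_Nl_M$. *)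

(* Defs.v *)
From HB Require Import structures.
From mathcomp Require Import all_boot all_order all_algebra.
From mathcomp Require Import fraction complex.
From mathcomp Require Import -(notations) mpoly.
From mathcomp Require Import all_classical all_reals all_analysis.

Set Implicit Arguments.
Unset Strict Implicit.
Unset Printing Implicit Defensive.

Import Order.TTheory GRing.Theory Num.Theory numFieldNormedType.Exports.
Local Open Scope classical_set_scope.
Local Open Scope ring_scope.

(* [R[i]] has no canonical topology; its regular module [R[i]^o] carries the
   topology of the modulus, and [derivable] on it is complex
   differentiability. *)
Notation cplx R := ((R[i])^o).

Definition upper_half_plane (R : realType) : set (cplx R) :=
  [set z | 0 < complex.Im z].

Definition complex_infty (R : realType) : set_system (cplx R) :=
  [set A | exists M : R, forall z : cplx R, M%:C%C < `|z| -> A z].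

Definition conformal_map (R : realType) (U V : set (cplx R))
    (f : cplx R -> cplx R) : Prop :=
  set_bij U V f /\ forall z, U z -> derivable f z 1.

Definition simply_connected (R : realType) (U : set (cplx R)) : Prop :=
  connected U /\
  forall p : R -> cplx R,
    {within `[0, 1], continuous p} -> p @` `[0, 1] `<=` U -> p 0 = p 1 ->
    exists h : R * R -> cplx R,
      [/\ {within (`[0, 1] `*` `[0, 1])%classic, continuous h},
          h @` (`[0, 1] `*` `[0, 1])%classic `<=` U,
          (forall t, t \in `[0, 1] -> h (0, t) = p t /\ h (1, t) = p 0) &
          (forall s, s \in `[0, 1] -> h (s, 0) = p 0 /\ h (s, 1) = p 0)].

Definition brownian_motion d (T : measurableType d) (R : realType)
    (P : probability T R) (beta : R -> T -> R) : Prop :=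
  [/\ forall t, 0 <= t -> measurable_fun setT (beta t),
      {ae P, forall w, beta 0 w = 0 /\
         {within `[0, +oo[, continuous (fun t => beta t w)}},
      (forall s t, 0 <= s -> s < t -> forall A : set R, measurable A ->
         P [set w | A (beta t w - beta s w)] =
         normal_prob 0 (Num.sqrt (t - s)) A) &
      (forall (n : nat) (t : nat -> R) (A : nat -> set R),
         0 <= t 0%N -> {homo t : i j / (i <= j)%N >-> i <= j} ->
         (forall i, measurable (A i)) ->
         let E (i : nat) := [set w | A i (beta (t i.+1) w - beta (t i) w)] in
         P (\bigcap_(i in `I_n) E i) = (\prod_(i < n) P (E i))%E)].

Definition unbounded_component (R : realType) (A : set (cplx R)) :
    set (cplx R) :=
  [set z | A z /\ ~ bounded_set (connected_component A z)].

(* The domain of g_t, for the hull generated by the curve c up to time t. *)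
Definition sle_domain (R : realType) (kappa : R) (c : R -> cplx R) (t : R) :
    set (cplx R) :=
  let D := @upper_half_plane R `\` (c @` `[0, t]) in
  if kappa <= 4 then D else unbounded_component D.

(* At t = 0 the time derivative is one-sided, hence the condition
   [0 <= t + h]. *)
Definition loewner_flow (R : realType) (kappa : R) (c : R -> cplx R)
    (W : R -> R) (g : R -> cplx R -> cplx R) : Prop :=
  (forall z, upper_half_plane z -> g 0 z = z) /\
  forall t, 0 <= t ->
    let D := sle_domain kappa c t in
    [/\ conformal_map D (@upper_half_plane R) (g t),
        (g t z - z @[z --> within D (@complex_infty R)] --> (0 : cplx R)) &
        forall z, D z ->
          ((h^-1)%:C%C * (g (t + h) z - g t z) : cplx R)
            @[h --> within [set h : R | 0 <= t + h] 0^'] -->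
          (2 / (g t z - (W t)%:C%C) : cplx R)].

Definition chordal_SLE d (T : measurableType d) (R : realType)
    (P : probability T R) (kappa : R) (gamma : R -> T -> cplx R) : Prop :=
  [/\ (forall t, 0 <= t ->
         measurable_fun setT (fun w => complex.Re (gamma t w)) /\
         measurable_fun setT (fun w => complex.Im (gamma t w))),
      (forall w, [/\ {within `[0, +oo[, continuous (fun t => gamma t w)},
                     gamma 0 w = 0 &
                     forall t, 0 <= t -> 0 <= complex.Im (gamma t w)]),
      {ae P, forall w,
         (fun t => gamma t w) @ +oo `=>` @complex_infty R} &
      exists beta : R -> T -> R, brownian_motion P beta /\
        {ae P, forall w, exists g,
           loewner_flow kappa (fun t => gamma t w)
             (fun t => Num.sqrt kappa * beta t w) g}].

(* The starting point 0 lies on the boundary of the half-plane, so it is left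
   out of the random set: {gamma in H} means that gamma(t) is in H for all
   t > 0. *)
Definition open_trace (R : realType) (T : Type) (gamma : R -> T -> cplx R)
    (w : T) : set (cplx R) :=
  [set gamma t w | t in `]0, +oo[].

(* The sigma-algebra on subsets of the plane generated by the events
   "the random set hits K", K compact; the law of a curve considered up to time
   change is the law of its trace on this sigma-algebra. *)
Definition hitting_sigma_algebra (R : realType) : set (set (set (cplx R))) :=
  <<s [set E | exists2 K : set (cplx R), compact K &
                 E = [set X : set (cplx R) | X `&` K !=set0]] >>.

Definition restriction_domain (R : realType) (H : set (cplx R)) : Prop :=
  let A := @upper_half_plane R `\` H in
  [/\ open H, H `<=` @upper_half_plane R, simply_connected H,
      bounded_set A &
      exists2 r : R, 0 < r & forall z, A z -> r%:C%C <= `|z|].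

Definition restriction_map (R : realType) (H : set (cplx R))
    (Phi : cplx R -> cplx R) : Prop :=
  [/\ conformal_map (@upper_half_plane R) H Phi,
      (Phi z @[z --> within (@upper_half_plane R) (nbhs (0 : cplx R))]
         --> (0 : cplx R)) &
      ((Phi z / z : cplx R)
         @[z --> within (@upper_half_plane R) (@complex_infty R)]
         --> (1 : cplx R))].

(* [a] is the derivative at the boundary point 0, where Phi(0) = 0. *)
Definition boundary_derivative0 (R : realType) (Phi : cplx R -> cplx R)
    (a : R) : Prop :=
  (Phi z / z : cplx R) @[z --> within (@upper_half_plane R) (nbhs (0 : cplx R))]
    --> (a%:C%C : cplx R).

(* [Phi] is meaningful only on the half-plane, and the case where H is the whole
   half-plane says that the open trace almost surely stays there; intersecting
   with it discards the values of [Phi] elsewhere. *)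
Definition conformal_restriction d (T : measurableType d) (R : realType)
    (P : probability T R) (alpha : R) (gamma : R -> T -> cplx R) : Prop :=
  forall (H : set (cplx R)) (Phi : cplx R -> cplx R) (a : R),
    restriction_domain H -> restriction_map H Phi ->
    boundary_derivative0 Phi a ->
    let inH := [set w | open_trace gamma w `<=` H] in
    (forall E, hitting_sigma_algebra E ->
       fine (P ([set w | E (open_trace gamma w)] `&` inH)) / fine (P inH) =
       fine (P [set w |
         E (Phi @` (open_trace gamma w `&` @upper_half_plane R))])) /\
    P inH = (a `^ (- alpha))%:E.

Definition vertical_segment (R : realType) (x e : R) : set (cplx R) :=
  [set z | complex.Re z = x /\ 0 <= complex.Im z <= e * Num.sqrt 2].

Definition configuration (R : realType) (n : nat) (x : 'I_n -> R) : Prop :=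
  injective x /\ forall j, x j != 0.

Definition rescaled_hitting_prob d (T : measurableType d) (R : realType)
    (P : probability T R) (kappa : R) (gamma : R -> T -> cplx R)
    (n : nat) (x : 'I_n -> R) (e : 'rV[R]_n) : R :=
  (\prod_(j < n) e ord0 j `^ (- (8 / kappa - 1))) *
  fine (P (\bigcap_(j in [set: 'I_n])
    [set w | [set gamma t w | t in `[0, +oo[]
               `&` vertical_segment (x j) (e ord0 j) !=set0])).

Definition positive_to0 (R : realType) (n : nat) : set_system 'rV[R]_n :=
  within [set e : 'rV[R]_n | forall j, 0 < e ord0 j] (nbhs (0 : 'rV[R]_n)).

Definition correlation d (T : measurableType d) (R : realType)
    (P : probability T R) (kappa : R) (gamma : R -> T -> cplx R)
    (n : nat) (x : 'I_n -> R) : R :=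
  if n is 0%N then 1
  else lim (rescaled_hitting_prob P kappa gamma x e
              @[e --> @positive_to0 R n]).

(* The field R(x_1, ..., x_n); variable x_{j+1} is the one of index j : 'I_n. *)
Notation ratfun R n := {fraction (mpoly n R)}.

Definition ratseq (R : realType) : Type := forall n : nat, ratfun R n.

Definition rf_poly (R : realType) (n : nat) (p : mpoly n R) : ratfun R n :=
  tofrac p.

Definition rf_const (R : realType) (n : nat) (a : R) : ratfun R n :=
  rf_poly (mpolyC n a).

Definition rf_var (R : realType) (n : nat) (j : 'I_n) : ratfun R n :=
  rf_poly (mpolyX R (mnm1 j)).

Definition rf_value (R : realType) (n : nat) (f : ratfun R n) (x : 'I_n -> R)
    (v : R) : Prop :=
  exists p q : mpoly n R,
    [/\ f = rf_poly p / rf_poly q, meval x q != 0 & v = meval x p / meval x q].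

Definition rf_num (R : realType) (n : nat) (f : ratfun R n) : mpoly n R :=
  (frac (repr f)).1.

Definition rf_den (R : realType) (n : nat) (f : ratfun R n) : mpoly n R :=
  (frac (repr f)).2.

Definition rf_deriv (R : realType) (n : nat) (j : 'I_n) (f : ratfun R n) :
    ratfun R n :=
  let p := rf_num f in let q := rf_den f in
  rf_poly (mderiv j p * q - p * mderiv j q) / rf_poly q ^+ 2.

(* In n.+1 variables (x, x_1, ..., x_n) the expansion variable x has index
   [ord0]; [rf_shift] views a function of (x_1, ..., x_n) as a function of
   (x, x_1, ..., x_n). *)
Definition mpoly_shift (R : realType) (n : nat) (p : mpoly n R) :
    mpoly n.+1 R :=
  mmap (@mpolyC n.+1 R) (fun j : 'I_n => mpolyX R (mnm1 (lift ord0 j))) p.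

Definition rf_shift (R : realType) (n : nat) (f : ratfun R n) :
    ratfun R n.+1 :=
  rf_poly (mpoly_shift (rf_num f)) / rf_poly (mpoly_shift (rf_den f)).

Definition regular_at_x0 (R : realType) (n : nat) (f : ratfun R n.+1) : Prop :=
  exists p q : mpoly n.+1 R,
    f = rf_poly p / rf_poly q /\
    forall r : mpoly n.+1 R, q <> mpolyX R (mnm1 ord0) * r.

(* f = \sum_k c_k x^k as a Laurent series in x over R(x_1, ..., x_n), i.e. for
   x-adic convergence of the partial sums.  Every f has exactly one such
   expansion. *)
Definition laurent_expansion (R : realType) (n : nat) (f : ratfun R n.+1)
    (c : int -> ratfun R n) : Prop :=
  let x : ratfun R n.+1 := rf_var R ord0 in
  exists m : int,
    (forall k : int, k < m -> c k = 0) /\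
    forall N : nat,
      regular_at_x0
        ((f - \sum_(i < N) rf_shift (c (m + i%:Z)) * x ^ (m + i%:Z))
           / x ^ (m + N%:Z)).

Definition laurent_coef (R : realType) (n : nat) (f : ratfun R n.+1)
    (k : int) : ratfun R n :=
  xget (fun=> 0) [set c | laurent_expansion f c] k.

(* calL N is L_N: with N = - M, the summand is
   - x_j^(1-M) d_j + 2 (M - 1) x_j^(-M). *)
Definition calL (R : realType) (n : nat) (N : int) (f : ratfun R n) :
    ratfun R n :=
  let M := - N in
  \sum_(j < n) (- (rf_var R j ^ (1 - M) * rf_deriv j f)
                + (2 * (M - 1))%:~R * rf_var R j ^ (- M) * f).

(* l_{-M} takes the coefficient of x^(M-2). *)
Definition lop (R : realType) (N : int) (w : ratseq R) : ratseq R :=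
  fun n => let M := - N in laurent_coef (w n.+1) (M - 2).

Definition negative_sorted (Ns : seq int) : bool :=
  sorted (fun M N : int => M <= N) Ns && all (fun N : int => N < 0) Ns.

(* l_{N_1} ... l_{N_r} w; the empty list gives w. *)
Definition lops (R : realType) (Ns : seq int) (w : ratseq R) : ratseq R :=
  foldr (@lop R) w Ns.

(* The real span of B and of the l_{N_1} ... l_{N_r} B. *)
Definition generated_space (R : realType) (B : ratseq R) : set (ratseq R) :=
  [set w | exists s : seq (R * seq int),
     all (fun p => negative_sorted p.2) s /\
     forall n, w n = \sum_(p <- s) rf_const n p.1 * lops p.2 B n].

(* Main.v *)
Require Import Defs.
From HB Require Import structures.
From mathcomp Require Import all_boot all_order all_algebra.
From mathcomp Require Import fraction complex.
From mathcomp Require Import -(notations) mpoly.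
From mathcomp Require Import all_classical all_reals all_analysis.
From mathcomp Require Import ring lra zify.

(* Removing from the event "gamma hits the slits at x_1, ..., x_n" those curves
   that avoid a further slit at x of height delta * sqrt 2, and pushing the latter
   event through the conformal map removing that slit, restriction gives
     B_(n+1)(x, x_1, ..., x_n) =
       alpha / x^2 B_n - \sum_j (1 / (x_j - x) + 1 / x) d_j B_n
         + 2 \sum_j B_n / (x_j - x)^2,
   as the coefficient of delta^2.  Expanding in powers of x, the coefficients of
   B_(n+1) are the L_N B_n for N < 0, alpha B_n for N = 0 and 0 for N > 0: the
   action of the Witt algebra on a highest-weight vector of weight alpha, from
   which the three assertions follow by reordering words in the L_N.

   The analytic point is that a slit pulled back by a conformal map is not a slit.
   The curves that tell the two apart touch a box of size O(e^2) above the tip of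
   a slit of height e without touching the slit.  After removal of the slit that box
   is covered by O(e^(-1/2)) half-discs of radius O(e^(3/2)), each hit with
   probability O(radius^2), again by restriction and induction on the number of
   points; so the error O(e^(5/2)) is negligible against e^2. *)
Set Implicit Arguments.
Unset Strict Implicit.
Unset Printing Implicit Defensive.
Import Order.TTheory GRing.Theory Num.Theory numFieldNormedType.Exports.
Local Open Scope classical_set_scope.
Local Open Scope ring_scope.

(** * Rational functions *)

(** The heights of the slits tend to 0 one after another. With the first height e, or the radius r
    of a disc, already fixed, the asymptotics for the remaining points can be demanded with accuracy
    e^2 or r^2, although their rate depends on the maps applied so far. Hence the iterated limit
    [near_iter].

    Only slits and half-discs are ever removed, since their maps are explicit. Compositions are kept
    as lists of such maps, and the induction hypotheses quantify over all lists, so that they still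
    apply after a further removal.

    The estimates for n + 1 points use that the correlation functions of at most n points are
    locally Lipschitz. This follows from their rationality, which the identity yields in turn; one
    induction proves both.

    The exponent s = 8/kappa - 1 has to be compared with 2, the order to which restriction makes a
    short slit be hit. If s > 2 the one-point limit could not be finite. If s < 2 every correlation
    of at least one point vanishes, and B is given by the same recursion with weight 0 in place of
    alpha. *)

Lemma quotient_rule_add (F : fieldType) (a a' b b' c c' d d' : F) :
  b != 0 -> d != 0 ->
  ((a' * d + a * d' + (c' * b + c * b')) * (b * d)
     - (a * d + c * b) * (b' * d + b * d')) / (b * d) ^+ 2
  = (a' * b - a * b') / b ^+ 2 + (c' * d - c * d') / d ^+ 2.
Proof. by move=> b0 d0; field; apply/andP. Qed.

Lemma quotient_rule_mul (F : fieldType) (a a' b b' c c' d d' : F) :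
  b != 0 -> d != 0 ->
  ((a' * c + a * c') * (b * d) - (a * c) * (b' * d + b * d')) / (b * d) ^+ 2
  = (a' * b - a * b') / b ^+ 2 * (c / d) + a / b * ((c' * d - c * d') / d ^+ 2).
Proof. by move=> b0 d0; field; apply/andP. Qed.

Definition derivation (F : fieldType) (D : F -> F) : Prop :=
  (forall f g, D (f + g) = D f + D g) /\
  (forall f g, D (f * g) = D f * g + f * D g).

Section Derivations.
Variables (F : fieldType) (D : F -> F).
Hypothesis dD : derivation D.

Lemma derD f g : D (f + g) = D f + D g. Proof. exact: dD.1. Qed.
Lemma derM f g : D (f * g) = D f * g + f * D g. Proof. exact: dD.2. Qed.

Lemma der0 : D 0 = 0.
Proof. by apply: (addrI (D 0)); rewrite -derD !addr0. Qed.

Lemma derN f : D (- f) = - D f.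
Proof. by apply/eqP; rewrite -addr_eq0 -derD addNr der0. Qed.

Lemma derB f g : D (f - g) = D f - D g.
Proof. by rewrite derD derN. Qed.

Lemma der1 : D 1 = 0.
Proof.
by apply: (addrI (D 1)); rewrite addr0 -{3}[1]mulr1 derM mulr1 mul1r.
Qed.

Lemma der_int (k : int) : D k%:~R = 0.
Proof.
have hn (m : nat) : D m%:R = 0.
  by elim: m => [|m IH]; rewrite ?der0 // -natr1 derD IH der1 addr0.
by case: k => m; rewrite ?NegzE ?mulrNz ?derN -pmulrn hn ?oppr0.
Qed.

Lemma der_sum (I : Type) (r : seq I) (P : pred I) (G : I -> F) :
  D (\sum_(i <- r | P i) G i) = \sum_(i <- r | P i) D (G i).
Proof. exact: (big_morph _ derD der0). Qed.

Lemma derV f : f != 0 -> D f^-1 = - D f / f ^+ 2.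
Proof.
move=> f0; have : D (f * f^-1) = 0 by rewrite mulfV // der1.
rewrite derM => /eqP; rewrite addr_eq0 => /eqP e.
apply: (mulfI f0); apply: oppr_inj; rewrite -e mulNr mulrN opprK.
by rewrite mulrCA; congr (_ * _); rewrite expr2 invfM mulrA mulfV // mul1r.
Qed.

Lemma derXn f (k : nat) : D (f ^+ k) = k%:R * f ^+ k.-1 * D f.
Proof.
elim: k => [|k IH]; first by rewrite expr0 der1 !mul0r.
rewrite exprS derM IH; case: k {IH} => [|k]; first by rewrite !expr0 /=; ring.
by rewrite -pred_Sn -[k.+2%:R]natr1 exprS; ring.
Qed.

Lemma derXz f (k : int) : f != 0 -> D (f ^ k) = k%:~R * f ^ (k - 1) * D f.
Proof.
move=> f0; case: k => k.
  case: k => [|k]; first by rewrite expr0z der1 !mul0r.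
  by rewrite -exprnP derXn /= -addn1 PoszD addrK.
rewrite NegzE -exprnN derV ?expf_neq0 // derXn /= mulrNz -pmulrn.
have -> : - (k.+1 : int) - 1 = - (k.+2 : int) by rewrite -opprD -PoszD addn1.
by rewrite -exprnN !exprS; field; rewrite f0 expf_neq0.
Qed.
End Derivations.

(** Carries commutation from polynomials over to fractions: after two quotient rules every term is
    symmetric in [D] and [D'], except those in the second derivatives of p and q, which agree by
    hypothesis. *)
Lemma derivation_comm_div (F : fieldType) (D D' : F -> F) (p q : F) :
  derivation D -> derivation D' -> q != 0 ->
  D (D' p) = D' (D p) -> D (D' q) = D' (D q) ->
  D (D' (p / q)) = D' (D (p / q)).
Proof.
move=> dD dD' q0 ep eq.
rewrite !(derM dD, derM dD') (derV dD) // (derV dD') //.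
rewrite !(derD dD, derD dD', derM dD, derM dD') !(derN dD, derN dD').
have q2 : q ^+ 2 != 0 by rewrite expf_neq0.
have e2 E : derivation E -> E (q ^+ 2)^-1 = - (2 * q * E q) / (q ^+ 2) ^+ 2.
  by move=> dE; rewrite (derV dE) // (derXn dE) expr1.
rewrite (e2 _ dD) (e2 _ dD') ep eq ?(derV dD q0) ?(derV dD' q0).
by field.
Qed.

Section RationalFunctions.
Variable R : realType.

Section FixedArity.
Variable n : nat.
Implicit Types (p q : mpoly n R) (f g : ratfun R n) (j : 'I_n).

Lemma rf_polyD p q : rf_poly (p + q) = rf_poly p + rf_poly q.
Proof. exact: rmorphD. Qed.
Lemma rf_polyN p : rf_poly (- p) = - rf_poly p.
Proof. exact: rmorphN. Qed.
Lemma rf_polyB p q : rf_poly (p - q) = rf_poly p - rf_poly q.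
Proof. exact: rmorphB. Qed.
Lemma rf_polyM p q : rf_poly (p * q) = rf_poly p * rf_poly q.
Proof. exact: rmorphM. Qed.
Lemma rf_polyXn p k : rf_poly (p ^+ k) = rf_poly p ^+ k.
Proof. exact: rmorphXn. Qed.
Lemma rf_poly0 : rf_poly (0 : mpoly n R) = 0.
Proof. exact: rmorph0. Qed.
Lemma rf_poly1 : rf_poly (1 : mpoly n R) = 1.
Proof. exact: rmorph1. Qed.
Lemma rf_poly_eq0 p : (rf_poly p == 0) = (p == 0).
Proof. exact: tofrac_eq0. Qed.
Lemma rf_poly_inj : injective (@rf_poly R n).
Proof. by move=> p q /eqP; rewrite /rf_poly tofrac_eq => /eqP. Qed.

Lemma rf_den_neq0 f : rf_den f != 0.
Proof. exact: denom_ratioP. Qed.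

Lemma rf_numdenE f : f = rf_poly (rf_num f) / rf_poly (rf_den f).
Proof.
have den0 := rf_den_neq0 f.
have q0 : rf_poly (rf_den f) != 0 by rewrite rf_poly_eq0.
apply: (mulIf q0); rewrite mulfVK // /rf_poly.
have {1}-> : f = \pi_(ratfun R n)%qT (repr f) by rewrite reprK.
rewrite /rf_num /rf_den; move: (repr f) => -[[p q] hq] /=.
unlock FracField.tofrac; rewrite -[LHS]FracField.pi_mul; apply/eqmodP => /=.
rewrite FracField.equivfE /FracField.mulf !numden_Ratio ?mulf_neq0 ?oner_eq0 //.
by rewrite /= !mulr1 mulrC.
Qed.

Lemma rf_divP f : exists p q, q != 0 /\ f = rf_poly p / rf_poly q.
Proof. by exists (rf_num f), (rf_den f); rewrite rf_den_neq0 -rf_numdenE. Qed.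

Lemma rf_div_eq p q p' q' : q != 0 -> q' != 0 ->
  (rf_poly p / rf_poly q = rf_poly p' / rf_poly q') <-> p * q' = p' * q.
Proof.
move=> q0 q'0; split => [/eqP|e].
  by rewrite eqr_div ?rf_poly_eq0 // -!rf_polyM => /eqP /rf_poly_inj.
by apply/eqP; rewrite eqr_div ?rf_poly_eq0 // -!rf_polyM e.
Qed.

(** Independence of the representative: [rf_deriv] is computed on the chosen fraction N/D. The
    relation p D = N q together with its derivative turns one quotient rule into the other. *)
Lemma rf_deriv_div j p q : q != 0 ->
  rf_deriv j (rf_poly p / rf_poly q)
  = rf_poly (mderiv j p * q - p * mderiv j q) / rf_poly q ^+ 2.
Proof.
move=> q0; set f := _ / _; have := rf_numdenE f; rewrite /rf_deriv.
have := rf_den_neq0 f; move: (rf_num f) (rf_den f) => N D D0.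
move/(rf_div_eq _ _ q0 D0) => e; rewrite -!rf_polyXn.
apply/rf_div_eq; rewrite ?expf_neq0 // !expr2.
have e' : mderiv j p * D + p * mderiv j D = mderiv j N * q + N * mderiv j q.
  by rewrite -!mderivM e.
have -> : (mderiv j N * D - N * mderiv j D) * (q * q)
   = D * q * (mderiv j N * q) - N * q * (q * mderiv j D) by ring.
have -> : mderiv j N * q
   = mderiv j p * D + p * mderiv j D - N * mderiv j q by rewrite e' addrK.
have -> : D * q * (mderiv j p * D + p * mderiv j D - N * mderiv j q)
  = mderiv j p * q * D * D + (p * D) * q * mderiv j D - N * q * D * mderiv j q.
  by ring.
rewrite e -[N * q in X in _ - X - _]e. ring.
Qed.

Local Opaque rf_deriv.

Lemma mderiv1 j : mderiv j (1 : mpoly n R) = 0.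
Proof. by rewrite -[RHS](mderivC j 1) mpolyC1. Qed.

Lemma rf_deriv_poly j p : rf_deriv j (rf_poly p) = rf_poly (mderiv j p).
Proof.
rewrite -[rf_poly p]divr1 -rf_poly1 rf_deriv_div ?oner_neq0 //.
by rewrite mulr1 mderiv1 mulr0 subr0 rf_poly1 expr1n divr1.
Qed.

Lemma rf_derivD j f g : rf_deriv j (f + g) = rf_deriv j f + rf_deriv j g.
Proof.
have [p [q [q0 ->]]] := rf_divP f; have [p' [q' [q'0 ->]]] := rf_divP g.
rewrite addf_div ?rf_poly_eq0 // -!rf_polyM -rf_polyD.
rewrite !rf_deriv_div ?mulf_neq0 // mderivD !mderivM.
rewrite !(rf_polyB, rf_polyD, rf_polyM).
by rewrite quotient_rule_add ?rf_poly_eq0.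
Qed.

Lemma rf_derivM j f g :
  rf_deriv j (f * g) = rf_deriv j f * g + f * rf_deriv j g.
Proof.
have [p [q [q0 ->]]] := rf_divP f; have [p' [q' [q'0 ->]]] := rf_divP g.
rewrite mulf_div -!rf_polyM !rf_deriv_div ?mulf_neq0 // !mderivM.
rewrite !(rf_polyB, rf_polyD, rf_polyM).
by rewrite quotient_rule_mul ?rf_poly_eq0.
Qed.

Lemma rf_derivation j : derivation (@rf_deriv R n j).
Proof. by split; [exact: rf_derivD | exact: rf_derivM]. Qed.

Lemma rf_deriv_comm i j f :
  rf_deriv i (rf_deriv j f) = rf_deriv j (rf_deriv i f).
Proof.
have [p [q [q0 ->]]] := rf_divP f.
apply: derivation_comm_div; rewrite ?rf_poly_eq0 //; try exact: rf_derivation;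
  by rewrite !rf_deriv_poly mderiv_comm.
Qed.

Lemma rf_deriv_var i j : rf_deriv i (rf_var R j) = (i == j)%:R.
Proof.
rewrite /rf_var rf_deriv_poly mderivX mnmE eq_sym.
case: eqP => [->|_]; rewrite /= ?scale0r ?rf_poly0 // scale1r.
have -> : mnm_sub (mnm1 j) (mnm1 j) = mnm0 by apply/mnmP => k; rewrite mnmBE subnn mnm0E.
by rewrite mpolyX0 rf_poly1.
Qed.

Lemma rf_var_neq0 j : rf_var R j != 0.
Proof.
apply/eqP => x0; have := rf_deriv_var j j.
by rewrite x0 (der0 (rf_derivation j)) eqxx => /esym/eqP; rewrite oner_eq0.
Qed.

End FixedArity.

(** Induction in ring form: statements about morphisms, derivations and jets are thereby checked on
    constants and variables only. *)
Lemma mpoly_ring_ind n (Q : mpoly n R -> Prop) :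
  (forall c, Q (mpolyC n c)) -> (forall j, Q (mpolyX R (mnm1 j))) ->
  (forall p q, Q p -> Q q -> Q (p + q)) ->
  (forall p q, Q p -> Q q -> Q (p * q)) -> forall p, Q p.
Proof.
move=> QC QX QD QM; elim/mpolyind => [|c m p _ _ Qp].
  by rewrite -(mpolyC0 n R); apply: QC.
apply: (QD) => //; rewrite -mul_mpolyC; apply: (QM) => //.
rewrite (mpolyXE_id R m).
apply: (big_ind Q) => [|//|j _]; first by rewrite -(mpolyC1 n R); apply: QC.
elim: (m j) => [|k IH]; first by rewrite expr0 -(mpolyC1 n R); apply: QC.
by rewrite exprS; apply: QM.
Qed.

Section Shift.
Variable n : nat.
Implicit Types (p q : mpoly n R).

Lemma mpoly_shiftD p q : mpoly_shift (p + q) = mpoly_shift p + mpoly_shift q.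
Proof. exact: mmapD. Qed.
Lemma mpoly_shiftN p : mpoly_shift (- p) = - mpoly_shift p.
Proof. exact: mmapN. Qed.
Lemma mpoly_shiftM p q : mpoly_shift (p * q) = mpoly_shift p * mpoly_shift q.
Proof. exact: rmorphM. Qed.
Lemma mpoly_shiftC c : @mpoly_shift R n (mpolyC n c) = mpolyC n.+1 c.
Proof. exact: mmapC. Qed.
Lemma mpoly_shiftX j :
  @mpoly_shift R n (mpolyX R (mnm1 j)) = mpolyX R (mnm1 (lift ord0 j)).
Proof. by rewrite /mpoly_shift mmapX mmap1U. Qed.

(** Sets the expansion variable to 0 and renumbers the others, so that it is a retraction of
    [mpoly_shift]. *)
Definition mpoly_at0 (p : mpoly n.+1 R) : mpoly n R :=
  mmap (@mpolyC n R)
    (fun j => oapp (fun i => mpolyX R (mnm1 i)) 0 (unlift ord0 j)) p.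

Lemma mpoly_at0D (p q : mpoly n.+1 R) : mpoly_at0 (p + q) = mpoly_at0 p + mpoly_at0 q.
Proof. exact: mmapD. Qed.
Lemma mpoly_at0M (p q : mpoly n.+1 R) : mpoly_at0 (p * q) = mpoly_at0 p * mpoly_at0 q.
Proof. exact: rmorphM. Qed.
Lemma mpoly_at0C c : mpoly_at0 (mpolyC n.+1 c) = mpolyC n c.
Proof. exact: mmapC. Qed.
Lemma mpoly_at0X0 : mpoly_at0 (mpolyX R (mnm1 ord0)) = 0.
Proof. by rewrite /mpoly_at0 mmapX mmap1U unlift_none. Qed.
Lemma mpoly_at0X j :
  mpoly_at0 (mpolyX R (mnm1 (lift ord0 j))) = mpolyX R (mnm1 j).
Proof. by rewrite /mpoly_at0 mmapX mmap1U liftK. Qed.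

Lemma mpoly_shiftK p : mpoly_at0 (mpoly_shift p) = p.
Proof.
elim/mpoly_ring_ind: p => [c|j|p q ep eq|p q ep eq].
- by rewrite mpoly_shiftC mpoly_at0C.
- by rewrite mpoly_shiftX mpoly_at0X.
- by rewrite mpoly_shiftD mpoly_at0D ep eq.
- by rewrite mpoly_shiftM mpoly_at0M ep eq.
Qed.

Lemma mpoly_at0_decomp (p : mpoly n.+1 R) :
  exists r, p = mpoly_shift (mpoly_at0 p) + mpolyX R (mnm1 ord0) * r.
Proof.
elim/mpoly_ring_ind: p => [c|j|p q [r ep] [s eq]|p q [r ep] [s eq]].
- by exists 0; rewrite mpoly_at0C mpoly_shiftC mulr0 addr0.
- case: (unliftP ord0 j) => [k ->|->].
    by exists 0; rewrite mpoly_at0X mpoly_shiftX mulr0 addr0.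
  by exists 1; rewrite mpoly_at0X0 /mpoly_shift mmap0 add0r mulr1.
- exists (r + s); rewrite mpoly_at0D mpoly_shiftD {1}ep {1}eq mulrDr.
  by rewrite addrACA.
- exists (mpoly_shift (mpoly_at0 p) * s + r * q).
  rewrite mpoly_at0M mpoly_shiftM.
  move: (mpoly_shift _) (mpoly_shift _) ep eq => a b -> ->; ring.
Qed.

(** [regular_at_x0] speaks of divisibility by x. The value at x = 0 is multiplicative, which makes
    stability under products immediate. *)
Lemma mpoly_at0_eq0P (q : mpoly n.+1 R) :
  (forall r, q <> mpolyX R (mnm1 ord0) * r) <-> mpoly_at0 q != 0.
Proof.
split=> [qX|q0 r eq].
  apply/eqP => q0; have [r] := mpoly_at0_decomp q.
  by rewrite q0 {1}/mpoly_shift mmap0 add0r => /qX.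
by move: q0; rewrite eq mpoly_at0M mpoly_at0X0 mul0r eqxx.
Qed.

Lemma mderiv_shift j p :
  mderiv (lift ord0 j) (mpoly_shift p) = mpoly_shift (mderiv j p).
Proof.
elim/mpoly_ring_ind: p => [c|i|p q ep eq|p q ep eq].
- by rewrite mpoly_shiftC !mderivC /mpoly_shift mmap0.
- rewrite mpoly_shiftX; apply: rf_poly_inj.
  rewrite -rf_deriv_poly rf_deriv_var; apply/esym.
  rewrite mderivX mnmE (inj_eq (@lift_inj _ ord0)) eq_sym.
  case: eqP => [->|_]; rewrite ?scale0r ?scale1r /mpoly_shift ?mmap0 ?rf_poly0 //.
  have -> : mnm_sub (mnm1 i) (mnm1 i) = mnm0.
    by apply/mnmP => k; rewrite mnmBE subnn mnm0E.
  by rewrite mpolyX0 rmorph1 rf_poly1.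
- by rewrite mpoly_shiftD !mderivD ep eq mpoly_shiftD.
- by rewrite mpoly_shiftM !mderivM ep eq mpoly_shiftD !mpoly_shiftM.
Qed.

Lemma mderiv_shift0 p : mderiv ord0 (mpoly_shift p) = 0.
Proof.
elim/mpoly_ring_ind: p => [c|i|p q ep eq|p q ep eq].
- by rewrite mpoly_shiftC mderivC.
- by rewrite mpoly_shiftX; apply: rf_poly_inj; rewrite -rf_deriv_poly rf_deriv_var rf_poly0.
- by rewrite mpoly_shiftD mderivD ep eq addr0.
- by rewrite mpoly_shiftM mderivM ep eq mul0r mulr0 addr0.
Qed.

Lemma mpoly_shift_eq0 p : (mpoly_shift p == 0) = (p == 0).
Proof.
apply/eqP/eqP => [e|->]; last exact: mmap0.
by rewrite -(mpoly_shiftK p) e /mpoly_at0 mmap0.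
Qed.

Implicit Types f g : ratfun R n.

Lemma rf_shift_div p q : q != 0 ->
  rf_shift (rf_poly p / rf_poly q)
  = rf_poly (mpoly_shift p) / rf_poly (mpoly_shift q).
Proof.
move=> q0; rewrite /rf_shift; apply/rf_div_eq; rewrite ?mpoly_shift_eq0 ?rf_den_neq0 //.
rewrite -!mpoly_shiftM; congr mpoly_shift.
by apply/(rf_div_eq _ _ (rf_den_neq0 _) q0); rewrite -rf_numdenE.
Qed.

Lemma rf_shift_poly p : rf_shift (rf_poly p) = rf_poly (mpoly_shift p).
Proof.
rewrite -[rf_poly p]divr1 -rf_poly1 rf_shift_div ?oner_neq0 //.
by rewrite -[1](mpolyC1 n R) mpoly_shiftC mpolyC1 rf_poly1 divr1.
Qed.

Lemma rf_shift_is_zmod_morphism : zmod_morphism (@rf_shift R n).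
Proof.
move=> f g; have [p [q [q0 ->]]] := rf_divP f; have [p' [q' [q'0 ->]]] := rf_divP g.
rewrite -mulNr addf_div ?rf_poly_eq0 // -rf_polyN -!rf_polyM -rf_polyD.
rewrite !rf_shift_div ?mulf_neq0 // -mulNr addf_div ?rf_poly_eq0 ?mpoly_shift_eq0 //.
by rewrite !(mpoly_shiftD, mpoly_shiftM, mpoly_shiftN, rf_polyD, rf_polyM, rf_polyN).
Qed.

Lemma rf_shift_is_monoid_morphism : monoid_morphism (@rf_shift R n).
Proof.
split=> [|f g].
  by rewrite -rf_poly1 rf_shift_poly -[1](mpolyC1 n R) mpoly_shiftC mpolyC1 rf_poly1.
have [p [q [q0 ->]]] := rf_divP f; have [p' [q' [q'0 ->]]] := rf_divP g.
rewrite mulf_div -!rf_polyM !rf_shift_div ?mulf_neq0 // mulf_div.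
by rewrite !(mpoly_shiftM, rf_polyM).
Qed.

HB.instance Definition _ := GRing.isZmodMorphism.Build (ratfun R n)
  (ratfun R n.+1) (@rf_shift R n) rf_shift_is_zmod_morphism.
HB.instance Definition _ := GRing.isMonoidMorphism.Build (ratfun R n)
  (ratfun R n.+1) (@rf_shift R n) rf_shift_is_monoid_morphism.

Lemma rf_shift_var (j : 'I_n) : rf_shift (rf_var R j) = rf_var R (lift (@ord0 n) j).
Proof. by rewrite /rf_var rf_shift_poly mpoly_shiftX. Qed.

Lemma rf_deriv_shift (j : 'I_n) f :
  rf_deriv (lift ord0 j) (rf_shift f) = rf_shift (rf_deriv j f).
Proof.
have [p [q [q0 ->]]] := rf_divP f.
rewrite rf_shift_div // !rf_deriv_div ?mpoly_shift_eq0 //.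
rewrite -!rf_polyXn rf_shift_div ?expf_neq0 // !expr2.
by rewrite !(mpoly_shiftD, mpoly_shiftM, mpoly_shiftN) !mderiv_shift.
Qed.

Lemma rf_deriv_shift0 f : rf_deriv ord0 (rf_shift f) = 0.
Proof.
have [p [q [q0 ->]]] := rf_divP f.
rewrite rf_shift_div // rf_deriv_div ?mpoly_shift_eq0 //.
by rewrite !mderiv_shift0 mul0r mulr0 subr0 rf_poly0 mul0r.
Qed.

End Shift.

End RationalFunctions.

(** * Laurent expansions and the Witt algebra *)

Section LaurentSeries.
(** Abstract setting: [K] is the coefficient field, [F] the field of functions, [sh] the inclusion
    and [O] the local ring at x = 0. Uniqueness of expansions rests on [Oinj]: a constant over x is
    regular only if it is 0. *)
Variables (K F : fieldType) (sh : {rmorphism K -> F}) (x : F) (O : F -> Prop).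
Hypotheses (x0 : x != 0) (OD : forall f g, O f -> O g -> O (f + g))
  (OM : forall f g, O f -> O g -> O (f * g)) (Osh : forall a, O (sh a))
  (Ox : O x) (Oinj : forall a, O (sh a / x) -> a = 0).

Definition laurent_sum (c : int -> K) (m : int) (N : nat) : F :=
  \sum_(i < N) sh (c (m + i%:Z)) * x ^ (m + i%:Z).

Definition laurent_from (m : int) (f : F) (c : int -> K) : Prop :=
  (forall k : int, k < m -> c k = 0) /\
  forall N : nat, O ((f - laurent_sum c m N) / x ^ (m + N%:Z)).

(** The term added in front is zero, and the condition of index N + 1 from [m - 1] is the one of
    index N from [m]. Only index 0 is new, and it is a multiplication by x. Two expansions thus
    acquire a common starting exponent. *)
Lemma laurent_from_pred m f c : laurent_from m f c -> laurent_from (m - 1) f c.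
Proof.
move=> [c0 cO]; split=> [k km|[|N]]; first by apply: c0; lia.
  have := OM (cO 0%N) Ox; rewrite /laurent_sum !big_ord0 !subr0.
  have -> : x ^ m = x ^ (m - 1) * x by rewrite -[X in _ * X]expr1z -expfzDr // subrK.
  by rewrite invfM mulrA mulfVK.
rewrite /laurent_sum big_ord_recl /= [m - 1 + _]addr0 c0; last by lia.
rewrite rmorph0 mul0r add0r.
have -> : m - 1 + N.+1%:Z = m + N%:Z by lia.
have := cO N; rewrite /laurent_sum; congr (O ((_ - _) / _)).
by apply: eq_bigr => i _; rewrite /bump /=; congr (sh (c _) * x ^ _); lia.
Qed.

Lemma laurent_from_le m m' f c :
  m' <= m -> laurent_from m f c -> laurent_from m' f c.
Proof.
move=> mm'; have -> : m' = m - (absz (m - m')%R)%:Z by lia.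
elim: (absz _) => [|k IH] h; first by rewrite subr0.
by have := laurent_from_pred (IH h); congr laurent_from; lia.
Qed.

Definition laurent (f : F) (c : int -> K) : Prop := exists m, laurent_from m f c.

Lemma laurent_common f c g d : laurent f c -> laurent g d ->
  exists m, laurent_from m f c /\ laurent_from m g d.
Proof.
move=> [m hf] [m' hg]; exists (Num.min m m').
by split; [apply: laurent_from_le hf|apply: laurent_from_le hg];
  rewrite ge_min lexx ?orbT.
Qed.

Lemma laurentD f c g d : laurent f c -> laurent g d ->
  laurent (f + g) (fun k => c k + d k).
Proof.
move=> hf hg; have [m [[c0 cO] [d0 dO]]] := laurent_common hf hg.
exists m; split=> [k km|N]; first by rewrite c0 // d0 // addr0.
have := OD (cO N) (dO N); rewrite -mulrDl addrACA -opprD /laurent_sum -big_split.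
by congr (O ((_ - _) / _)); apply: eq_bigr => i _; rewrite rmorphD mulrDl.
Qed.

Lemma laurentZ a f c : laurent f c -> laurent (sh a * f) (fun k => a * c k).
Proof.
move=> [m [c0 cO]]; exists m; split=> [k km|N]; first by rewrite c0 // mulr0.
have := OM (Osh a) (cO N); rewrite mulrA mulrBr /laurent_sum big_distrr /=.
by congr (O ((_ - _) / _)); apply: eq_bigr => i _; rewrite rmorphM mulrA.
Qed.

Lemma laurentN f c : laurent f c -> laurent (- f) (fun k => - c k).
Proof.
move/(laurentZ (-1)); rewrite rmorphN1 mulN1r.
by congr (laurent _ _); apply/funext => k; rewrite mulN1r.
Qed.

Lemma laurentX j f c : laurent f c -> laurent (x ^ j * f) (fun k => c (k - j)).
Proof.
move=> [m [c0 cO]]; exists (m + j); split=> [k km|N]; first by apply: c0; lia.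
have := cO N; congr (O _); rewrite /laurent_sum.
have -> : x ^ (m + j + N%:Z) = x ^ j * x ^ (m + N%:Z).
  by rewrite -expfzDr //; congr (x ^ _); lia.
have xj0 : x ^ j != 0 by rewrite expfz_neq0.
rewrite invfM mulrA [in RHS]mulrBl; congr (_ / _).
have -> : \sum_(i < N) sh (c (m + j + i%:Z - j)) * x ^ (m + j + i%:Z)
   = x ^ j * \sum_(i < N) sh (c (m + i%:Z)) * x ^ (m + i%:Z).
  rewrite big_distrr /=; apply: eq_bigr => i _.
  rewrite mulrCA -expfzDr //; congr (sh (c _) * x ^ _); lia.
by rewrite -!mulrBl -mulrBr mulrAC mulfV // mul1r.
Qed.

Lemma laurent0 : laurent 0 (fun=> 0).
Proof.
exists 0; split=> // N; rewrite /laurent_sum big1 ?subrr ?mul0r; last first.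
  by move=> i _; rewrite rmorph0 mul0r.
by rewrite -(rmorph0 sh); apply: Osh.
Qed.

Lemma laurent_bigsum (I : Type) (r : seq I) (f : I -> F) (c : I -> int -> K) :
  (forall i, laurent (f i) (c i)) ->
  laurent (\sum_(i <- r) f i) (fun k => \sum_(i <- r) c i k).
Proof.
move=> h; elim: r => [|i r IH].
  rewrite big_nil (_ : (fun k => _) = fun=> 0); first exact: laurent0.
  by apply/funext => k; rewrite big_nil.
rewrite big_cons (_ : (fun k => _) = fun k => c i k + \sum_(i <- r) c i k).
  exact: laurentD.
by apply/funext => k; rewrite big_cons.
Qed.

(** The difference e expands 0. If all coefficients before e_k vanish, the partial sum through e_k
    shows that e_k / x is regular, and [Oinj] gives e_k = 0. *)
Lemma laurent_uniq f c d : laurent f c -> laurent f d -> c = d.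
Proof.
move=> hc /laurentN hd; have [m [e0 eO]] := laurentD hc hd; move: e0 eO.
rewrite subrr; set e := fun k => _ => e0 eO.
suff e_eq0 k : e k = 0 by apply/funext => k; have /eqP := e_eq0 k; rewrite subr_eq0 => /eqP.
have [/e0//|mk] := ltP k m; have -> : k = m + (absz (k - m)%R)%:Z by lia.
move: (absz _) => {mk k} i.
elim/ltn_ind: i => i IH; apply: Oinj; rewrite -[_ / _]opprK.
have := OM (Osh (-1)) (eO i.+1); congr (O _).
rewrite /laurent_sum big_ord_recr big1 /=; last by move=> j _; rewrite IH // rmorph0 mul0r.
rewrite rmorphN1 mulN1r !add0r; congr (- _); rewrite mulNr; congr (- _).
have -> : m + i.+1%:Z = m + i%:Z + 1 by lia.
have -> : x ^ (m + i%:Z + 1) = x ^ (m + i%:Z) * x by rewrite expfzDr // expr1z.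
by rewrite invfM mulrA mulfK // expfz_neq0.
Qed.

Lemma laurent_deriv (D : F -> F) (d : K -> K) f c :
  derivation D -> derivation d -> (forall g, O g -> O (D g)) ->
  D x = 0 -> (forall a, D (sh a) = sh (d a)) ->
  laurent f c -> laurent (D f) (fun k => d (c k)).
Proof.
move=> dD dd OdD Dx Dsh [m [c0 cO]]; exists m; split=> [k km|N].
  by rewrite c0 // der0.
have Dxk k : D (x ^ k) = 0 by rewrite derXz // Dx mulr0.
have Dxk' k : D (x ^ k)^-1 = 0.
  by rewrite derV ?expfz_neq0 // Dxk oppr0 mul0r.
have := OdD _ (cO N); rewrite (derM dD) Dxk' mulr0 addr0 (derB dD).
congr (O ((_ - _) / _)); rewrite /laurent_sum (der_sum dD).
by apply: eq_bigr => i _; rewrite (derM dD) Dxk mulr0 addr0 Dsh.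
Qed.

(** Differentiating the remainder r x^(m + N) costs one power of x; starting the expansion at m - 1
    absorbs the loss. *)
Lemma laurent_derivx (D : F -> F) f c :
  derivation D -> (forall g, O g -> O (D g)) ->
  D x = 1 -> (forall a, D (sh a) = 0) ->
  laurent f c -> laurent (D f) (fun k => (k + 1)%:~R * c (k + 1)).
Proof.
move=> dD OdD Dx Dsh [m [c0 cO]]; exists (m - 1); split=> [k km|N].
  by rewrite c0 ?mulr0 //; lia.
set r := (f - laurent_sum c m N) / x ^ (m + N%:Z).
have xk k : x ^ k != 0 by rewrite expfz_neq0.
have ef : f = laurent_sum c m N + r * x ^ (m + N%:Z).
  by rewrite /r divfK // addrC subrK.
have eD : D (laurent_sum c m N) = laurent_sum (fun k => (k + 1)%:~R * c (k + 1)) (m - 1) N.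
  rewrite /laurent_sum (der_sum dD); apply: eq_bigr => i _.
  rewrite (derM dD) Dsh mul0r add0r derXz // Dx mulr1 rmorphM rmorph_int.
  have -> : m - 1 + i%:Z + 1 = m + i%:Z by lia.
  have -> : m - 1 + i%:Z = m + i%:Z - 1 by lia.
  by rewrite mulrCA mulrA.
have Df : D f = laurent_sum (fun k => (k + 1)%:~R * c (k + 1)) (m - 1) N
    + (D r * x ^ (m + N%:Z) + r * ((m + N%:Z)%:~R * x ^ (m + N%:Z - 1))).
  by rewrite {1}ef (derD dD) eD (derM dD) (derXz dD) // Dx mulr1.
have -> : m - 1 + N%:Z = m + N%:Z - 1 by lia.
have xE : x ^ (m + N%:Z) = x ^ (m + N%:Z - 1) * x.
  by rewrite -[X in _ * X]expr1z -expfzDr // subrK.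
rewrite Df addrC addrA addNr add0r xE.
have e (u v w y z : F) : y != 0 -> (u * (y * v) + w * (z * y)) / y = u * v + z * w.
  by move=> y0; field.
rewrite e ?xk //.
rewrite -(rmorph_int sh).
apply: (OD); apply: (OM) => //; first exact/OdD/cO.
exact: cO.
Qed.

(** The remainder after M terms is exactly x^M a^(-M) / (a - x), hence regular once divided by
    x^M. *)
Lemma laurent_geometric a : a != 0 -> O (sh a - x)^-1 -> sh a - x != 0 ->
  laurent (sh a - x)^-1 (fun k => if 0 <= k then a ^ (- (k + 1)) else 0).
Proof.
move=> a0 Oa ax0; exists 0; split=> [k k0|N]; first by rewrite leNgt k0.
have sa0 : sh a != 0 by rewrite fmorph_eq0.
pose c (k : int) := if 0 <= k then a ^ (- (k + 1)) else 0.
have cE (i : nat) : sh (c i%:Z) = (sh a ^+ i.+1)^-1.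
  by rewrite /c /= addrC -intS -exprnN fmorphV rmorphXn.
suff e M : ((sh a - x)^-1 - laurent_sum c 0 M) / x ^+ M
   = sh (a ^+ M)^-1 * (sh a - x)^-1 by rewrite add0r [_ / _]e; apply: OM.
rewrite fmorphV rmorphXn.
elim: M => [|M IH].
  by rewrite /laurent_sum big_ord0 subr0 !expr0 invr1 mulr1 mul1r.
have {}IH : (sh a - x)^-1 - laurent_sum c 0 M = (sh a ^+ M)^-1 / (sh a - x) * x ^+ M.
  by rewrite -IH mulfVK // expf_neq0.
rewrite /laurent_sum big_ord_recr /= opprD addrA.
rewrite [X in X - _]IH add0r cE -exprnP !exprS.
have := expf_neq0 M x0; have := expf_neq0 M sa0.
move: (x ^+ M) (sh a ^+ M) => u v v0 u0.
by field; rewrite ?ax0 ?x0 ?sa0 ?u0 ?v0.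
Qed.
End LaurentSeries.

(** * Vector fields x^(N+1) d/dx acting in several variables *)

Section Witt.
Variables (F : fieldType) (n : nat) (x : 'I_n -> F) (D : 'I_n -> F -> F).
Hypotheses (dD : forall j, derivation (D j)) (x0 : forall j, x j != 0)
  (Dx : forall i j, D i (x j) = (i == j)%:R)
  (DC : forall i j f, D i (D j f) = D j (D i f)).

(** Lie derivative of a quadratic differential along - x^(N+1) d/dx, in the variable of index j. The
    uncancelled [- - N] makes [calLE] hold by conversion. *)
Definition vfield (N : int) (j : 'I_n) (f : F) : F :=
  - (x j ^ (1 - - N) * D j f) + (2 * (- N - 1))%:~R * x j ^ (- - N) * f.

Lemma vfieldD N j f g : vfield N j (f + g) = vfield N j f + vfield N j g.
Proof. by rewrite /vfield (derD (dD j)); ring. Qed.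

Lemma vfield0 N j : vfield N j 0 = 0.
Proof. by rewrite /vfield (der0 (dD j)) !mulr0 oppr0 addr0. Qed.

Lemma vfieldZ N j c f : D j c = 0 -> vfield N j (c * f) = c * vfield N j f.
Proof. by move=> Dc; rewrite /vfield (derM (dD j)) Dc; ring. Qed.

Lemma vfield_comm i j M N f : i != j ->
  vfield M i (vfield N j f) = vfield N j (vfield M i f).
Proof.
move=> ij.
have Dxz k l z : k != l -> D k (x l ^ z) = 0.
  by move=> kl; rewrite (derXz (dD k)) // Dx (negbTE kl) mulr0.
have ji : j != i by rewrite eq_sym.
rewrite /vfield !(derD (dD _), derM (dD _), derN (dD _)) !Dxz // !(der_int (dD _)).
rewrite (DC j i); ring.
Qed.

Lemma vfield_bracket j M N f :
  vfield M j (vfield N j f) - vfield N j (vfield M j f)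
  = (M - N)%:~R * vfield (M + N) j f.
Proof.
(* Integer powers of the variable are turned into atoms p with D p = L p / x, after which the
   bracket is an identity of rational expressions. *)
have h (L : int) : exists p,
    [/\ x j ^ (1 - - L) = x j * p, x j ^ (- - L) = p
      & D j p = L%:~R * p / x j].
  exists (x j ^ L); rewrite !opprK expfzDr // expr1z; split=> //.
  rewrite (derXz (dD j)) // Dx eqxx mulr1 -mulrA; congr (_ * _).
  by rewrite expfzDr // exprN1.
have [p [p1 p2 Dp]] := h M; have [q [q1 q2 Dq]] := h N.
have r1 : x j ^ (1 - - (M + N)) = x j * (p * q).
  rewrite -p2 -q2 !opprK expfzDr // expfzDr // expr1z; ring.
have r2 : x j ^ (- - (M + N)) = p * q by rewrite -p2 -q2 !opprK expfzDr.
rewrite /vfield p1 p2 q1 q2 r1 r2.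
rewrite !(derD (dD _), derM (dD _), derN (dD _)) !(der_int (dD _)) Dp Dq.
rewrite Dx eqxx; move: (D j (D j f)) (D j f) (x0 j) => u v.
rewrite !(rmorphM, rmorphD, rmorphN, rmorph1) /=.
move: (x j) (M%:~R) (N%:~R) => X a b X0.
by field.
Qed.

Definition vfields N f := \sum_(j < n) vfield N j f.

Lemma vfieldsD N f g : vfields N (f + g) = vfields N f + vfields N g.
Proof. by rewrite -big_split; apply: eq_bigr => j _; rewrite vfieldD. Qed.

Lemma vfieldsZ N c f :
  (forall j, D j c = 0) -> vfields N (c * f) = c * vfields N f.
Proof. by move=> Dc; rewrite /vfields big_distrr; apply: eq_bigr => j _; rewrite vfieldZ. Qed.

(** Vector fields in distinct variables commute, so only the diagonal of the double sum survives. *)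
Lemma vfields_bracket M N f :
  vfields M (vfields N f) - vfields N (vfields M f)
  = (M - N)%:~R * vfields (M + N) f.
Proof.
have sumE A B g : vfields A (vfields B g)
   = \sum_(i < n) \sum_(j < n) vfield A i (vfield B j g).
  by apply: eq_bigr => i _;
    apply: (big_morph _ (fun f g => vfieldD A i f g) (vfield0 A i)).
rewrite !sumE [X in _ - X]exchange_big -sumrB /vfields big_distrr.
apply: eq_bigr => i _; rewrite -sumrB (bigD1 i) //= vfield_bracket big1 ?addr0 //.
by move=> j ji; rewrite vfield_comm ?subrr // eq_sym.
Qed.
End Witt.

Lemma divf_neq0 (F : fieldType) (a b : F) : a != 0 -> b != 0 -> a / b != 0.
Proof. by move=> a0 b0; rewrite mulf_neq0 ?invr_eq0. Qed.

(** * The local ring at x = 0 of the field of rational functions *)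

Section RegularRing.
Variables (R : realType) (n : nat).
Implicit Types f g : ratfun R n.+1.
Let x : ratfun R n.+1 := rf_var R ord0.
Let O := @regular_at_x0 R n.

Lemma regularP f : O f <-> exists p q, f = rf_poly p / rf_poly q /\ mpoly_at0 q != 0.
Proof.
by split=> -[p [q [e h]]]; exists p, q; split=> //; apply/mpoly_at0_eq0P.
Qed.

Lemma mpoly_at0_neq0 (q : mpoly n.+1 R) : mpoly_at0 q != 0 -> q != 0.
Proof. by apply: contraNneq => ->; rewrite /mpoly_at0 mmap0. Qed.

Lemma regularD f g : O f -> O g -> O (f + g).
Proof.
move=> /regularP[p [q [-> q0]]] /regularP[p' [q' [-> q'0]]]; apply/regularP.
exists (p * q' + p' * q), (q * q'); rewrite mpoly_at0M mulf_neq0 //; split=> //.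
by rewrite addf_div ?rf_poly_eq0 ?mpoly_at0_neq0 // rf_polyD !rf_polyM.
Qed.

Lemma regularM f g : O f -> O g -> O (f * g).
Proof.
move=> /regularP[p [q [-> q0]]] /regularP[p' [q' [-> q'0]]]; apply/regularP.
exists (p * p'), (q * q'); rewrite mpoly_at0M mulf_neq0 //; split=> //.
by rewrite mulf_div !rf_polyM.
Qed.

Lemma regular_shift (a : ratfun R n) : O (rf_shift a).
Proof.
have [p [q [q0 ->]]] := rf_divP a; apply/regularP.
by exists (mpoly_shift p), (mpoly_shift q); rewrite rf_shift_div // mpoly_shiftK.
Qed.

Lemma regular_var : O x.
Proof.
apply/regularP; exists (mpolyX R (mnm1 ord0)), 1; rewrite rf_poly1 divr1.
by split=> //; rewrite -(mpolyC1 n.+1 R) mpoly_at0C mpolyC1 oner_neq0.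
Qed.

(** After clearing denominators, p q' = p' q x. Setting x = 0 leaves p q'(0) = 0 with q'(0)
    nonzero. *)
Lemma regular_shift_div_var (a : ratfun R n) : O (rf_shift a / x) -> a = 0.
Proof.
have [p [q [q0 ->]]] := rf_divP a.
rewrite rf_shift_div // => /regularP[p' [q' [e q'0]]].
have {e} : rf_poly (mpoly_shift p) / rf_poly (mpoly_shift q * mpolyX R (mnm1 ord0))
   = rf_poly p' / rf_poly q' by rewrite -e rf_polyM invfM mulrA.
have X0 : mpolyX R (mnm1 (@ord0 n)) != 0 by rewrite -rf_poly_eq0; apply: rf_var_neq0.
have qX0 : mpoly_shift q * mpolyX R (mnm1 ord0) != 0 by rewrite mulf_neq0 ?mpoly_shift_eq0.
move/(rf_div_eq _ _ qX0 (mpoly_at0_neq0 q'0)) /(congr1 (@mpoly_at0 R n)).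
rewrite !mpoly_at0M mpoly_at0X0 !mpoly_shiftK !mulr0 => /eqP.
rewrite mulf_eq0 (negbTE q'0) orbF => /eqP ->.
by rewrite rf_poly0 mul0r.
Qed.

Lemma regular_deriv j f : O f -> O (rf_deriv j f).
Proof.
move=> /regularP[p [q [-> q0]]]; rewrite rf_deriv_div ?mpoly_at0_neq0 //.
apply/regularP; exists (mderiv j p * q - p * mderiv j q), (q ^+ 2).
by rewrite rf_polyXn expr2 mpoly_at0M mulf_neq0.
Qed.

Lemma regular_shift_sub_var (a : ratfun R n) : a != 0 ->
  rf_shift a - x != 0 /\ O (rf_shift a - x)^-1.
Proof.
have [p [q [q0 ->]]] := rf_divP a => pq0.
have p0 : p != 0 by apply: contraNneq pq0 => ->; rewrite rf_poly0 mul0r.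
rewrite rf_shift_div //.
pose r := mpoly_shift p - mpolyX R (mnm1 ord0) * mpoly_shift q.
have r0 : mpoly_at0 r != 0.
  rewrite /r mpoly_at0D -mulNr mpoly_at0M mpoly_shiftK.
  by rewrite {1}/mpoly_at0 mmapN -[mmap _ _ _]/(mpoly_at0 _) mpoly_at0X0 oppr0 mul0r addr0.
have sq0 : rf_poly (mpoly_shift q) != 0 by rewrite rf_poly_eq0 mpoly_shift_eq0.
have -> : rf_poly (mpoly_shift p) / rf_poly (mpoly_shift q) - x
   = rf_poly r / rf_poly (mpoly_shift q).
  apply: (mulIf sq0); rewrite mulrBl !divfK // /r rf_polyB rf_polyM //.
have rr0 : rf_poly r != 0 by rewrite rf_poly_eq0 mpoly_at0_neq0.
split; first exact: divf_neq0 rr0 sq0.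
by apply/regularP; exists (mpoly_shift q), r; rewrite invf_div.
Qed.
End RegularRing.

(** * Expansions in x of the operators and of the recursion *)

Section Expansions.
Variables (R : realType) (n : nat).
Implicit Types (f g : ratfun R n.+1) (c : int -> ratfun R n).

Let x : ratfun R n.+1 := rf_var R ord0.
Let O := @regular_at_x0 R n.
Let x0 : x != 0. Proof. exact: rf_var_neq0. Qed.
Let OD := @regularD R n. Let OM := @regularM R n.
Let Osh := @regular_shift R n. Let Ox := @regular_var R n.
Let Oinj := @regular_shift_div_var R n.

(** [laurent_coef] picks an expansion by choice; by uniqueness any expansion that has been exhibited
    computes it. *)
Lemma laurent_coefE f c k : laurent_expansion f c -> laurent_coef f k = c k.
Proof.
move=> hc; rewrite /laurent_coef.
have hd : laurent_expansion f (xget (fun=> 0) [set d | laurent_expansion f d]).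
  by apply: (@xgetPex _ (fun=> 0) [set d | laurent_expansion f d]); exists c.
by rewrite (laurent_uniq x0 OD OM Osh Ox Oinj hd hc).
Qed.

Lemma expansionD f c g d : laurent_expansion f c -> laurent_expansion g d ->
  laurent_expansion (f + g) (fun k => c k + d k).
Proof. exact: (laurentD x0 OD OM Ox). Qed.

Lemma expansionN f c : laurent_expansion f c ->
  laurent_expansion (- f) (fun k => - c k).
Proof. exact: (laurentN OM Osh). Qed.

Lemma expansionZ a f c : laurent_expansion f c ->
  laurent_expansion (rf_shift a * f) (fun k => a * c k).
Proof. exact: (laurentZ OM Osh). Qed.

Lemma expansionX j f c : laurent_expansion f c ->
  laurent_expansion (x ^ j * f) (fun k => c (k - j)).
Proof. exact: (laurentX x0). Qed.

Lemma expansion0 : laurent_expansion (0 : ratfun R n.+1) (fun=> 0).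
Proof. exact: (laurent0 x Osh). Qed.

Lemma expansion_sum (I : Type) (r : seq I) (f : I -> ratfun R n.+1)
    (c : I -> int -> ratfun R n) :
  (forall i, laurent_expansion (f i) (c i)) ->
  laurent_expansion (\sum_(i <- r) f i) (fun k => \sum_(i <- r) c i k).
Proof. exact: (laurent_bigsum x0 OD OM Osh Ox). Qed.

Lemma expansion_deriv (j : 'I_n) f c : laurent_expansion f c ->
  laurent_expansion (rf_deriv (lift ord0 j) f) (fun k => rf_deriv j (c k)).
Proof.
move=> hf; have dD := rf_derivation R (lift (@ord0 n) j).
have Dx : rf_deriv (lift (@ord0 n) j) x = 0 by rewrite rf_deriv_var.
exact: (laurent_deriv x0 dD (rf_derivation R j) (@regular_deriv R n _) Dx
  (rf_deriv_shift j) hf).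
Qed.

Lemma expansion_deriv0 f c : laurent_expansion f c ->
  laurent_expansion (rf_deriv ord0 f) (fun k => (k + 1)%:~R * c (k + 1)).
Proof.
move=> hf; have Dx : rf_deriv (@ord0 n) x = 1 by rewrite rf_deriv_var.
exact: (laurent_derivx x0 OD OM Osh Ox (rf_derivation R ord0)
  (@regular_deriv R n _) Dx (@rf_deriv_shift0 R n) hf).
Qed.

Lemma expansion_geometric a : a != 0 ->
  laurent_expansion (rf_shift a - x)^-1
    (fun k => if 0 <= k then a ^ (- (k + 1)) else 0).
Proof.
move=> a0; have [sx0 Oa] := regular_shift_sub_var a0.
exact: (laurent_geometric x0 OM Osh a0 Oa sx0).
Qed.

Lemma expansion_shift (a : ratfun R n) :
  laurent_expansion (rf_shift a) (fun k : int => if k == 0 then a else 0).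
Proof.
exists 0; split=> [k|N]; first by case: eqP => // ->.
case: N => [|N].
  by rewrite big_ord0 subr0 expr0z divr1; apply: regular_shift.
rewrite big_ord_recl /= big1 => [|i _]; last by rewrite rmorph0 mul0r.
by rewrite expr0z mulr1 addr0 subrr mul0r -(rmorph0 (@rf_shift R n)); apply: regular_shift.
Qed.

Lemma calLE m N (f : ratfun R m) :
  calL N f = vfields (@rf_var R m) (@rf_deriv R m) N f.
Proof. by []. Qed.

(** In n + 1 variables L_N is its n-variable version plus the part in x. The latter multiplies x^(k
    - N) by - (k - N) - 2 (N + 1) and raises its exponent by N, which produces the factor - N - 2 -
    k. *)
Lemma expansion_calL N f c : laurent_expansion f c ->
  laurent_expansion (calL N f)
    (fun k => (- N - 2 - k)%:~R * c (k - N) + calL N (c k)).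
Proof.
move=> hf; rewrite /calL big_ord_recl.
have shX j z : rf_var R (lift ord0 j) ^ z = rf_shift (rf_var R j ^ z).
  by rewrite fmorphXz /= rf_shift_var.
have h0 := expansionD
  (expansionN (expansionX (1 - - N) (expansion_deriv0 hf)))
  (expansionZ (2 * (- N - 1))%:~R (expansionX (- - N) hf)).
have hj := expansionD h0 (expansion_sum (index_enum 'I_n) (fun j =>
  expansionD (expansionN (expansionZ (rf_var R j ^ (1 - - N)) (expansion_deriv j hf)))
   (expansionZ ((2 * (- N - 1))%:~R * rf_var R j ^ (- - N)) hf))).
move: hj; congr (laurent_expansion _ _).
  congr (_ + _ + _); first by rewrite rmorph_int [LHS]mulrA.
  by apply: eq_bigr => j _; rewrite !shX rmorphM rmorph_int.
apply/funext => k; congr (_ + _).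
have -> : k - (1 - - N) + 1 = k - N by lia.
have -> : k - - - N = k - N by lia.
have -> : - N - 2 - k = 2 * (- N - 1) - (k - N) by lia.
by rewrite [X in _ = X * _]intrB mulrBl addrC.
Qed.

(** Right-hand side of the recursion. The form [x ^ (-1) * rf_shift 1] of 1/x is the one whose
    expansion [expansionX] and [expansion_shift] deliver. *)
Definition ward (a : R) (f : ratfun R n) : ratfun R n.+1 :=
  x ^ (- 2) * rf_shift (rf_const n a * f)
  + \sum_(j < n)
     (- (rf_shift (rf_deriv j f) * ((rf_shift (rf_var R j) - x)^-1 + x ^ (-1) * rf_shift 1))
      + rf_shift (2 * f) * ((rf_shift (rf_var R j) - x)^-1) ^+ 2).

Definition vir_act m (a : R) (N : int) (f : ratfun R m) : ratfun R m :=
  if N < 0 then calL N f else if N == 0 then rf_const m a * f else 0.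

(** 1/(x_j - x)^2 is the x-derivative of 1/(x_j - x), so both come from the geometric series. The
    term 1/x supplies the coefficient at k = -1 that this series lacks, so that all k >= -1 follow
    the single formula of L_N with N = - (k + 2) < 0. At k = -2 only the term in [a] remains. *)
Lemma expansion_ward a (f : ratfun R n) :
  laurent_expansion (ward a f) (fun k => vir_act a (- (k + 2)) f).
Proof.
have hX j : rf_var R j != 0 :> ratfun R n by exact: rf_var_neq0.
have sq j : rf_deriv ord0 (rf_shift (rf_var R j) - x)^-1
   = ((rf_shift (rf_var R j) - x)^-1) ^+ 2.
  have [sx0 _] := regular_shift_sub_var (hX j).
  rewrite (derV (rf_derivation R _)) // (derB (rf_derivation R _)) rf_deriv_shift0.
  by rewrite rf_deriv_var eqxx sub0r opprK mul1r exprVn.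
have h := expansionD
  (expansionX (- 2) (expansion_shift (rf_const n a * f)))
  (expansion_sum (index_enum 'I_n) (fun j =>
    expansionD (expansionN (expansionZ (rf_deriv j f)
      (expansionD (expansion_geometric (hX j)) (expansionX (-1) (expansion_shift 1)))))
      (expansionZ (2 * f) (expansion_deriv0 (expansion_geometric (hX j)))))).
move: h; congr (laurent_expansion _ _).
  by rewrite /ward; congr (_ + _); apply: eq_bigr => j _; rewrite sq.
apply/funext => k; rewrite /vir_act.
have -> : (- (k + 2) < 0) = (- 1 <= k) by lia.
have -> : (- (k + 2) == 0) = (k == - 2) by lia.
have -> : (k - -2 == 0) = (k == - 2) by lia.
case: (leP (- 1) k) => k1.
  have -> : (k == -2) = false by lia.
  rewrite add0r; apply: eq_bigr => j _.
  have -> : (0 <= k + 1) by lia.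
  have -> : (k - -1 == 0) = ~~ (0 <= k) by lia.
  have -> : 1 - - - (k + 2) = - (k + 1) by lia.
  have -> : - - - (k + 2) = - (k + 1 + 1) by lia.
  have -> : 2 * (- - (k + 2) - 1) = 2 * (k + 1) by lia.
  congr (- _ + _); last by rewrite rmorphM /=; ring.
  case: ifP => k0 /=; rewrite ?addr0 ?add0r mulrC //.
  by have -> : - (k + 1) = 0 by lia.
rewrite big1 ?addr0 //= => j _.
have -> : (0 <= k) = false by lia.
have -> : (0 <= k + 1) = false by lia.
have -> : (k - -1 == 0) = false by lia.
by rewrite !(addr0, mulr0, oppr0).
Qed.
End Expansions.

(** Bookkeeping for [bracket_word]: the hypotheses are three brackets on the shorter word, and the
    conclusion is their combination as in the Jacobi identity. *)
Lemma jacobi_combination (F : fieldType) (k m n P Q l S U V W Z : F) :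
  P - Q = (m - (n + k)) * l -> S - U = (m + k - n) * l -> V - W = (m - n) * Z ->
  (n - k) * P + ((m - k) * S + V) - ((m - k) * U + ((n - k) * Q + W))
  = (m - n) * ((m + n - k) * l + Z).
Proof.
move=> /eqP; rewrite subr_eq => /eqP -> /eqP; rewrite subr_eq => /eqP -> /eqP.
by rewrite subr_eq => /eqP ->; ring.
Qed.

(** * The module of sequences generated by a highest-weight vector *)

Section Sequences.
Variable R : realType.
Implicit Types (w u v : ratseq R) (K M N : int) (Ns : seq int).

Lemma rf_constE n a : rf_const n a = rf_poly (mpolyC n a) :> ratfun R n.
Proof. by []. Qed.

Lemma rf_deriv_const n (j : 'I_n) a : rf_deriv j (rf_const n a) = 0 :> ratfun R n.
Proof. by rewrite rf_constE rf_deriv_poly mderivC rf_poly0. Qed.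

Lemma rf_shift_const n a : rf_shift (rf_const n a) = rf_const n.+1 a :> ratfun R n.+1.
Proof. by rewrite /rf_const rf_shift_poly mpoly_shiftC. Qed.

Lemma rf_constM n a b : rf_const n (a * b) = rf_const n a * rf_const n b :> ratfun R n.
Proof. by rewrite /rf_const mpolyCM rf_polyM. Qed.

Lemma rf_const0 n : rf_const n 0 = 0 :> ratfun R n.
Proof. by rewrite /rf_const mpolyC0 rf_poly0. Qed.

Lemma rf_const1 n : rf_const n 1 = 1 :> ratfun R n.
Proof. by rewrite /rf_const mpolyC1 rf_poly1. Qed.

Lemma rf_const_int n (z : int) : rf_const n z%:~R = z%:~R :> ratfun R n.
Proof.
have hn m : rf_const n m%:R = m%:R :> ratfun R n.
  elim: m => [|m IH]; first exact: rf_const0.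
  by rewrite -!natr1 /rf_const mpolyCD rf_polyD mpolyC1 rf_poly1 -IH.
case: z => m; rewrite ?NegzE ?mulrNz -!pmulrn ?hn //.
by rewrite /rf_const mpolyCN rf_polyN -/(rf_const n _) hn.
Qed.

Lemma calLD n N (f g : ratfun R n) : calL N (f + g) = calL N f + calL N g.
Proof. by rewrite !calLE (vfieldsD _ (@rf_derivation R n)). Qed.

Lemma calLZ n N a (f : ratfun R n) :
  calL N (rf_const n a * f) = rf_const n a * calL N f.
Proof.
by rewrite !calLE (vfieldsZ _ (@rf_derivation R n)) // => j; rewrite rf_deriv_const.
Qed.

Lemma calLZint n N (z : int) (f : ratfun R n) :
  calL N (z%:~R * f) = z%:~R * calL N f.
Proof. by rewrite -(rf_const_int n z) calLZ. Qed.

Lemma calL0 n N : calL N (0 : ratfun R n) = 0.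
Proof. by apply: (addrI (calL N (0 : ratfun R n))); rewrite -calLD !addr0. Qed.

Lemma calLB n N (f g : ratfun R n) : calL N (f - g) = calL N f - calL N g.
Proof. by apply/eqP; rewrite eq_sym subr_eq -calLD subrK. Qed.

Lemma calL_bracket n M N (f : ratfun R n) :
  calL M (calL N f) - calL N (calL M f) = (M - N)%:~R * calL (M + N) f.
Proof.
rewrite !calLE; apply: vfields_bracket.
- exact: rf_derivation.
- exact: rf_var_neq0.
- exact: rf_deriv_var.
- exact: rf_deriv_comm.
Qed.

(** [lop] is computed through an exhibited expansion, so the existence of one is carried along for
    every sequence to which linearity of [lop] is applied. *)
Definition expandable w := forall n, exists c, laurent_expansion (w n.+1) c.

Lemma lopE w N n c :
  laurent_expansion (w n.+1) c -> lop N w n = c (- N - 2).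
Proof. by move=> h; rewrite /lop (laurent_coefE _ h). Qed.

Definition addw u v : ratseq R := fun n => u n + v n.
Definition scalew (a : R) w : ratseq R := fun n => rf_const n a * w n.
Definition calLw N w : ratseq R := fun n => calL N (w n).

Lemma expandable_add u v : expandable u -> expandable v -> expandable (addw u v).
Proof.
by move=> hu hv n; have [c hc] := hu n; have [d hd] := hv n;
  eexists; apply: expansionD; [exact: hc|exact: hd].
Qed.

Lemma expandable_scale a w : expandable w -> expandable (scalew a w).
Proof.
move=> hw n; have [c hc] := hw n; eexists; rewrite /scalew -rf_shift_const.
exact: expansionZ hc.
Qed.

Lemma expandable_calL N w : expandable w -> expandable (calLw N w).
Proof. by move=> hw n; have [c /(expansion_calL N) hc] := hw n; eexists; exact: hc. Qed.

Lemma lop_add N u v : expandable u -> expandable v ->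
  lop N (addw u v) = addw (lop N u) (lop N v).
Proof.
move=> hu hv; apply: functional_extensionality_dep => n.
have [c hc] := hu n; have [d hd] := hv n.
by rewrite /addw (lopE _ hc) (lopE _ hd); exact: (lopE _ (expansionD hc hd)).
Qed.

Lemma lop_scale N a w : expandable w -> lop N (scalew a w) = scalew a (lop N w).
Proof.
move=> hw; apply: functional_extensionality_dep => n; have [c hc] := hw n.
have h : laurent_expansion (scalew a w n.+1) (fun k => rf_const n a * c k).
  by rewrite /scalew -rf_shift_const; exact: expansionZ hc.
by rewrite (lopE N h) /scalew (lopE N hc).
Qed.

(** Moves l_K past a letter L_N of a word. By induction on words it then suffices to know how l_K
    acts on [B]. *)
Lemma lop_calL K N w : expandable w ->
  lop K (calLw N w)
  = addw (scalew (K - N)%:~R (lop (K + N) w)) (calLw N (lop K w)).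
Proof.
move=> hw; apply: functional_extensionality_dep => n; have [c hc] := hw n.
rewrite (lopE K (expansion_calL N hc : laurent_expansion (calLw N w n.+1) _)).
rewrite /addw /scalew /calLw !(lopE _ hc) rf_const_int.
have -> : - N - 2 - (- K - 2) = K - N by lia.
by have -> : - K - 2 - N = - (K + N) - 2 by lia.
Qed.

Lemma addwC u v : addw u v = addw v u.
Proof. by apply: functional_extensionality_dep => n; rewrite /addw addrC. Qed.

Lemma addwA u v w : addw u (addw v w) = addw (addw u v) w.
Proof. by apply: functional_extensionality_dep => n; rewrite /addw addrA. Qed.

Lemma calLw_add N u v : calLw N (addw u v) = addw (calLw N u) (calLw N v).
Proof. by apply: functional_extensionality_dep => n; rewrite /addw /calLw calLD. Qed.

Lemma calLw_scale N a w : calLw N (scalew a w) = scalew a (calLw N w).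
Proof. by apply: functional_extensionality_dep => n; rewrite /scalew /calLw calLZ. Qed.

Lemma calLw_swap M N w :
  calLw M (calLw N w)
  = addw (calLw N (calLw M w)) (scalew (M - N)%:~R (calLw (M + N) w)).
Proof.
apply: functional_extensionality_dep => n.
by rewrite /addw /scalew /calLw rf_const_int -calL_bracket addrC subrK.
Qed.

Section Module.
Variables (a : R) (B : ratseq R).
Hypothesis BS : forall n, B n.+1 = ward a (B n).

Definition word Ns : ratseq R := foldr calLw B Ns.

Definition lincomb (s : seq (R * seq int)) : ratseq R :=
  fun n => \sum_(p <- s) rf_const n p.1 * word p.2 n.

Definition negatives Ns := all (fun N => N < 0) Ns.

Lemma lincomb_cons p s :
  lincomb (p :: s) = addw (scalew p.1 (word p.2)) (lincomb s).
Proof. by apply: functional_extensionality_dep => n; rewrite /lincomb big_cons. Qed.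

Lemma lincomb_cat s t : lincomb (s ++ t) = addw (lincomb s) (lincomb t).
Proof. by apply: functional_extensionality_dep => n; rewrite /lincomb big_cat. Qed.

Lemma lincomb_nil n : lincomb [::] n = 0.
Proof. by rewrite /lincomb big_nil. Qed.

(* The span of the words [word Ns] whose list satisfies [S]. *)
Definition wspan (S : pred (seq int)) : set (ratseq R) :=
  [set w | exists2 s, all (fun p => S p.2) s & w = lincomb s].

Lemma wspan_add S u v : wspan S u -> wspan S v -> wspan S (addw u v).
Proof.
move=> [s hs ->] [t ht ->]; exists (s ++ t); first by rewrite all_cat hs.
by rewrite lincomb_cat.
Qed.

Lemma wspan_scale S b w : wspan S w -> wspan S (scalew b w).
Proof.
move=> [s hs ->]; exists [seq (b * p.1, p.2) | p <- s]; first by rewrite all_map.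
apply: functional_extensionality_dep => n; rewrite /scalew /lincomb big_map big_distrr /=.
by apply: eq_bigr => p _; rewrite rf_constM mulrA.
Qed.

Lemma wspan_word (S : pred (seq int)) Ns : S Ns -> wspan S (word Ns).
Proof.
move=> h; exists [:: (1, Ns)]; first by rewrite /= h.
apply: functional_extensionality_dep => n.
by rewrite /lincomb big_seq1 rf_const1 mul1r.
Qed.

Lemma wspan_ind (S : pred (seq int)) (Q : ratseq R -> Prop) :
  Q (fun n => 0) -> (forall b Ns u, S Ns -> wspan S u -> Q u ->
    Q (addw (scalew b (word Ns)) u)) -> forall w, wspan S w -> Q w.
Proof.
move=> Q0 QD w [s + ->]; elim: s => [|p s IH] /=.
  by move=> _; rewrite (_ : lincomb _ = fun n => 0) //;
    apply: functional_extensionality_dep => n; exact: lincomb_nil.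
by case/andP => hp hs; rewrite lincomb_cons; apply: QD => //; [exists s|apply: IH].
Qed.

Lemma wspan_sub (S S' : pred (seq int)) :
  (forall Ns, S Ns -> wspan S' (word Ns)) -> wspan S `<=` wspan S'.
Proof.
move=> h; apply: wspan_ind => [|b Ns u hN _ hu]; last first.
  by apply: wspan_add => //; apply: wspan_scale; apply: h.
by exists [::] => //; apply: functional_extensionality_dep => n; rewrite lincomb_nil.
Qed.

Lemma wspan_zero S : wspan S (fun n => 0).
Proof.
by exists [::] => //; apply: functional_extensionality_dep => n; rewrite lincomb_nil.
Qed.

Lemma expandable_B : expandable B.
Proof. by move=> n; rewrite BS; eexists; exact: expansion_ward. Qed.

Lemma expandable_word Ns : expandable (word Ns).
Proof. by elim: Ns => [|N Ns IH] /=; [exact: expandable_B|exact: expandable_calL]. Qed.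

Lemma expandable_zero : expandable (fun n => 0).
Proof. by move=> n; eexists; exact: expansion0. Qed.

Lemma expandable_wspan S w : wspan S w -> expandable w.
Proof.
move: w; apply: wspan_ind => [|b Ns u _ _ hu]; first exact: expandable_zero.
by apply: expandable_add => //; apply/expandable_scale/expandable_word.
Qed.

Lemma lop_B N : lop N B = fun n => vir_act a N (B n).
Proof.
apply: functional_extensionality_dep => n.
have h : laurent_expansion (B n.+1) (fun k => vir_act a (- (k + 2)) (B n)).
  by rewrite BS; exact: expansion_ward.
by rewrite (lopE _ h); congr vir_act; lia.
Qed.

Lemma lop_zero N : lop N (fun n => 0 : ratfun R n) = fun n => 0.
Proof.
apply: functional_extensionality_dep => n.
by rewrite (lopE (w := fun n => 0) N (expansion0 R n)).
Qed.

(** By [lop_calL], l_N L_M = L_M l_N + (N - M) l_(N+M). Since N + M is negative again, both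
    operators on the right act as L on the shorter word, and the right side is then L_N L_M by the
    bracket of the L's. *)
Lemma lop_word_neg N Ns : N < 0 -> negatives Ns ->
  lop N (word Ns) = calLw N (word Ns).
Proof.
elim: Ns N => [|M Ns IH] N N0 /=.
  by move=> _; rewrite lop_B; apply: functional_extensionality_dep => n; rewrite /vir_act N0.
case/andP => M0 hN; rewrite lop_calL; last exact: expandable_word.
have NM : N + M < 0 by lia.
by rewrite !IH // [RHS]calLw_swap addwC.
Qed.

Lemma calLw_zero N : calLw N (fun n => 0 : ratfun R n) = fun n => 0.
Proof. by apply: functional_extensionality_dep => n; rewrite /calLw calL0. Qed.

Lemma wspan_calL N w : N < 0 -> wspan negatives w -> wspan negatives (calLw N w).
Proof.
move=> N0; move: w; apply: wspan_ind => [|b Ns u hN _ hu].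
  by rewrite calLw_zero; exact: wspan_zero.
rewrite calLw_add calLw_scale; apply: wspan_add => //; apply: wspan_scale.
by apply: (@wspan_word negatives (N :: Ns)); rewrite /= N0.
Qed.

(** l_N is pushed to the right through the letters until it meets [B], where it yields a letter, a
    multiple of [B], or 0. *)
Lemma wspan_lop_word N Ns : negatives Ns -> wspan negatives (lop N (word Ns)).
Proof.
elim: Ns N => [|M Ns IH] N /=.
  move=> _; rewrite lop_B /vir_act; case: ltP => N0.
    by apply: (@wspan_word negatives [:: N]); rewrite /= N0.
  case: eqP => _; last exact: wspan_zero.
  by apply: wspan_scale; exact: (@wspan_word negatives [::]).
case/andP => M0 hN; rewrite lop_calL; last exact: expandable_word.
apply: wspan_add; first by apply: wspan_scale; exact: IH.
by apply: wspan_calL => //; exact: IH.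
Qed.

Lemma wspan_lop N w : wspan negatives w -> wspan negatives (lop N w).
Proof.
move: w; apply: wspan_ind => [|b Ns u hN hu IH]; first by rewrite lop_zero; exact: wspan_zero.
rewrite lop_add; last exact: expandable_wspan hu; last first.
  by apply/expandable_scale/expandable_word.
rewrite lop_scale; last exact: expandable_word.
by apply: wspan_add => //; apply: wspan_scale; exact: wspan_lop_word.
Qed.

Lemma lop_neg N w : N < 0 -> wspan negatives w -> lop N w = calLw N w.
Proof.
move=> N0; move: w; apply: wspan_ind => [|b Ns u hN hu IH].
  by rewrite lop_zero calLw_zero.
rewrite lop_add; last exact: expandable_wspan hu; last first.
  by apply/expandable_scale/expandable_word.
rewrite lop_scale; last exact: expandable_word.
by rewrite IH lop_word_neg // calLw_add calLw_scale.
Qed.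

Lemma lops_word Ns : negatives Ns -> lops Ns B = word Ns.
Proof.
elim: Ns => [//|N Ns IH] /= /andP[N0 hN].
by rewrite IH // lop_word_neg.
Qed.

Lemma word_foldr Ns n : word Ns n = foldr (@calL R n) (B n) Ns.
Proof. by elim: Ns => [//|N Ns IH] /=; rewrite /calLw IH. Qed.

Definition bracket M N w : ratseq R := fun n => lop M (lop N w) n - lop N (lop M w) n.

(** If one of the two indices is negative, that operator is an L on the words concerned and the
    claim is [lop_calL]. This settles the empty word up to two nonnegative indices; longer words
    follow by induction on their first letter. *)
Lemma bracket_word M N Ns : negatives Ns ->
  bracket M N (word Ns) = scalew (M - N)%:~R (lop (M + N) (word Ns)).
Proof.
have neg_case M' N' Ls : N' < 0 -> negatives Ls ->
    bracket M' N' (word Ls) = scalew (M' - N')%:~R (lop (M' + N') (word Ls)).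
  move=> N0 hL; rewrite /bracket.
  rewrite (lop_neg N0 (wspan_word hL)) (lop_neg N0 (wspan_lop_word M' hL)).
  rewrite lop_calL; last exact: expandable_word.
  by apply: functional_extensionality_dep => n; rewrite /addw addrK.
have anti M' N' w n : bracket M' N' w n = - bracket N' M' w n by rewrite /bracket opprB.
elim: Ns M N => [|K Ns IH] M N hN.
  have [N0|N0] := ltP N 0; first exact: neg_case.
  have [M0|M0] := ltP M 0.
    apply: functional_extensionality_dep => n; rewrite anti neg_case //.
    by rewrite /scalew !rf_const_int -mulNr -mulrNz opprB [N + M]addrC.
  (* Operators of nonnegative index act on [B] by scalars and so commute. The right side vanishes as
     well: either M = N, or M + N > 0 and l_(M+N) kills [B]. *)
  rewrite /bracket /=; apply: functional_extensionality_dep => n.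
  have lopz L w : lop L (fun n => rf_const n 0 * w n) = fun n => 0.
    rewrite -(lop_zero L); congr lop; apply: functional_extensionality_dep => m.
    by rewrite rf_const0 mul0r.
  have lopB L : 0 <= L -> lop L B = scalew (if L == 0 then a else 0) B.
    move=> L0; rewrite lop_B; apply: functional_extensionality_dep => m.
    by rewrite /vir_act ltNge L0 /= /scalew; case: eqP => _ //; rewrite rf_const0 mul0r.
  rewrite (lopB N) // (lopB M) // !lop_scale; try exact: expandable_B.
  rewrite (lopB N) // (lopB M) // (lopB (M + N)) ?addr_ge0 //.
  rewrite /scalew rf_const_int !mulrA [rf_const _ _ * rf_const _ _]mulrC subrr.
  have [->|MN] := eqVneq M N; first by rewrite subrr !mul0r.
  have -> : (M + N == 0) = false by lia.
  by rewrite rf_const0 mulr0 mul0r.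
have [hK hNs] := andP hN.
have ew := expandable_word Ns.
have el L := expandable_wspan (wspan_lop_word L hNs).
(* Both operators are moved past the first letter K. In the difference of the two orders, the terms
   group into three brackets on the shorter word. *)
have key L L' : lop L (lop L' (word (K :: Ns))) = addw
    (scalew (L' - K)%:~R (lop L (lop (L' + K) (word Ns))))
    (addw (scalew (L - K)%:~R (lop (L + K) (lop L' (word Ns))))
      (calLw K (lop L (lop L' (word Ns))))).
  rewrite /= lop_calL // lop_add; last first.
  - by apply/expandable_calL/el.
  - by apply/expandable_scale/el.
  rewrite lop_scale; last exact: el.
  by rewrite lop_calL.
apply: functional_extensionality_dep => n.
rewrite /bracket !key /= lop_calL //.
have e1 := congr1 (fun f => f n) (IH M (N + K) hNs).
have e2 := congr1 (fun f => f n) (IH (M + K) N hNs).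
have e3 := congr1 (fun f => calL K (f n)) (IH M N hNs).
move: e1 e2 e3; rewrite /bracket /addw /scalew /calLw !rf_const_int.
rewrite calLZint.
rewrite calLB.
have -> : M + (N + K) = M + N + K by lia.
have -> : M + K + N = M + N + K by lia.
rewrite !(intrB, intrD); exact: jacobi_combination.
Qed.

Lemma word_cat s t : word (s ++ t) = foldr calLw (word t) s.
Proof. by rewrite /word foldr_cat. Qed.

Lemma foldr_calLw_add s u v :
  foldr calLw (addw u v) s = addw (foldr calLw u s) (foldr calLw v s).
Proof. by elim: s => //= N s ->; rewrite calLw_add. Qed.

Lemma foldr_calLw_scale s b w :
  foldr calLw (scalew b w) s = scalew b (foldr calLw w s).
Proof. by elim: s => //= N s ->; rewrite calLw_scale. Qed.

Lemma word_swap s M N t : word (s ++ M :: N :: t)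
  = addw (word (s ++ N :: M :: t)) (scalew (M - N)%:~R (word (s ++ M + N :: t))).
Proof.
by rewrite !word_cat /= calLw_swap foldr_calLw_add foldr_calLw_scale.
Qed.

Fixpoint insertz (M : int) Ns : seq int :=
  if Ns is N :: s then if M <= N then M :: Ns else N :: insertz M s else [:: M].

Lemma insertz_sorted M Ns :
  sorted (fun M N : int => M <= N) Ns -> sorted (fun M N : int => M <= N) (insertz M Ns).
Proof.
elim: Ns => [//|N s IH] /= hs; case: leP => [MN|NM]; first by rewrite /= MN.
have := IH (path_sorted hs); case: s hs {IH} => [|L s] /=; first by rewrite (ltW NM).
by case/andP => NL hs; case: leP => ML /=; rewrite ?(ltW NM) ?NL.
Qed.

Lemma insertz_neg M Ns : M < 0 -> negatives Ns -> negatives (insertz M Ns).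
Proof.
move=> M0; elim: Ns => [|N s IH] /=; first by rewrite M0.
by case/andP => N0 hs; case: ifP => _ /=; rewrite ?M0 ?N0 ?IH.
Qed.

Lemma size_insertz M Ns : size (insertz M Ns) = (size Ns).+1.
Proof. by elim: Ns => [//|N s IH] /=; case: ifP => _ //=; rewrite IH. Qed.

Definition isortz Ns := foldr insertz [::] Ns.

Lemma isortz_sorted Ns : negatives Ns -> negative_sorted (isortz Ns).
Proof.
rewrite /negative_sorted; elim: Ns => [//|N s IH] /= /andP[N0 /IH /andP[h1 h2]].
by rewrite insertz_sorted //=; exact: insertz_neg.
Qed.

Lemma size_isortz Ns : size (isortz Ns) = size Ns.
Proof. by elim: Ns => [//|N s IH] /=; rewrite size_insertz IH. Qed.

(** Poincare-Birkhoff-Witt argument: exchanging two neighbouring letters changes a word by a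
    multiple of a shorter one, which lies in the sorted span by induction on the length. Insertion
    sort can therefore be carried out modulo that span. *)
Lemma wspan_sorted_word Ns : negatives Ns -> wspan negative_sorted (word Ns).
Proof.
move: {2}(size Ns) (leqnn (size Ns)) => k; elim: k Ns => [|k IH] Ns hk hN.
  by case: Ns hk hN => // _ _; exact: (@wspan_word negative_sorted [::]).
pose eqv u v := exists2 z, wspan negative_sorted z & u = addw v z.
have eqv_refl u : eqv u u.
  exists (fun n => 0); first exact: wspan_zero.
  by apply: functional_extensionality_dep => n; rewrite /addw addr0.
have eqv_trans v u z : eqv u v -> eqv v z -> eqv u z.
  move=> [p hp ->] [q hq ->]; exists (addw q p); first exact: wspan_add.
  by rewrite addwA.
have neg_cat s t : negatives (s ++ t) = negatives s && negatives t by exact: all_cat.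
(* The letter M travels to the right past the letters smaller than it, and the prefix s collects
   those already passed. *)
have ins s M t : (size (s ++ M :: t) <= k.+1)%N -> negatives (s ++ M :: t) ->
    eqv (word (s ++ M :: t)) (word (s ++ insertz M t)).
  elim: t s => [|N t IHt] s hs hn //=.
  case: ifP => // _.
  apply: (@eqv_trans (word (rcons s N ++ M :: t))); last first.
    rewrite -[s ++ N :: _]cat_rcons; apply: IHt.
      by move: hs; rewrite !size_cat size_rcons /= addSnnS.
    by move: hn; rewrite cat_rcons !neg_cat /= => /and4P[-> -> -> ->].
  rewrite cat_rcons word_swap.
  exists (scalew (M - N)%:~R (word (s ++ M + N :: t))) => //.
  apply: wspan_scale; apply: IH; first by move: hs; rewrite !size_cat /= addnS ltnS.
  move: hn; rewrite !neg_cat /= => /and4P[-> M0 N0 ->]; rewrite andbT /=; lia.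
have srt s t : (size (s ++ t) <= k.+1)%N -> negatives (s ++ t) ->
    eqv (word (s ++ t)) (word (s ++ isortz t)).
  elim: t s => [|M t IHt] s hs hn //=.
  apply: (@eqv_trans (word (s ++ M :: isortz t))); last first.
    apply: ins; first by move: hs; rewrite !size_cat /= size_isortz.
    move: hn; rewrite !neg_cat /= => /and3P[-> -> /isortz_sorted].
    by rewrite /negative_sorted => /andP[_].
  rewrite -cat_rcons -[s ++ M :: isortz t]cat_rcons; apply: IHt.
    by rewrite cat_rcons.
  by rewrite cat_rcons.
have [z hz ->] := srt [::] Ns hk hN.
by apply: wspan_add => //; apply: wspan_word; exact: isortz_sorted.
Qed.

(** Stability under l_N is evident for the span of all negative words, whereas the definition asks
    for sorted ones; the two spans agree. *)
Lemma generated_spaceE : generated_space B = wspan negatives.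
Proof.
have sortedN Ls : negative_sorted Ls -> negatives Ls by case/andP.
apply/seteqP; split => w.
  move=> [s [hs ew]]; exists s.
    by apply: sub_all hs => p /sortedN.
  apply: functional_extensionality_dep => n; rewrite ew /lincomb big_seq [RHS]big_seq.
  by apply: eq_bigr => p /(allP hs) /sortedN hp; rewrite lops_word.
move=> /(@wspan_sub negatives negative_sorted wspan_sorted_word)[s hs ->].
exists s; split=> // n; rewrite /lincomb big_seq [RHS]big_seq.
by apply: eq_bigr => p /(allP hs) /sortedN hp; rewrite lops_word.
Qed.

(** The algebraic half: the three assertions for any sequence obeying the recursion [BS] with weight
    [a]. It is applied below with the weight alpha and with the weight 0. *)
Theorem virasoro_module :
  [/\ forall Ns, negative_sorted Ns -> forall n, lops Ns B n = foldr (@calL R n) (B n) Ns,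
      forall N w, generated_space B w -> generated_space B (lop N w) &
      forall M N w, generated_space B w -> forall n,
        lop M (lop N w) n - lop N (lop M w) n = (M - N)%:~R * lop (M + N) w n].
Proof.
rewrite generated_spaceE; split.
- by move=> Ns /andP[_ hN] n; rewrite lops_word // word_foldr.
- exact: wspan_lop.
move=> M N; suff h w : wspan negatives w -> bracket M N w = scalew (M - N)%:~R (lop (M + N) w).
  by move=> w /h e n; have := congr1 (fun f => f n) e; rewrite /scalew rf_const_int.
move: w; apply: wspan_ind => [|b Ns u hN hu IH].
  apply: functional_extensionality_dep => n.
  by rewrite /bracket /scalew !lop_zero subrr mulr0.
have ew L := expandable_scale b (expandable_wspan (wspan_lop_word L hN)).
have eu := expandable_wspan hu; have elu L := expandable_wspan (wspan_lop L hu).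
have ewN := expandable_word Ns.
have E L w v : expandable w -> expandable v ->
    lop L (addw (scalew b w) v) = addw (scalew b (lop L w)) (lop L v).
  by move=> hw hv; rewrite lop_add // ?lop_scale //; exact: expandable_scale.
have el L := expandable_wspan (wspan_lop_word L hN).
apply: functional_extensionality_dep => n.
have := congr1 (fun f => f n) (bracket_word M N hN).
have := congr1 (fun f => f n) IH.
rewrite /bracket /scalew !E // /addw /scalew.
move: (rf_const n b) (rf_const n _) (lop M (lop N u) n) (lop N (lop M u) n).
move=> c d p q e1 e2; rewrite opprD addrACA -mulrBr e1 e2; ring.
Qed.

End Module.
End Sequences.

(** * Elementary conformal maps *)

Section ComplexPlane.
Variable R : realType.
Local Notation C := (cplx R).
Local Notation Re := (@complex.Re R).
Local Notation Im := (@complex.Im R).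
Implicit Types (z u w : C).

(** The norm of a complex number is itself an element of R[i]; estimates are made with this real
    number instead. *)
Definition cabs (z : C) : R := Num.sqrt (Re z ^+ 2 + Im z ^+ 2).

Lemma cabsE z : `|z| = (cabs z)%:C%C.
Proof. exact: normc_def. Qed.

Lemma cabs_ge0 z : 0 <= cabs z. Proof. exact: sqrtr_ge0. Qed.

Lemma cabsD z w : cabs (z + w) <= cabs z + cabs w.
Proof.
have := ler_normD z w; rewrite !cabsE.
by rewrite -(rmorphD (real_complex R)) lecR.
Qed.

Lemma cabsN z : cabs (- z) = cabs z.
Proof. by case: z => a b; rewrite /cabs /= !sqrrN. Qed.

Lemma cabsM z w : cabs (z * w) = cabs z * cabs w.
Proof.
have := normrM z w; rewrite !cabsE.
by rewrite -(rmorphM (real_complex R)) => /complexI.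
Qed.

Lemma cabs_sqr z : cabs z ^+ 2 = Re z ^+ 2 + Im z ^+ 2.
Proof. by rewrite sqr_sqrtr // addr_ge0 ?sqr_ge0. Qed.

Lemma cabs_eq0 z : cabs z = 0 -> z = 0.
Proof. by move=> h; apply/normr0_eq0; rewrite cabsE h. Qed.

Lemma cabs0 : cabs 0 = 0.
Proof. by rewrite /cabs /= !expr0n addr0 sqrtr0. Qed.

Lemma cabs_gt0 z : (0 < cabs z) = (z != 0).
Proof.
rewrite lt_neqAle cabs_ge0 andbT eq_sym; apply/idP/idP.
  by apply: contra => /eqP ->; rewrite cabs0.
by apply: contra => /eqP/cabs_eq0 ->.
Qed.

Lemma cabsV z : cabs z^-1 = (cabs z)^-1.
Proof.
have [->|z0] := eqVneq z 0; first by rewrite invr0 cabs0 invr0.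
have c0 : cabs z != 0 by rewrite gt_eqF // cabs_gt0.
apply: (mulfI c0); rewrite -cabsM !mulfV //.
by rewrite /cabs /= expr1n expr0n addr0 sqrtr1.
Qed.

Lemma cabs_real (r : R) : cabs r%:C%C = `|r|.
Proof. by rewrite /cabs /= expr0n addr0 sqrtr_sqr. Qed.

Lemma Re_le_cabs z : `|Re z| <= cabs z.
Proof. by rewrite /cabs -sqrtr_sqr ler_wsqrtr // lerDl sqr_ge0. Qed.

Lemma Im_le_cabs z : `|Im z| <= cabs z.
Proof. by rewrite /cabs -sqrtr_sqr ler_wsqrtr // lerDr sqr_ge0. Qed.

Lemma cabs_le_ReIm z : cabs z <= `|Re z| + `|Im z|.
Proof.
rewrite -(@ler_pXn2r _ 2) ?nnegrE ?addr_ge0 ?cabs_ge0 //.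
rewrite cabs_sqr sqrrD !real_normK ?num_real //.
by rewrite lerD2r lerDl mulrn_wge0 // mulr_ge0.
Qed.

Lemma cReD z w : Re (z + w) = Re z + Re w. Proof. by case: z w => ? ? [? ?]. Qed.
Lemma cImD z w : Im (z + w) = Im z + Im w. Proof. by case: z w => ? ? [? ?]. Qed.
Lemma cReN z : Re (- z) = - Re z. Proof. by case: z. Qed.
Lemma cImN z : Im (- z) = - Im z. Proof. by case: z. Qed.
Lemma cReM z w : Re (z * w) = Re z * Re w - Im z * Im w.
Proof. by case: z w => ? ? [? ?]. Qed.
Lemma cImM z w : Im (z * w) = Re z * Im w + Im z * Re w.
Proof. by case: z w => ? ? [? ?]. Qed.
Lemma complex_ext z w : Re z = Re w -> Im z = Im w -> z = w.
Proof. by case: z w => ? ? [? ?] /= -> ->. Qed.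

Lemma cplx_nbhsP z (A : set C) :
  nbhs z A <-> exists2 e : R, 0 < e & forall u, cabs (u - z) < e -> A u.
Proof.
split.
  move/nbhs_normP => [e /= e0 eA].
  have eE : e = (Re e)%:C%C.
    by move: e0; rewrite ltcE /= => /andP[/eqP i0 _]; apply: complex_ext.
  exists (Re e); first by move: e0; rewrite eE ltcR.
  by move=> u uz; apply: eA; rewrite /ball_ /= distrC cabsE eE ltcR.
move=> [e e0 eA]; apply/(@nbhs_normP _ C); exists e%:C%C; first by rewrite /= ltcR.
by move=> u; rewrite /ball_ /= distrC cabsE ltcR => /eA.
Qed.

Lemma cplx_cvgP (T : Type) (F : set_system T) {FF : Filter F} (f : T -> C) (l : C) :
  f @ F --> l <-> forall e : R, 0 < e -> \forall x \near F, cabs (f x - l) < e.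
Proof.
split=> [fl e e0|h A /cplx_nbhsP[e e0 eA]].
  by apply: (fl [set u | cabs (u - l) < e]); apply/cplx_nbhsP; exists e.
by apply: filterS (h _ e0) => x; apply: eA.
Qed.

Lemma cplx_openP (A : set C) :
  open A <-> forall z, A z -> exists2 e : R, 0 < e & forall u, cabs (u - z) < e -> A u.
Proof.
rewrite openE; split=> [h z /h /cplx_nbhsP//|h z /h Az].
by apply/cplx_nbhsP.
Qed.

Lemma cplx_continuousP (T : topologicalType) (A : set T) (f : T -> C) :
  {within A, continuous f} <-> forall x, A x -> forall e : R, 0 < e ->
    \forall y \near within A (nbhs x), cabs (f y - f x) < e.
Proof.
rewrite subspace_continuousP; split=> h x Ax; first by apply/cplx_cvgP; exact: h.
by apply/cplx_cvgP; exact: h.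
Qed.

Lemma near_cplxP z (Q : C -> Prop) :
  (\forall u \near z, Q u) <-> exists2 e : R, 0 < e & forall u, cabs (u - z) < e -> Q u.
Proof. exact: (cplx_nbhsP z Q). Qed.

Lemma derivable_of_quotient (f : C -> C) z l :
  (forall e : R, 0 < e -> exists2 d : R, 0 < d & forall h : C, h != 0 ->
     cabs h < d -> cabs (h^-1 * (f (h + z) - f z) - l) < e) -> derivable f z 1.
Proof.
move=> H; apply/cvg_ex; exists l; apply/cplx_cvgP => e e0.
have [d d0 hd] := H e e0.
apply/(@cplx_nbhsP (0 : C) (fun h : C => h != 0 -> _)); exists d => // h.
rewrite subr0 => hlt h0; have := hd h h0 hlt.
by rewrite /= -[h *: (1 : C)]/(h * 1) mulr1.
Qed.

Lemma derivable_near (f : C -> C) z : derivable f z 1 ->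
  forall e : R, 0 < e -> exists2 d : R, 0 < d & forall u, cabs (u - z) < d ->
    cabs (f u - f z) < e.
Proof.
move=> /derivable1_diffP /differentiable_continuous h e e0.
by have /cplx_cvgP /(_ e e0) /near_cplxP := h.
Qed.

Lemma plane_continuous : continuous (fun p : R * R => (p.1 +i* p.2)%C : C).
Proof.
move=> [a b]; apply/cplx_cvgP => e e0.
have e2 : 0 < e / 2 by rewrite divr_gt0.
exists (ball a (e / 2), ball b (e / 2)) => /=.
  by split; apply: nbhsx_ballx.
move=> p /= [pa pb]; apply: le_lt_trans (cabs_le_ReIm _) _.
by rewrite (splitr e) ltrD //= distrC.
Qed.

Lemma closed_cplxP (K : set C) :
  closed K <-> forall z, ~ K z -> exists2 e : R, 0 < e & forall u, cabs (u - z) < e -> ~ K u.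
Proof. by rewrite -openC; exact: cplx_openP. Qed.

Lemma bounded_closed_cplx_compact (K : set C) (M : R) :
  closed K -> (forall z, K z -> cabs z <= M) -> compact K.
Proof.
move=> cK bK; pose sq := `[- M, M]%classic `*` `[- M, M]%classic.
have csq : compact ((fun p : R * R => (p.1 +i* p.2)%C : C) @` sq).
  apply: continuous_compact; last by apply: compact_setX; exact: segment_compact.
  by apply: continuous_subspaceT; exact: plane_continuous.
apply: (subclosed_compact cK csq) => z Kz.
exists (Re z, Im z); last by case: (z).
have := bK _ Kz; split; rewrite /= in_itv /= -ler_norml.
  exact: le_trans (Re_le_cabs z) _.
exact: le_trans (Im_le_cabs z) _.
Qed.

End ComplexPlane.

(** * Simple connectedness of images of the half-plane *)

Section Homotopy.
Variable R : realType.
Local Notation C := (cplx R).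
Local Notation Re := (@complex.Re R).
Local Notation Im := (@complex.Im R).
Local Notation HP := (@upper_half_plane R).

Definition lin_path (a b : C) (t : R) : C := (1 - t)%:C%C * a + t%:C%C * b.

Lemma Im_lin_path a b t : Im (lin_path a b t) = (1 - t) * Im a + t * Im b.
Proof. by rewrite /lin_path cImD !cImM /= !mul0r !addr0. Qed.

Lemma lin_path_HP a b t : HP a -> HP b -> 0 <= t <= 1 -> HP (lin_path a b t).
Proof.
rewrite /upper_half_plane /= Im_lin_path => a0 b0 /andP[t0 t1].
have [->|tp] := eqVneq t 0; first by rewrite subr0 mul1r mul0r addr0.
by rewrite ltr_wpDl // ?mulr_gt0 ?mulr_ge0 ?subr_ge0 ?(ltW a0) // lt_neqAle eq_sym tp.
Qed.

Lemma lin_path_dist (a a' b : C) (s s' : R) : 0 <= s' <= 1 ->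
  cabs (lin_path a' b s' - lin_path a b s) <= cabs (a' - a) + `|s' - s| * cabs (b - a).
Proof.
move=> /andP[s0 s1].
have -> : lin_path a' b s' - lin_path a b s
    = (1 - s')%:C%C * (a' - a) + (s' - s)%:C%C * (b - a).
  by rewrite /lin_path !rmorphB rmorph1; ring.
apply: le_trans (cabsD _ _) _; rewrite !cabsM !cabs_real lerD2r.
by rewrite ler_piMl ?cabs_ge0 // ger0_norm ?subr_ge0 // lerBlDr lerDl.
Qed.

Definition cont_at (f : C -> C) (z : C) : Prop := forall e : R, 0 < e ->
  exists2 d : R, 0 < d & forall u, cabs (u - z) < d -> cabs (f u - f z) < e.

Variables (H : set C) (Phi phi : C -> C).
Hypotheses (PhiH : forall z, HP z -> H (Phi z)) (phiH : forall z, H z -> HP (phi z))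
  (PhiK : forall z, H z -> Phi (phi z) = z)
  (Phi_cont : forall z, HP z -> cont_at Phi z)
  (phi_cont : forall z, H z -> cont_at phi z).

(** [H] is homeomorphic to a convex set. Segments of the half-plane, carried over by [Phi], join
    every point to the image of i and contract a loop to its base point. *)
Lemma simply_connected_image : simply_connected H.
Proof.
split.
  have seg z : H z -> exists A, [/\ connected A, A `<=` H, A z & A (Phi 'i%C)].
    move=> Hz; exists ((fun t => Phi (lin_path 'i%C (phi z) t)) @` `[0, 1]).
    have i0 : HP 'i%C by rewrite /upper_half_plane /=.
    split.
    - apply: connected_continuous_connected; first exact/connected_intervalP/interval_is_interval.
      apply/cplx_continuousP => t /=; rewrite in_itv /= => t01 e e0.
      have [d d0 hd] := Phi_cont (lin_path_HP i0 (phiH Hz) t01) e0.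
      pose m := d / (1 + cabs (phi z - 'i%C)).
      have m0 : 0 < m by rewrite divr_gt0 // ltr_pwDl // cabs_ge0.
      rewrite near_withinE.
      apply: filterS (nbhsx_ballx t m m0) => t' tt; rewrite /= in_itv /= => t'01.
      apply: hd; apply: le_lt_trans (lin_path_dist _ _ _ _ t'01) _.
      rewrite subrr cabs0 add0r; rewrite /ball /= distrC in tt.
      have : `|t' - t| * (1 + cabs (phi z - 'i%C)) < d.
        by rewrite -ltr_pdivlMr // ltr_pwDl // cabs_ge0.
      by apply: le_lt_trans; rewrite ler_wpM2l // lerDr.
    - by move=> _ [t /= + <-]; rewrite in_itv /= => t01; apply/PhiH/lin_path_HP => //; apply: phiH.
    - exists 1; first by rewrite /= in_itv /= ler01 lexx.
      by rewrite /lin_path subrr mul0r add0r mul1r PhiK.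
    - exists 0; first by rewrite /= in_itv /= ler01 lexx.
      by rewrite /lin_path subr0 mul0r addr0 mul1r.
  have -> : H = \bigcup_(A in [set A | [/\ connected A, A `<=` H & A (Phi 'i%C)]]) A.
    apply/seteqP; split => z.
      by move=> /seg[A [cA AH Az Ai]]; exists A.
    by move=> [A [_ AH _] Az]; exact: AH.
  apply: bigcup_connected; last by move=> A [].
  by exists (Phi 'i%C) => A [].
move=> p /cplx_continuousP cp pH p01.
have pHt t : 0 <= t <= 1 -> H (p t) by move=> t01; apply: pH; exists t; rewrite //= in_itv.
have H00 : 0 <= (0 : R) <= 1 by rewrite lexx ler01.
exists (fun st => Phi (lin_path (phi (p st.2)) (phi (p 0)) st.1)); split.
- apply/cplx_continuousP => -[s t] /= []; rewrite !in_itv /= => s01 t01 e e0.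
  have hpt := phiH (pHt _ t01); have hp0 := phiH (pHt _ H00).
  have [d d0 hd] := Phi_cont (lin_path_HP hpt hp0 s01) e0.
  have d2 : 0 < d / 2 by rewrite divr_gt0.
  have [d' d'0 hd'] := phi_cont (pHt _ t01) d2.
  pose k := 1 + cabs (phi (p 0) - phi (p t)).
  have k0 : 0 < k by rewrite ltr_pwDl // cabs_ge0.
  have m0 : 0 < d / 2 / k by rewrite divr_gt0.
  have pt1 : `[0, 1]%classic t by rewrite /= in_itv.
  have := cp t pt1 d' d'0; rewrite near_withinE => ptn.
  exists (ball s (d / 2 / k), [set y | `[0, 1]%classic y -> cabs (p y - p t) < d']) => /=.
    by split; [exact: nbhsx_ballx|exact: ptn].
  move=> [s' t'] /= [ss tt] [+ t'01]; rewrite in_itv /= => s'01.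
  apply: hd; apply: le_lt_trans (lin_path_dist _ _ _ _ s'01) _.
  rewrite (splitr d) ltrD //; first by apply: hd'; apply: tt.
  have : `|s' - s| * k < d / 2 by rewrite -ltr_pdivlMr // distrC.
  by apply: le_lt_trans; rewrite ler_wpM2l // lerDr.
- move=> _ [[s t] /= [+ +] <-]; rewrite !in_itv /= => s01 t01.
  by apply/PhiH/lin_path_HP => //; apply/phiH/pHt.
- move=> t; rewrite in_itv /= => t01; rewrite /lin_path /=.
  by rewrite subr0 subrr !mul0r mul1r mul1r addr0 add0r !PhiK //; apply: pHt.
- move=> s; rewrite in_itv /= => s01.
  have e : lin_path (phi (p 0)) (phi (p 0)) s = phi (p 0).
    by rewrite /lin_path -mulrDl -(rmorphD (real_complex R)) subrK rmorph1 mul1r.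
  by rewrite /= -p01 e PhiK //; apply: pHt.
Qed.
End Homotopy.

(** * The map sqrt(u^2 + c) on the half-plane *)

Section SquareRoot.
Variable R : realType.
Local Notation C := (cplx R).
Local Notation Re := (@complex.Re R).
Local Notation Im := (@complex.Im R).
Local Notation HP := (@upper_half_plane R).
Implicit Types (c x : R) (u v w : C).

Definition csqrt (v : C) : C :=
  let r := sqrtc v in if 0 <= Im r then r else - r.

Lemma csqrt_sqr v : csqrt v ^+ 2 = v.
Proof. by rewrite /csqrt; case: ifP => _; rewrite ?sqrrN; exact: sqr_sqrtc. Qed.

Lemma Im_csqrt_ge0 v : 0 <= Im (csqrt v).
Proof.
rewrite /csqrt; case: ifP => // /negbT; rewrite -ltNge cImN => h.
by rewrite oppr_ge0 ltW.
Qed.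

Lemma csqrt_uniq w : HP w -> csqrt (w ^+ 2) = w.
Proof.
rewrite /upper_half_plane /= => w0.
have /eqP := csqrt_sqr (w ^+ 2); rewrite eqf_sqr => /orP[/eqP//|/eqP e].
have := Im_csqrt_ge0 (w ^+ 2); rewrite e cImN oppr_ge0 => h.
by move: w0; rewrite ltNge h.
Qed.

(* The branch of [sqrt (u ^ 2 + c)] with values in the upper half-plane. *)
Definition sqrt_shift c u : C := csqrt (u ^+ 2 + c%:C%C).

(** For c > 0 the half-plane without the vertical segment from 0 of height sqrt c, for c <= 0 the
    half-plane itself. One formula thus serves as domain for [sqrt_shift c] and for its inverse
    [sqrt_shift (- c)]. *)
Definition slit_domain c : set C :=
  [set u | HP u /\ (Re u = 0 -> c < Im u ^+ 2)].

Lemma sqrt_shift_sqr c u : sqrt_shift c u ^+ 2 = u ^+ 2 + c%:C%C.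
Proof. exact: csqrt_sqr. Qed.

Lemma Re_sqr u : Re (u ^+ 2) = Re u ^+ 2 - Im u ^+ 2.
Proof. by rewrite !expr2 cReM. Qed.

Lemma Im_sqr u : Im (u ^+ 2) = 2 * Re u * Im u.
Proof. by rewrite expr2 cImM; ring. Qed.

Lemma sqrt_shift_Re c u :
  Re (sqrt_shift c u) ^+ 2 - Im (sqrt_shift c u) ^+ 2 = Re u ^+ 2 - Im u ^+ 2 + c.
Proof. by rewrite -!Re_sqr sqrt_shift_sqr cReD. Qed.

Lemma sqrt_shift_Im c u :
  Re (sqrt_shift c u) * Im (sqrt_shift c u) = Re u * Im u.
Proof.
have : Im (sqrt_shift c u ^+ 2) = Im (u ^+ 2) by rewrite sqrt_shift_sqr cImD addr0.
by rewrite !Im_sqr -!mulrA => /mulfI -> //; rewrite pnatr_eq0.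
Qed.

Lemma sqrt_shift_domain c u : slit_domain c u -> slit_domain (- c) (sqrt_shift c u).
Proof.
move=> [u0 uc]; have := sqrt_shift_Re c u; have := sqrt_shift_Im c u.
have := Im_csqrt_ge0 (u ^+ 2 + c%:C%C); rewrite -/(sqrt_shift c u).
set w := sqrt_shift c u; rewrite /slit_domain /upper_half_plane /= in u0 uc *.
move=> w0 e1 e2.
have w1 : 0 < Im w.
  rewrite lt_neqAle w0 andbT eq_sym; apply/eqP => w00.
  move: e1; rewrite w00 mulr0 => /esym/eqP; rewrite mulf_eq0 (gt_eqF u0) orbF => /eqP r0.
  by have := uc r0; move: e2; rewrite w00 r0; have := sqr_ge0 (Re w); nra.
split=> // rw; move: e1; rewrite rw mul0r => /esym/eqP.
rewrite mulf_eq0 (gt_eqF u0) orbF => /eqP r0; move: e2; rewrite rw r0; nra.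
Qed.

Lemma sqrt_shiftK c u : HP u -> sqrt_shift (- c) (sqrt_shift c u) = u.
Proof.
move=> u0; rewrite {1}/sqrt_shift sqrt_shift_sqr -addrA -(rmorphD (real_complex R)).
by rewrite subrr addr0 csqrt_uniq.
Qed.

Lemma slit_domain_neg c u : c <= 0 -> HP u -> slit_domain c u.
Proof.
move=> c0 u0; split=> // _; apply: le_lt_trans c0 _.
by rewrite exprn_gt0.
Qed.

(* Same quadrant: the sum of the two roots cannot be small. *)
Lemma sqrt_shift_lipschitz c u u' : slit_domain c u -> slit_domain c u' ->
  cabs (sqrt_shift c u' - sqrt_shift c u) * Im (sqrt_shift c u)
  <= cabs (u' - u) * cabs (u' + u).
Proof.
move=> /sqrt_shift_domain[w0 _] /sqrt_shift_domain[w'0 _].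
rewrite /upper_half_plane /= in w0 w'0.
have e : (sqrt_shift c u' - sqrt_shift c u) * (sqrt_shift c u' + sqrt_shift c u)
    = (u' - u) * (u' + u).
  by rewrite -!subr_sqr !sqrt_shift_sqr; ring.
rewrite -cabsM -e cabsM ler_wpM2l ?cabs_ge0 //.
apply: le_trans (Im_le_cabs _); rewrite cImD ger0_norm ?lerDr ?addr_ge0 ?ltW //.
Qed.

Lemma slit_domain_open c : open (slit_domain c).
Proof.
apply/cplx_openP => z [z0 zc]; rewrite /upper_half_plane /= in z0.
have [r0|r0] := eqVneq (Re z) 0; last first.
  exists (Num.min `|Re z| (Im z)); first by rewrite lt_min normr_gt0 r0.
  move=> u; rewrite lt_min => /andP[h1 h2].
  have := le_lt_trans (Re_le_cabs _) h1; have := le_lt_trans (Im_le_cabs _) h2.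
  rewrite cReD cImD cReN cImN => i2 i1; split.
    by rewrite /upper_half_plane /=; move: i2; rewrite ltr_norml => /andP[]; lra.
  by move=> u0; move: i1; rewrite u0 sub0r normrN ltxx.
have {}zc := zc r0.
pose s := Num.sqrt (Num.max c 0).
have s0 : 0 <= s by exact: sqrtr_ge0.
have cs : c <= s ^+ 2 by rewrite sqr_sqrtr ?le_max ?lexx ?orbT.
have sz : s < Im z.
  rewrite -(@ltr_pXn2r _ 2) ?nnegrE ?(ltW z0) // sqr_sqrtr ?le_max ?lexx ?orbT //.
  by rewrite gt_max zc exprn_gt0.
exists (Im z - s); first by rewrite subr_gt0.
move=> u h; have := le_lt_trans (Im_le_cabs _) h; rewrite cImD cImN ltr_norml => /andP[h1 _].
have su : s < Im u by lra.
split; first by apply: le_lt_trans s0 su.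
by move=> _; apply: le_lt_trans cs _; rewrite ltr_pXn2r // ?nnegrE // ltW // (le_lt_trans s0).
Qed.

Lemma sqrt_shift_cont c u : slit_domain c u -> cont_at (sqrt_shift c) u.
Proof.
move=> hu e e0; have [w0 _] := sqrt_shift_domain hu.
rewrite /upper_half_plane /= in w0.
have [d d0 hd] := (cplx_openP _).1 (slit_domain_open (c := c)) _ hu.
pose k := 1 + 2 * cabs u; have k0 : 0 < k by rewrite ltr_pwDl // mulr_ge0 ?cabs_ge0.
exists (Num.min d (Num.min 1 (e * Im (sqrt_shift c u) / k))).
  by rewrite !lt_min d0 ltr01 divr_gt0 // mulr_gt0.
move=> u'; rewrite !lt_min => /and3P[h1 h2 h3].
have := sqrt_shift_lipschitz hu (hd _ h1).
have hk : cabs (u' + u) <= k.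
  have -> : u' + u = (u' - u) + (u + u) by ring.
  apply: le_trans (cabsD _ _) _; rewrite lerD ?(ltW h2) //.
  by apply: le_trans (cabsD _ _) _; rewrite mulr_natl mulr2n.
move=> h; rewrite -(ltr_pM2r w0); apply: le_lt_trans h _.
apply: le_lt_trans (_ : cabs (u' - u) * k < _); first by rewrite ler_wpM2l ?cabs_ge0.
by rewrite -ltr_pdivlMr.
Qed.

Definition has_cderiv (f : C -> C) (z l : C) : Prop := forall e : R, 0 < e ->
  exists2 d : R, 0 < d & forall h : C, h != 0 -> cabs h < d ->
    cabs (h^-1 * (f (h + z) - f z) - l) < e.

(** From w'^2 - w^2 = h (h + 2 u) the difference quotient is (h + 2 u) / (w' + w), and |w' + w| >=
    Im w because both roots lie in the upper half-plane. *)
Lemma sqrt_shift_cderiv c u : slit_domain c u ->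
  has_cderiv (sqrt_shift c) u (u / sqrt_shift c u).
Proof.
move=> hu; have [w0 _] := sqrt_shift_domain hu.
rewrite /upper_half_plane /= in w0; set w := sqrt_shift c u in w0 *.
have wn0 : w != 0 by apply: contraTneq w0 => ->; rewrite ltxx.
move=> e e0.
have cw0 : 0 < cabs w by rewrite cabs_gt0.
pose k := cabs w + cabs u; have k0 : 0 < k by rewrite ltr_pwDl // cabs_ge0.
pose m := e * (cabs w * Im w) / k.
have m0 : 0 < m by rewrite divr_gt0 // !mulr_gt0.
have [d d0 hd] := sqrt_shift_cont hu m0.
have [d' d'0 hd'] := (cplx_openP _).1 (slit_domain_open (c := c)) _ hu.
exists (Num.min m (Num.min d d')); first by rewrite !lt_min m0 d0 d'0.
move=> h h0; rewrite !lt_min => /and3P[h1 h2 h3].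
have eh : h + u - u = h by rewrite addrK.
have hu' : slit_domain c (h + u) by apply: hd'; rewrite eh.
have [w'0 _] := sqrt_shift_domain hu'; rewrite /upper_half_plane /= in w'0.
have := hd (h + u); rewrite eh => /(_ h2); rewrite -/w => hww.
set w' := sqrt_shift c (h + u) in w'0 hww *.
have Isum : Im w <= cabs (w' + w).
  by apply: le_trans (Im_le_cabs _); rewrite cImD ger0_norm ?lerDr ?addr_ge0 ?ltW.
have ww0 : w' + w != 0 by rewrite -cabs_gt0; apply: lt_le_trans Isum.
have esq : w' ^+ 2 - w ^+ 2 = h * (h + 2 * u).
  by rewrite !sqrt_shift_sqr; ring.
have -> : h^-1 * (w' - w) - u / w = (h * w - u * (w' - w)) / (w * (w' + w)).
  have -> : h^-1 * (w' - w) = (h + 2 * u) / (w' + w).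
    apply: (mulfI h0); rewrite mulrA mulfV // mul1r mulrA -esq subr_sqr mulfK //.
  by field; rewrite wn0 ww0.
rewrite cabsM cabsV cabsM.
rewrite ltr_pdivrMr; last by rewrite mulr_gt0 // (lt_le_trans w0).
apply: le_lt_trans (cabsD _ _) _; rewrite cabsN !cabsM.
apply: lt_le_trans (_ : e * (cabs w * Im w) <= _); last first.
  by rewrite ler_pM2l // ler_pM2l.
have -> : e * (cabs w * Im w) = m * cabs w + m * cabs u.
  by rewrite -mulrDr -/k /m mulfVK ?gt_eqF.
by rewrite ltr_leD ?ltr_pM2r // mulrC ler_wpM2r ?cabs_ge0 // ltW.
Qed.

(* Both roots lie in the same quadrant as [u]. *)
Lemma sqrt_shift_sub c u : slit_domain c u ->
  cabs (sqrt_shift c u - u) * cabs u <= `|c|.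
Proof.
move=> hu; have [w0 _] := sqrt_shift_domain hu; have [u0 _] := hu.
rewrite /upper_half_plane /= in w0 u0; have := sqrt_shift_Im c u.
set w := sqrt_shift c u in w0 * => e.
have rr : 0 <= Re w * Re u.
  have := sqr_ge0 (Re u); have -> : Re w = Re u * Im u / Im w by rewrite -e mulfK // gt_eqF.
  move=> s; have -> : Re u * Im u / Im w * Re u = Re u ^+ 2 * (Im u / Im w) by ring.
  by rewrite mulr_ge0 // divr_ge0 // ltW.
apply: le_trans (_ : cabs (w - u) * cabs (w + u) <= _).
  rewrite ler_wpM2l ?cabs_ge0 // /cabs ler_wsqrtr // cReD cImD.
  have := sqr_ge0 (Re w); have := sqr_ge0 (Im w).
  have := mulr_ge0 (ltW w0) (ltW u0); nra.
by rewrite -cabsM -subr_sqr sqrt_shift_sqr addrAC subrr add0r cabs_real.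
Qed.

(* [f (x + u) = y + a u + O(u ^ 2)] for [u] in the half-plane, with values there. *)
Definition expands (f : C -> C) (x y a : R) : Prop :=
  exists k, exists2 d : R, 0 < d & 0 <= k /\ forall u : C, 0 < Im u -> cabs u < d ->
    0 < Im (f (x%:C%C + u)) /\
    cabs (f (x%:C%C + u) - y%:C%C - a%:C%C * u) <= k * cabs u ^+ 2.

(** Boundary value of [sqrt_shift c] at a real x: the root keeps the sign of x, because
    [sqrt_shift c u] lies in the same quadrant as u. *)
Definition sqrt_shiftR c x : R := Num.sg x * Num.sqrt (x ^+ 2 + c).

Lemma sqrt_shiftR_sqr c x : x != 0 -> 0 <= x ^+ 2 + c ->
  sqrt_shiftR c x ^+ 2 = x ^+ 2 + c.
Proof. by move=> x0 h; rewrite exprMn sqr_sqrtr // sqr_sg x0 mul1r. Qed.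

(** With F0 the boundary value, (F - F0) (F + F0) = u (2 x + u). For |u| < |x| the real part of F
    has the sign of F0, so |F + F0| >= |F0| and F - F0 = O(u). Feeding this back into the same
    identity gives the error O(u^2). *)
Lemma expands_sqrt_shift c x : x != 0 -> 0 < x ^+ 2 + c ->
  expands (sqrt_shift c) x (sqrt_shiftR c x) (x / sqrt_shiftR c x).
Proof.
move=> x0 xc; set F0 := sqrt_shiftR c x.
have eF0 : F0 ^+ 2 = x ^+ 2 + c by rewrite sqrt_shiftR_sqr // ltW.
have F00 : F0 != 0 by rewrite -sqrf_eq0 eF0 gt_eqF.
have nF0 : 0 < `|F0| by rewrite normr_gt0.
have nx0 : 0 < `|x| by rewrite normr_gt0.
have xF0 : 0 < x * F0.
  rewrite /F0 /sqrt_shiftR mulrA [x * _]mulrC -normrEsg mulr_gt0 //.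
  by rewrite sqrtr_gt0.
exists ((1 + `|x| / `|F0| * (3 * `|x|) / `|F0|) / `|F0|); exists `|x| => //; split.
  by rewrite divr_ge0 // addr_ge0 // !mulr_ge0 // invr_ge0.
move=> u u0 ux; set F := sqrt_shift c (x%:C%C + u).
have Reu : `|Re u| < `|x| := le_lt_trans (Re_le_cabs u) ux.
have xRe : 0 < x * (x + Re u).
  have : `|x * Re u| < x ^+ 2 by rewrite normrM -real_normK ?num_real // expr2 ltr_pM2l.
  by rewrite ltr_norml => /andP[h _]; rewrite mulrDr -expr2; lra.
have dom : slit_domain c (x%:C%C + u).
  split; first by rewrite /upper_half_plane /= cImD /= add0r.
  by rewrite cReD /= => e; move: xRe; rewrite e mulr0 ltxx.
have [F1 _] := sqrt_shift_domain dom; rewrite /upper_half_plane /= -/F in F1.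
have := sqrt_shift_Im c (x%:C%C + u); rewrite -/F cReD cImD /= add0r => eIm.
have ReF : 0 < Re F * F0.
  have : 0 < x * (Re F * Im F) by rewrite eIm mulrA mulr_gt0.
  rewrite mulrA pmulr_lgt0 // => xF.
  by have := mulr_gt0 xF xF0; rewrite mulrACA pmulr_rgt0 // -expr2 exprn_even_gt0.
split=> //.
have FF0 : `|F0| <= cabs (F + F0%:C%C).
  apply: le_trans (Re_le_cabs _); rewrite cReD /= -ler_sqr ?nnegrE // !real_normK ?num_real //.
  have := sqr_ge0 (Re F); nra.
have FF00 : F + F0%:C%C != 0 by rewrite -cabs_gt0; apply: lt_le_trans FF0.
have esq : (F - F0%:C%C) * (F + F0%:C%C) = u * (2 * x%:C%C + u).
  rewrite -subr_sqr sqrt_shift_sqr -rmorphXn eF0 rmorphD rmorphXn /=; ring.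
have dF : cabs (F - F0%:C%C) <= cabs u * (3 * `|x|) / `|F0|.
  rewrite ler_pdivlMr //; apply: le_trans (_ : cabs (F - F0%:C%C) * cabs (F + F0%:C%C) <= _).
    by rewrite ler_wpM2l ?cabs_ge0.
  rewrite -cabsM esq cabsM ler_wpM2l ?cabs_ge0 //.
  apply: le_trans (cabsD _ _) _.
  have -> : 2 * x%:C%C = (2 * x)%:C%C :> C by rewrite rmorphM /= rmorph_nat.
  by rewrite cabs_real normrM ger0_norm //; lra.
have F0C : F0%:C%C != 0 :> C by rewrite -cabs_gt0 cabs_real.
have -> : F - F0%:C%C - (x / F0)%:C%C * u
    = (u ^+ 2 - (x / F0)%:C%C * u * (F - F0%:C%C)) / (F + F0%:C%C).
  apply: (mulIf FF00); rewrite mulfVK // mulrBl esq.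
  rewrite rmorphM fmorphV /=; field; exact: F0C.
rewrite cabsM cabsV mulrAC ler_pdivrMr ?(lt_le_trans nF0) //.
rewrite -[X in _ <= X]mulrA; apply: le_trans (_ : (1 + `|x| / `|F0| * (3 * `|x|) / `|F0|) * cabs u ^+ 2 <= _).
  apply: le_trans (cabsD _ _) _; rewrite cabsN !cabsM cabs_real normrM normrV ?unitfE //.
  rewrite mulrDl mul1r expr2 lerD2l.
  have -> : `|x| / `|F0| * (3 * `|x|) / `|F0| * (cabs u * cabs u)
     = `|x| / `|F0| * cabs u * (cabs u * (3 * `|x|) / `|F0|) by ring.
  by rewrite mulrAC ler_wpM2l // !mulr_ge0 ?cabs_ge0 // invr_ge0.
set A := 1 + _; have A0 : 0 <= A by rewrite addr_ge0 // !mulr_ge0 // invr_ge0.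
have -> : A / `|F0| * (cabs u ^+ 2 * cabs (F + F0%:C%C))
   = A * cabs u ^+ 2 * (cabs (F + F0%:C%C) / `|F0|) by ring.
by rewrite ler_peMr ?ler_pdivlMr ?mul1r // mulr_ge0 ?sqr_ge0.
Qed.
End SquareRoot.

(** * Conformal maps removing a slit or a half-disc placed at the origin *)

Section ElementaryMaps.
Variable R : realType.
Local Notation C := (cplx R).
Local Notation Re := (@complex.Re R).
Local Notation Im := (@complex.Im R).
Local Notation HP := (@upper_half_plane R).

(* [Slit x h] removes the segment from [x] to [x + i h], and [Disc x r] the
   half-disc of radius [r] centered at [x]. *)
Inductive emap := Slit of R & R | Disc of R & R.

Definition ecenter (m : emap) : R := match m with Slit x _ => x | Disc x _ => x end.
Definition esize (m : emap) : R := match m with Slit _ h => h | Disc _ r => r end.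

Definition evalid (m : emap) : Prop :=
  0 < esize m /\ match m with Slit x h => x != 0 | Disc x r => r < `|x| end.

Definition hull0 (m : emap) : set C :=
  match m with
  | Slit _ h => [set z | Re z = 0 /\ 0 < Im z <= h]
  | Disc _ r => [set z | HP z /\ cabs z <= r]
  end.

(** The square root for a slit, the Joukowski map for a half-disc. The inverse [Phi0] of the latter
    is a root of u^2 - w u + r^2 = 0. *)
Definition phi0 (m : emap) (z : C) : C :=
  match m with
  | Slit _ h => sqrt_shift (h ^+ 2) z
  | Disc _ r => z + (r ^+ 2)%:C%C / z
  end.

Definition Phi0 (m : emap) (w : C) : C :=
  match m with
  | Slit _ h => sqrt_shift (- h ^+ 2) w
  | Disc _ r => 2^-1 * (w + sqrt_shift (- (4 * r ^+ 2)) w)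
  end.

(** [ok0] says that x lies off the closure of the hull; [f0] and [d0] are the boundary values at x
    of [phi0] and of its derivative, see [expands_phi0]. *)
Definition ok0 (m : emap) (x : R) : Prop :=
  match m with Slit _ h => x != 0 | Disc _ r => r < `|x| end.

Definition f0 (m : emap) (x : R) : R :=
  match m with
  | Slit _ h => sqrt_shiftR (h ^+ 2) x
  | Disc _ r => x + r ^+ 2 / x
  end.

Definition d0 (m : emap) (x : R) : R :=
  match m with
  | Slit _ h => x / sqrt_shiftR (h ^+ 2) x
  | Disc _ r => 1 - r ^+ 2 / x ^+ 2
  end.

Lemma cabs1 : cabs (1 : C) = 1.
Proof. by rewrite /cabs /= expr1n expr0n addr0 sqrtr1. Qed.

Lemma disc_Im (r : R) (z : C) :
  z != 0 -> Im ((r ^+ 2)%:C%C / z) = - r ^+ 2 * Im z / cabs z ^+ 2.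
Proof.
move=> z0; rewrite cabs_sqr; case: z z0 => a b z0 /=.
by rewrite mulrN mul0r addr0 mulrA mulNr mulNr.
Qed.

Lemma HP_neq0 (z : C) : HP z -> z != 0.
Proof. by rewrite /upper_half_plane /=; apply: contraTneq => ->; rewrite ltxx. Qed.

Lemma Im_half (z : C) : Im (2^-1 * z) = 2^-1 * Im z.
Proof.
have -> : (2^-1 : C) = (2^-1 : R)%:C%C by rewrite fmorphV rmorph_nat.
by rewrite cImM /= mul0r addr0.
Qed.

Lemma neg4C (t : R) : (- (4 * t))%:C%C = - (4 * t%:C%C) :> C.
Proof. by rewrite rmorphN rmorphM /= rmorph_nat. Qed.

Lemma Phi0_HP m w : evalid m -> HP w ->
  [/\ HP (Phi0 m w), ~ hull0 m (Phi0 m w) & phi0 m (Phi0 m w) = w].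
Proof.
case: m => x s [/= s0 _] w0.
  have c0 : - s ^+ 2 <= 0 by rewrite oppr_le0 sqr_ge0.
  have [h1 h2] := sqrt_shift_domain (slit_domain_neg c0 w0).
  rewrite opprK in h2; split=> //; last by rewrite -[X in sqrt_shift X]opprK sqrt_shiftK.
  move=> [/h2 + /andP[h3 h4]]; rewrite ltNge => /negP; apply.
  by rewrite ler_pXn2r // ?nnegrE ltW.
have c0 : - (4 * s ^+ 2) <= 0 by rewrite oppr_le0 mulr_ge0 ?sqr_ge0.
have [h1 _] := sqrt_shift_domain (slit_domain_neg c0 w0).
set S := sqrt_shift _ w in h1 *; set u := 2^-1 * (w + S).
have eS : S ^+ 2 = w ^+ 2 - 4 * (s ^+ 2)%:C%C.
  by rewrite sqrt_shift_sqr neg4C.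
have u0 : HP u.
  by move: w0 h1; rewrite /upper_half_plane /= Im_half cImD => a b; rewrite mulr_gt0 // addr_gt0.
have un0 := HP_neq0 u0.
have euw : u * (w - u) = (s ^+ 2)%:C%C.
  have : u * (w - u) = 4^-1 * (w ^+ 2 - S ^+ 2) by rewrite /u; field.
  by move=> ->; rewrite eS; field.
have ew : u + (s ^+ 2)%:C%C / u = w by rewrite -euw [u * _]mulrC mulfK // addrC subrK.
split=> // -[_ us].
(* Im (u + s^2 / u) = Im u (1 - s^2 / |u|^2) is positive only if |u| > s. *)
move: (w0); rewrite /upper_half_plane /= -ew cImD disc_Im //.
have cu : 0 < cabs u by rewrite cabs_gt0.
rewrite mulNr mulNr subr_gt0 ltr_pdivrMr ?exprn_gt0 // mulrC ltr_pM2l // ltr_pXn2r ?nnegrE ?(ltW s0) ?(ltW cu) //.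
by rewrite ltNge us.
Qed.

Lemma slit_compl s z : 0 < s -> HP z -> ~ (Re z = 0 /\ 0 < Im z <= s) ->
  slit_domain (s ^+ 2) z.
Proof.
move=> s0 z0 zh; split=> // rz; rewrite ltNge; apply/negP => h; apply: zh; split=> //.
rewrite /upper_half_plane /= in z0; rewrite z0 /=.
by move: h; rewrite ler_pXn2r // nnegrE ltW.
Qed.

Lemma phi0_HP m z : evalid m -> HP z -> ~ hull0 m z ->
  HP (phi0 m z) /\ Phi0 m (phi0 m z) = z.
Proof.
case: m => x s [/= s0 _] z0 zh.
  have hz := slit_compl s0 z0 zh.
  have [h1 _] := sqrt_shift_domain hz.
  by split=> //; exact: sqrt_shiftK.
have zn0 := HP_neq0 z0; have cz : 0 < cabs z by rewrite cabs_gt0.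
have sz : s < cabs z by rewrite ltNge; apply/negP => h; apply: zh.
have rz : Im ((s ^+ 2)%:C%C / z) = - (s ^+ 2 / cabs z ^+ 2) * Im z.
  by rewrite disc_Im //; ring.
have q1 : s ^+ 2 / cabs z ^+ 2 < 1.
  by rewrite ltr_pdivrMr ?exprn_gt0 // mul1r ltr_pXn2r ?nnegrE ?ltW.
have q0 : 0 <= s ^+ 2 / cabs z ^+ 2 by rewrite divr_ge0 ?sqr_ge0.
rewrite /upper_half_plane /= in z0 *.
split; first by rewrite cImD rz; nra.
have e : (z + (s ^+ 2)%:C%C / z) ^+ 2 + (- (4 * s ^+ 2))%:C%C
    = (z - (s ^+ 2)%:C%C / z) ^+ 2.
  by rewrite neg4C; field.
rewrite /sqrt_shift e csqrt_uniq; first by field.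
by rewrite /upper_half_plane /= cImD cImN rz; nra.
Qed.

Lemma Phi0_cderiv m w : evalid m -> HP w -> exists l, has_cderiv (Phi0 m) w l.
Proof.
case: m => x s [/= s0 _] w0.
  eexists; apply: sqrt_shift_cderiv; apply: slit_domain_neg => //.
  by rewrite oppr_le0 sqr_ge0.
have dS : slit_domain (- (4 * s ^+ 2)) w.
  by apply: slit_domain_neg => //; rewrite oppr_le0 mulr_ge0 ?sqr_ge0.
have := sqrt_shift_cderiv dS; set S := sqrt_shift _; set l := _ / _ => hS.
exists (2^-1 * (1 + l)) => e e0; have [d d0 hd] := hS e e0; exists d => // h h0 hlt.
have -> : h^-1 * (2^-1 * (h + w + S (h + w)) - 2^-1 * (w + S w)) - 2^-1 * (1 + l)
  = 2^-1 * (h^-1 * (S (h + w) - S w) - l).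
  by move: (S (h + w)) (S w) => p q; field.
have i2 : (2^-1 : C) = (2^-1 : R)%:C%C by rewrite fmorphV rmorph_nat.
rewrite cabsM i2 cabs_real ger0_norm //; apply: le_lt_trans (hd h h0 hlt).
by rewrite ler_piMl ?cabs_ge0 // invf_le1 // ler1n.
Qed.

Lemma cont_at_id_disc (r : R) z : z != 0 -> cont_at (fun u : C => u + (r ^+ 2)%:C%C / u) z.
Proof.
move=> z0 e e0; have cz : 0 < cabs z by rewrite cabs_gt0.
pose k := 1 + 2 * r ^+ 2 / cabs z ^+ 2.
have k0 : 0 < k by rewrite ltr_pwDl // divr_ge0 ?sqr_ge0 // mulr_ge0 ?sqr_ge0.
exists (Num.min (cabs z / 2) (e / k)); first by rewrite lt_min !divr_gt0.
move=> u; rewrite lt_min => /andP[h1 h2].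
have cu : cabs z / 2 < cabs u.
  have := cabsD (- (u - z)) u; rewrite cabsN opprB subrK => h; lra.
have cu0 : 0 < cabs u by apply: lt_trans cu; rewrite divr_gt0.
have u0 : u != 0 by rewrite -cabs_gt0.
have -> : u + (r ^+ 2)%:C%C / u - (z + (r ^+ 2)%:C%C / z)
  = (u - z) * (1 - (r ^+ 2)%:C%C / (u * z)) by field; rewrite u0 z0.
rewrite cabsM; apply: le_lt_trans (_ : cabs (u - z) * k < _); last by rewrite -ltr_pdivlMr.
rewrite ler_wpM2l ?cabs_ge0 //; apply: le_trans (cabsD _ _) _.
rewrite cabsN cabsM cabsV cabsM cabs_real ger0_norm ?sqr_ge0 //.
rewrite cabs1.
have -> : k = 1 + r ^+ 2 / (cabs z / 2 * cabs z) by rewrite /k; field; rewrite gt_eqF.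
rewrite lerD2l ler_wpM2l ?sqr_ge0 // lef_pV2 ?posrE ?mulr_gt0 ?divr_gt0 //.
by rewrite ler_pM2r // ltW.
Qed.

Lemma phi0_cont m z : evalid m -> HP z -> ~ hull0 m z -> cont_at (phi0 m) z.
Proof.
case: m => x s [/= s0 _] z0 zh; last exact/cont_at_id_disc/HP_neq0.
exact/sqrt_shift_cont/(slit_compl s0 z0 zh).
Qed.

Lemma hull0_compl_open m : evalid m -> open (HP `\` hull0 m).
Proof.
case: m => x s [/= s0 _].
  have -> : HP `\` [set z | Re z = 0 /\ 0 < Im z <= s] = slit_domain (s ^+ 2).
    apply/seteqP; split => z [z0 h]; first exact: (slit_compl s0 z0 h).
    split=> //; move=> [/h + /andP[_ h2]]; rewrite ltNge ler_pXn2r ?h2 // ?nnegrE ltW //.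
  exact: slit_domain_open.
apply/cplx_openP => z [z0 zh]; rewrite /upper_half_plane /= in z0 zh *.
have sz : s < cabs z by rewrite ltNge; apply/negP => h; apply: zh.
exists (Num.min (Im z) (cabs z - s)); first by rewrite lt_min z0 subr_gt0.
move=> u; rewrite lt_min => /andP[h1 h2].
have u0 : 0 < Im u.
  have := le_lt_trans (Im_le_cabs _) h1; rewrite cImD cImN ltr_norml => /andP[]; lra.
split=> // -[_ us].
have := cabsD (- (u - z)) u; rewrite cabsN opprB subrK; lra.
Qed.

(** The error O(1/w) gives Phi(w) / w -> 1 at infinity, also after translation. *)
Lemma Phi0_sub m : evalid m ->
  exists k : R, forall w, HP w -> cabs (Phi0 m w - w) * cabs w <= k.
Proof.
case: m => x s [/= s0 _].
  exists `|- s ^+ 2| => w w0; apply: sqrt_shift_sub; apply: slit_domain_neg => //.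
  by rewrite oppr_le0 sqr_ge0.
exists `|- (4 * s ^+ 2)| => w w0; set S := sqrt_shift _ w.
have -> : 2^-1 * (w + S) - w = 2^-1 * (S - w) by field.
have c2 : cabs (2^-1 : C) <= 1.
  have -> : (2^-1 : C) = (2^-1 : R)%:C%C by rewrite fmorphV rmorph_nat.
  by rewrite cabs_real ger0_norm ?invr_ge0 // invf_le1 // ler1n.
rewrite cabsM -mulrA.
have := @sqrt_shift_sub _ (- (4 * s ^+ 2)) w; rewrite -/S => /(_ _) h.
apply: le_trans (h _); last first.
  by apply: slit_domain_neg => //; rewrite oppr_le0 mulr_ge0 ?sqr_ge0.
by rewrite ler_piMl // mulr_ge0 ?cabs_ge0.
Qed.

Lemma hull0_bounded m z : evalid m -> hull0 m z -> cabs z <= esize m.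
Proof.
case: m => x s [/= s0 _]; last by case.
move=> [rz /andP[h1 h2]]; apply: le_trans (cabs_le_ReIm _) _.
by rewrite rz normr0 add0r ger0_norm // ltW.
Qed.

Lemma d0_gt0 m x : evalid m -> ok0 m x -> 0 < d0 m x.
Proof.
case: m => c s [/= s0 _] h.
  rewrite /sqrt_shiftR invfM mulrA divr_gt0 //; last first.
    by rewrite sqrtr_gt0 ltr_wpDl ?sqr_ge0 // exprn_gt0.
  have -> : x / Num.sg x = `|x| by rewrite {1}[x]numEsg mulrAC mulfV ?mul1r // sgr_eq0.
  by rewrite normr_gt0.
have x0 : 0 < `|x| := lt_trans s0 h.
rewrite subr_gt0 ltr_pdivrMr; last by rewrite -real_normK ?num_real // exprn_gt0.
by rewrite mul1r -[x ^+ 2]real_normK ?num_real // ltr_pXn2r ?nnegrE ?ltW.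
Qed.

Lemma f0_inj m x y : evalid m -> ok0 m x -> ok0 m y -> f0 m x = f0 m y -> x = y.
Proof.
case: m => c s [/= s0 _] hx hy.
  move=> e; have e2 : x ^+ 2 = y ^+ 2.
    have := congr1 (fun t => t ^+ 2) e.
    by rewrite !sqrt_shiftR_sqr ?addr_ge0 ?sqr_ge0 // => /addIr.
  move/eqP: e2; rewrite eqf_sqr => /orP[/eqP //|/eqP xy].
  move: e; rewrite /sqrt_shiftR xy sgrN sqrrN mulNr => /eqP.
  rewrite eq_sym -addr_eq0 -mulr2n mulrn_eq0 /= mulf_eq0 sgr_eq0 (negbTE hy) /=.
  by rewrite gt_eqF // sqrtr_gt0 ltr_wpDl ?sqr_ge0 // exprn_gt0.
have x0 : x != 0 by rewrite -normr_gt0 (lt_trans s0).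
have y0 : y != 0 by rewrite -normr_gt0 (lt_trans s0).
move=> e; have : (x - y) * (x * y - s ^+ 2) = 0.
  have -> : (x - y) * (x * y - s ^+ 2) = x * y * ((x + s ^+ 2 / x) - (y + s ^+ 2 / y)).
    by field; rewrite x0 y0.
  by rewrite e subrr mulr0.
move/eqP; rewrite mulf_eq0 !subr_eq0 => /orP[/eqP//|/eqP xy].
have : s ^+ 2 < `|x * y| by rewrite normrM expr2 ltr_pM // ltW.
by rewrite xy ger0_norm ?sqr_ge0 // ltxx.
Qed.

Lemma expands_phi0 m x : evalid m -> ok0 m x -> expands (phi0 m) x (f0 m x) (d0 m x).
Proof.
move=> hm; case: m hm => c s [/= s0 _] hx.
  by apply: expands_sqrt_shift => //; rewrite ltr_wpDl ?sqr_ge0 // exprn_gt0.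
have nx0 : 0 < `|x| := lt_trans s0 hx.
have x0 : x != 0 by rewrite -normr_gt0.
have xC : x%:C%C != 0 :> C by rewrite -cabs_gt0 cabs_real.
exists (s ^+ 2 / x ^+ 2 / (`|x| / 2)), (Num.min (`|x| / 2) (`|x| - s)).
  by rewrite lt_min subr_gt0 hx divr_gt0.
split; first by rewrite !divr_ge0 ?sqr_ge0.
move=> u u0; rewrite lt_min => /andP[ux us].
have xu : `|x| <= cabs (x%:C%C + u) + cabs u.
  have := cabsD (x%:C%C + u) (- u); rewrite addrK cabs_real cabsN //.
have xu0 : 0 < cabs (x%:C%C + u) by lra.
have xun0 : x%:C%C + u != 0 by rewrite -cabs_gt0.
have HPxu : HP (x%:C%C + u) by rewrite /upper_half_plane /= cImD /= add0r.
split.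
  (* The map at the origin does not involve the center; any center making the disc valid will do. *)
  have hv : evalid (Disc (`|s| + 1) s).
    by split=> //=; rewrite ger0_norm ?addr_ge0 // ger0_norm ?(ltW s0) //; lra.
  apply: (phi0_HP hv HPxu _).1 => -[_ /=]; lra.
have -> : x%:C%C + u + (s ^+ 2)%:C%C / (x%:C%C + u) - (x + s ^+ 2 / x)%:C%C
     - (1 - s ^+ 2 / x ^+ 2)%:C%C * u
   = (s ^+ 2 / x ^+ 2)%:C%C * u ^+ 2 / (x%:C%C + u).
  rewrite !(rmorphD, rmorphN, rmorphM, rmorph1, fmorphV, rmorphXn) /=.
  by field; rewrite xC xun0.
rewrite cabsM cabsM cabsV cabs_real ger0_norm ?divr_ge0 ?sqr_ge0 //.
have -> : cabs (u ^+ 2) = cabs u ^+ 2 by rewrite !expr2 cabsM.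
rewrite mulrAC ler_wpM2r ?sqr_ge0 // ler_wpM2l ?divr_ge0 ?sqr_ge0 //.
by rewrite lef_pV2 ?posrE ?divr_gt0 //; lra.
Qed.

Lemma expands_Phi0 m x : evalid m -> ok0 m x -> expands (Phi0 m) (f0 m x) x (d0 m x)^-1.
Proof.
move=> hm; case: m hm => c s [/= s0 _] hx.
  have xs : 0 < x ^+ 2 + s ^+ 2 by rewrite ltr_wpDl ?sqr_ge0 // exprn_gt0.
  have F2 := sqrt_shiftR_sqr hx (ltW xs).
  have F0 : sqrt_shiftR (s ^+ 2) x != 0 by rewrite -sqrf_eq0 F2 gt_eqF.
  have x2 : 0 < x ^+ 2 by rewrite exprn_even_gt0.
  have e : sqrt_shiftR (- s ^+ 2) (sqrt_shiftR (s ^+ 2) x) = x.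
    rewrite {1}/sqrt_shiftR F2 addrK sqrtr_sqr /sqrt_shiftR sgrM sgr_id.
    by rewrite [Num.sg (Num.sqrt _)]gtr0_sg ?sqrtr_gt0 // mulr1 -numEsg.
  have := expands_sqrt_shift (c := - s ^+ 2) F0; rewrite F2 addrK => /(_ x2).
  by rewrite e invf_div.
have nx0 : 0 < `|x| := lt_trans s0 hx.
have x0 : x != 0 by rewrite -normr_gt0.
set w := x + s ^+ 2 / x.
have xs : 0 < x ^+ 2 - s ^+ 2.
  by rewrite subr_gt0 -[x ^+ 2]real_normK ?num_real // ltr_pXn2r ?nnegrE ?ltW.
have w0 : w != 0.
  have -> : w = (x ^+ 2 + s ^+ 2) / x by rewrite /w; field.
  by rewrite mulf_neq0 ?invr_eq0 // gt_eqF // ltr_wpDl ?sqr_ge0 // exprn_gt0.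
(* At w = x + s^2 / x the radicand is a perfect square, so the boundary value of the root is x - s^2
   / x, which has the sign of x. *)
have ew : w ^+ 2 - 4 * s ^+ 2 = (x - s ^+ 2 / x) ^+ 2 by rewrite /w; field.
have q0 : x - s ^+ 2 / x != 0.
  have -> : x - s ^+ 2 / x = (x ^+ 2 - s ^+ 2) / x by field.
  by rewrite mulf_neq0 ?invr_eq0 // gt_eqF.
have e : sqrt_shiftR (- (4 * s ^+ 2)) w = x - s ^+ 2 / x.
  rewrite /sqrt_shiftR ew sqrtr_sqr.
  have -> : w = (x ^+ 2 + s ^+ 2) * x^-1 by rewrite /w; field.
  have -> : x - s ^+ 2 / x = (x ^+ 2 - s ^+ 2) * x^-1 by field.
  rewrite normrM (gtr0_norm xs) sgrM gtr0_sg ?mul1r; last by rewrite ltr_wpDl ?sqr_ge0 // exprn_gt0.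
  by rewrite mulrCA; congr (_ * _); rewrite [RHS]numEsg.
have q2 : 0 < w ^+ 2 + - (4 * s ^+ 2) by rewrite ew exprn_even_gt0.
have [k [d d0' [k0 H]]] := expands_sqrt_shift w0 q2; rewrite e in H.
exists (2^-1 * k), d => //; split; first by rewrite mulr_ge0.
move=> u u0 ud; have [h1 h2] := H u u0 ud.
have i2 : (2^-1 : C) = (2^-1 : R)%:C%C by rewrite fmorphV rmorph_nat.
split; first by rewrite Im_half mulr_gt0 // cImD addr_gt0 // cImD /= add0r.
set S := sqrt_shift _ _ in h1 h2 *.
have -> : 2^-1 * (w%:C%C + u + S) - x%:C%C - (1 - s ^+ 2 / x ^+ 2)^-1%:C%C * u
   = 2^-1 * (S - (x - s ^+ 2 / x)%:C%C - (w / (x - s ^+ 2 / x))%:C%C * u).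
  have d1 : 1 - s ^+ 2 / x ^+ 2 != 0.
    have -> : 1 - s ^+ 2 / x ^+ 2 = (x - s ^+ 2 / x) / x by field.
    by rewrite mulf_neq0 ?invr_eq0.
  have -> : (1 - s ^+ 2 / x ^+ 2)^-1 = 2^-1 * (1 + w / (x - s ^+ 2 / x)).
    have xs0 : x ^+ 2 - s ^+ 2 != 0 by rewrite gt_eqF.
    by rewrite /w; field; rewrite x0 xs0.
  have ew' : w = 2 * x - (x - s ^+ 2 / x) by rewrite /w; ring.
  move: (w / (x - s ^+ 2 / x)) => v; rewrite ew'; move: (x - s ^+ 2 / x) => q.
  rewrite !(rmorphD, rmorphN, rmorphM, rmorph1, fmorphV, rmorph_nat) /=.
  by field.
by rewrite cabsM i2 cabs_real ger0_norm // -[X in _ <= X]mulrA ler_pM2l.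
Qed.
End ElementaryMaps.

(** * Normalized maps, their boundary values and their compositions *)

Section TranslatedMaps.
Variable R : realType.
Local Notation C := (cplx R).
Local Notation Re := (@complex.Re R).
Local Notation Im := (@complex.Im R).
Local Notation HP := (@upper_half_plane R).
Implicit Types (m : emap R) (x y a : R) (z w u : C).

Definition hull m : set C := [set z | hull0 m (z - (ecenter m)%:C%C)].
(** Subtracting the boundary value at - [ecenter m] makes 0 a fixed point ([ef0]), as required of a
    restriction map. *)
Definition ephi m z : C :=
  phi0 m (z - (ecenter m)%:C%C) - (f0 m (- ecenter m))%:C%C.
Definition ePhi m w : C :=
  (ecenter m)%:C%C + Phi0 m (w + (f0 m (- ecenter m))%:C%C).
Definition ef m x : R := f0 m (x - ecenter m) - f0 m (- ecenter m).
Definition ed m x : R := d0 m (x - ecenter m).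
Definition eok m x : Prop := ok0 m (x - ecenter m).

Lemma HP_addR z x : HP (z + x%:C%C) <-> HP z.
Proof. by rewrite /upper_half_plane /= cImD /= addr0. Qed.

Lemma HP_subR z x : HP (z - x%:C%C) <-> HP z.
Proof. by rewrite -(rmorphN (real_complex R)); exact: HP_addR. Qed.

Lemma eok0 m : evalid m -> eok m 0.
Proof. by rewrite /eok sub0r; case: m => x s [/= _ h] /=; rewrite ?oppr_eq0 ?normrN. Qed.

Lemma ef0 m : ef m 0 = 0.
Proof. by rewrite /ef sub0r subrr. Qed.

Lemma ef_inj m x y : evalid m -> eok m x -> eok m y -> ef m x = ef m y -> x = y.
Proof. by move=> hm hx hy /addIr /(f0_inj hm hx hy) /addIr. Qed.

Lemma ed_gt0 m x : evalid m -> eok m x -> 0 < ed m x.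
Proof. exact: d0_gt0. Qed.

Lemma ePhi_HP m w : evalid m -> HP w ->
  [/\ HP (ePhi m w), ~ hull m (ePhi m w) & ephi m (ePhi m w) = w].
Proof.
move=> hm /HP_addR w0; have [h1 h2 h3] := Phi0_HP hm (w0 (f0 m (- ecenter m))).
have e : ePhi m w - (ecenter m)%:C%C = Phi0 m (w + (f0 m (- ecenter m))%:C%C).
  by rewrite /ePhi addrC addrA addNr add0r.
split; first by apply/(HP_subR _ (ecenter m)); rewrite e.
  by rewrite /hull /= e.
by rewrite /ephi e h3 addrK.
Qed.

Lemma ephi_HP m z : evalid m -> HP z -> ~ hull m z ->
  HP (ephi m z) /\ ePhi m (ephi m z) = z.
Proof.
move=> hm /HP_subR z0 hz; have [h1 h2] := phi0_HP hm (z0 (ecenter m)) hz.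
by split; [apply/HP_subR|rewrite /ePhi /ephi subrK h2 addrC subrK].
Qed.

Lemma cont_at_translate (f : C -> C) (p q z : C) :
  cont_at f (z + p) -> cont_at (fun u => f (u + p) + q) z.
Proof.
move=> h e e0; have [d d0' hd] := h e e0; exists d => // u uz.
by rewrite opprD addrACA subrr addr0; apply: hd; rewrite opprD addrACA subrr addr0.
Qed.

Lemma ePhi_cderiv m w : evalid m -> HP w -> exists l, has_cderiv (ePhi m) w l.
Proof.
move=> hm /HP_addR w0; have [l hl] := Phi0_cderiv hm (w0 (f0 m (- ecenter m))).
exists l => e e0; have [d d0' hd] := hl e e0; exists d => // h h0 hlt.
have := hd h h0 hlt; rewrite /ePhi addrA.
by rewrite [_ + Phi0 m (h + w + _)]addrC opprD addrA addrK.
Qed.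

Lemma ePhi_derivable m w : evalid m -> HP w -> derivable (ePhi m) w 1.
Proof.
by move=> hm w0; have [l hl] := ePhi_cderiv hm w0; exact: derivable_of_quotient hl.
Qed.

Lemma ePhi_cont m w : evalid m -> HP w -> cont_at (ePhi m) w.
Proof. by move=> hm w0; apply: derivable_near; exact: ePhi_derivable. Qed.

Lemma ephi_cont m z : evalid m -> HP z -> ~ hull m z -> cont_at (ephi m) z.
Proof.
move=> hm /HP_subR z0 hz; have := phi0_cont hm (z0 (ecenter m)) hz.
exact: cont_at_translate.
Qed.

Definition edom m : set C := HP `\` hull m.

Lemma edom_open m : evalid m -> open (edom m).
Proof.
move=> hm; apply/cplx_openP => z [z0 zh].
have [|e e0 he] := (cplx_openP _).1 (hull0_compl_open hm) (z - (ecenter m)%:C%C).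
  by split=> //; apply/HP_subR.
exists e => // u uz; have [|h1 h2] := he (u - (ecenter m)%:C%C).
  by rewrite opprD addrACA subrr addr0.
by split=> //; apply/(HP_subR _ (ecenter m)).
Qed.

Lemma hull_bounded m z : evalid m -> hull m z -> cabs z <= `|ecenter m| + esize m.
Proof.
move=> hm hz; rewrite -(subrK (ecenter m)%:C%C z) addrC.
apply: le_trans (cabsD _ _) _; rewrite cabs_real lerD2l.
exact: hull0_bounded hz.
Qed.

Lemma edom_restriction m : evalid m -> restriction_domain (edom m).
Proof.
move=> hm.
have hullA z : (HP `\` edom m) z -> hull m z.
  by move=> [z0 h]; apply: contrapT => h'; apply: h.
split.
- exact: edom_open.
- by move=> z [].
- apply: (@simply_connected_image _ _ (ePhi m) (ephi m)).
  + by move=> z z0; have [h1 h2 _] := ePhi_HP hm z0.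
  + by move=> z [z0 h]; have [] := ephi_HP hm z0 h.
  + by move=> z [z0 h]; have [] := ephi_HP hm z0 h.
  + by move=> z; exact: ePhi_cont.
  + by move=> z [z0 h]; exact: ephi_cont.
- exists (`|ecenter m| + esize m)%:C%C; split.
    by apply/complex_realP; eexists.
  move=> x hx z /hullA /(hull_bounded hm) hz; rewrite /= cabsE.
  by apply: ltW; apply: le_lt_trans hx; rewrite lecR.
exists (match m with Slit c _ => `|c| | Disc c s => `|c| - s end).
  by case: m hm {hullA} => c s [/= s0 h]; rewrite ?normr_gt0 ?subr_gt0.
move=> z /hullA; rewrite cabsE lecR; case: m hm {hullA} => c s [/= s0 hc].
  move=> [+ _]; rewrite cReD cReN /= => /eqP; rewrite subr_eq0 => /eqP <-.
  exact: Re_le_cabs.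
move=> [_ /= hz]; have := cabsD z (- (z - c%:C%C)); rewrite cabsN addrC opprB subrK cabs_real.
by rewrite /= in hz; lra.
Qed.

Lemma expands_translate f x y a p t : expands f x y a ->
  expands (fun z => f (z - p%:C%C) - t%:C%C) (x + p) (y - t) a.
Proof.
move=> [k [d d0' [k0 H]]]; exists k, d => //; split=> // u u0 ud.
have e : (x + p)%:C%C + u - p%:C%C = x%:C%C + u by rewrite rmorphD /=; ring.
have [h1 h2] := H u u0 ud; rewrite e; split; first by rewrite cImD cImN /= subr0.
by move: h2; congr (cabs _ <= _); rewrite rmorphB; ring.
Qed.

Lemma expands_ephi m x : evalid m -> eok m x -> expands (ephi m) x (ef m x) (ed m x).
Proof.
move=> hm hx; have := expands_translate (ecenter m) (f0 m (- ecenter m)) (expands_phi0 hm hx).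
by rewrite subrK.
Qed.

Lemma expands_ePhi m x : evalid m -> eok m x -> expands (ePhi m) (ef m x) x (ed m x)^-1.
Proof.
move=> hm hx; have := expands_translate (- f0 m (- ecenter m)) (- ecenter m) (expands_Phi0 hm hx).
rewrite opprK subrK; congr expands.
by apply/funext => z; rewrite /ePhi !rmorphN !opprK addrC.
Qed.

Lemma edom_restriction_map m : evalid m -> restriction_map (edom m) (ePhi m).
Proof.
move=> hm; have := expands_ePhi hm (eok0 hm); rewrite ef0 => -[k [d d0' [k0 H]]].
set a := (ed m 0)^-1 in H.
have H' w : HP w -> cabs w < d -> cabs (ePhi m w - a%:C%C * w) <= k * cabs w ^+ 2.
  by move=> w0 wd; have [_] := H w w0 wd; rewrite add0r subr0.
have [K HK] := Phi0_sub hm.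
split; first split.
- split.
  + by move=> w w0; have [h1 h2 _] := ePhi_HP hm w0.
  + move=> w w' /set_mem w0 /set_mem w'0 e.
    by have [_ _ <-] := ePhi_HP hm w0; rewrite e; have [_ _ ->] := ePhi_HP hm w'0.
  + by move=> z [z0 h]; have [h1 h2] := ephi_HP hm z0 h; exists (ephi m z).
- by move=> z; exact: ePhi_derivable.
- move=> A /cplx_nbhsP[e e0 eA].
  pose q := `|a| + k + 1; have q0 : 0 < q by rewrite ltr_pwDr // addr_ge0.
  apply/(@cplx_nbhsP R 0 (fun w => HP w -> A (ePhi m w))).
  exists (Num.min 1 (Num.min d (e / q))); first by rewrite !lt_min ltr01 d0' divr_gt0.
  move=> w; rewrite subr0 !lt_min => /and3P[w1 wd we] w0; apply: eA; rewrite subr0.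
  rewrite -(subrK (a%:C%C * w) (ePhi m w)).
  apply: le_lt_trans (cabsD _ _) _; rewrite cabsM cabs_real.
  apply: le_lt_trans (_ : cabs w * q < _); last by rewrite -ltr_pdivlMr.
  have := H' w w0 wd; have cw := cabs_ge0 w.
  have : k * cabs w ^+ 2 <= k * cabs w by rewrite ler_wpM2l // expr2 ler_piMr // ltW.
  rewrite /q mulrDr mulrDr mulr1 [cabs w * k]mulrC [cabs w * `|a|]mulrC.
  move: (k * _) (k * _) (`|a| * _) => p1 p2 p3; lra.
- move=> A /cplx_nbhsP[e e0 eA].
  pose F := f0 m (- ecenter m).
  pose q := `|ecenter m| + `|F| + `|K|.
  exists (1 + `|F| + q / e) => w; rewrite cabsE ltcR => hw w0; apply: eA.
  have qe : 0 <= q / e by rewrite divr_ge0 ?addr_ge0 // ltW.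
  have w1 : 0 < cabs w by have := normr_ge0 F; lra.
  have wn0 : w != 0 by rewrite -cabs_gt0.
  have hF : HP (w + F%:C%C) by apply/HP_addR.
  have -> : ePhi m w / w - 1 = ((ecenter m)%:C%C + F%:C%C + (Phi0 m (w + F%:C%C) - (w + F%:C%C))) / w.
    by rewrite /ePhi -/F; field.
  rewrite cabsM cabsV ltr_pdivrMr //.
  apply: le_lt_trans (_ : q < _); last first.
    have : q / e < cabs w by have := normr_ge0 F; lra.
    by rewrite ltr_pdivrMr // mulrC.
  apply: le_trans (cabsD _ _) _; rewrite lerD //.
    by apply: le_trans (cabsD _ _) _; rewrite !cabs_real.
  have := HK _ hF; have := cabsD (w + F%:C%C) (- F%:C%C); rewrite addrK cabsN cabs_real.
  have := cabs_ge0 (Phi0 m (w + F%:C%C) - (w + F%:C%C)); have := ler_norm K.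
  move: (cabs (Phi0 m (w + F%:C%C) - (w + F%:C%C))) (cabs (w + F%:C%C)) => A1 A2.
  by move: (normr_ge0 F); nra.
Qed.

Lemma edom_boundary_derivative m : evalid m ->
  boundary_derivative0 (ePhi m) (ed m 0)^-1.
Proof.
move=> hm; have := expands_ePhi hm (eok0 hm); rewrite ef0 => -[k [d d0' [k0 H]]].
set a := (ed m 0)^-1 in H *.
move=> A /cplx_nbhsP[e e0 eA].
apply/(@cplx_nbhsP R 0 (fun w => HP w -> A (ePhi m w / w))).
have q0 : 0 < k + 1 by rewrite ltr_pwDr.
exists (Num.min d (e / (k + 1))); first by rewrite !lt_min d0' divr_gt0.
move=> w; rewrite subr0 lt_min => /andP[wd we] w0; apply: eA.
have w1 := HP_neq0 w0; have w2 : 0 < cabs w by rewrite cabs_gt0.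
have -> : ePhi m w / w - a%:C%C = (ePhi m w - a%:C%C * w) / w by field.
rewrite cabsM cabsV ltr_pdivrMr //; have [_] := H w w0 wd; rewrite add0r subr0.
move=> h; apply: le_lt_trans h _; rewrite expr2 mulrA ltr_pM2r //.
by move: we; rewrite ltr_pdivlMr //; nra.
Qed.

(* Composite of a list: [phis [:: m1; ...; mk]] is [ephi m1 \o ... \o ephi mk]. *)
Definition fs (ms : seq (emap R)) x : R := foldr ef x ms.
Fixpoint ds (ms : seq (emap R)) x : R :=
  if ms is m :: ms' then ed m (fs ms' x) * ds ms' x else 1.
Fixpoint oks (ms : seq (emap R)) x : Prop :=
  if ms is m :: ms' then eok m (fs ms' x) /\ oks ms' x else True.
Fixpoint valids (ms : seq (emap R)) : Prop :=
  if ms is m :: ms' then evalid m /\ valids ms' else True.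
Definition phis (ms : seq (emap R)) z : C := foldr ephi z ms.
Fixpoint Phis (ms : seq (emap R)) w : C :=
  if ms is m :: ms' then Phis ms' (ePhi m w) else w.

Lemma fs0 ms : fs ms 0 = 0.
Proof. by elim: ms => [//|m ms IH] /=; rewrite /fs /= -/(fs ms 0) IH ef0. Qed.

Lemma oks0 ms : valids ms -> oks ms 0.
Proof. by elim: ms => [//|m ms IH] /= [hm /IH h]; rewrite fs0; split=> //; exact: eok0. Qed.

Lemma fs_inj ms x y : valids ms -> oks ms x -> oks ms y -> fs ms x = fs ms y -> x = y.
Proof.
elim: ms => [//|m ms IH] /= [hm hms] [mx okx] [my oky] e.
by apply: IH => //; apply: (ef_inj hm).
Qed.

Lemma ds_gt0 ms x : valids ms -> oks ms x -> 0 < ds ms x.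
Proof.
elim: ms => [//|m ms IH] /= [hm hms] [mx okx].
by rewrite mulr_gt0 ?IH //; exact: ed_gt0.
Qed.

Lemma Phis_HP ms w : valids ms -> HP w -> HP (Phis ms w) /\ phis ms (Phis ms w) = w.
Proof.
elim: ms w => [//|m ms IH] w /= [hm hms] w0; have [h1 _ h2] := ePhi_HP hm w0.
have [h3 h4] := IH _ hms h1; split=> //.
by rewrite h4.
Qed.

Lemma expands_id x : expands id x x 1.
Proof.
exists 0, 1 => //; split=> // u u0 _; split; first by rewrite cImD /= add0r.
by rewrite mul0r rmorph1 mul1r [_ + u - _]addrAC subrr add0r subrr cabs0.
Qed.

Lemma expands_comp f g x y (z : R) a b : 0 < a -> expands f x y a -> expands g y z b ->
  expands (g \o f) x z (b * a).
Proof.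
move=> a0 [k [d d0' [k0 H]]] [k' [d' d'0 [k'0 H']]].
pose q := a + k; have q0 : 0 < q by rewrite ltr_pwDl.
exists (k' * q ^+ 2 + `|b| * k).
exists (Num.min 1 (Num.min d (d' / q))); first by rewrite !lt_min ltr01 d0' divr_gt0.
split; first by apply: addr_ge0; apply: mulr_ge0 => //; exact: sqr_ge0.
move=> u u0; rewrite !lt_min => /and3P[u1 ud ud'].
have [h1 h2] := H u u0 ud; set v := f (x%:C%C + u) - y%:C%C in h2.
have ev : f (x%:C%C + u) = y%:C%C + v by rewrite /v; ring.
have v0 : 0 < Im v by rewrite /v cImD cImN /= subr0.
have cu := cabs_ge0 u.
have cv : cabs v <= q * cabs u.
  rewrite -(subrK (a%:C%C * u) v); apply: le_trans (cabsD _ _) _.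
  rewrite cabsM cabs_real gtr0_norm //; apply: le_trans (lerD h2 (lexx _)) _.
  by rewrite /q mulrDl addrC lerD2l expr2 mulrA ler_piMr ?mulr_ge0 // ltW.
have vd : cabs v < d' by apply: le_lt_trans cv _; rewrite mulrC -ltr_pdivlMr.
have [h3 h4] := H' v v0 vd; rewrite /= ev; split=> //.
have -> : g (y%:C%C + v) - z%:C%C - (b * a)%:C%C * u
  = (g (y%:C%C + v) - z%:C%C - b%:C%C * v) + b%:C%C * (v - a%:C%C * u).
  by rewrite rmorphM; ring.
apply: le_trans (cabsD _ _) _; rewrite cabsM cabs_real mulrDl lerD //.
  apply: le_trans h4 _; rewrite -mulrA ler_wpM2l // -exprMn.
  by rewrite ler_pXn2r // ?nnegrE ?cabs_ge0 // mulr_ge0 // ltW.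
by rewrite -mulrA ler_wpM2l.
Qed.

Lemma expands_phis ms x : valids ms -> oks ms x -> expands (phis ms) x (fs ms x) (ds ms x).
Proof.
elim: ms => [|m ms IH] /=; first by move=> _ _; exact: expands_id.
move=> [hm hms] [mx okx].
by apply: (expands_comp (ds_gt0 hms okx) (IH hms okx)); exact: expands_ephi.
Qed.

Lemma expands_Phis ms x : valids ms -> oks ms x ->
  expands (Phis ms) (fs ms x) x (ds ms x)^-1.
Proof.
elim: ms => [|m ms IH] /=; first by move=> _ _; rewrite invr1; exact: expands_id.
move=> [hm hms] [mx okx]; rewrite invfM mulrC.
apply: (expands_comp _ (expands_ePhi hm mx) (IH hms okx)).
by rewrite invr_gt0; exact: ed_gt0.
Qed.
End TranslatedMaps.

(** * Hitting events and restriction *)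

Section CurveEvents.
Variables (R : realType) (d : measure_display) (T : measurableType d)
  (P : probability T R) (gamma : R -> T -> cplx R).
Local Notation C := (cplx R).
Local Notation Re := (@complex.Re R).
Local Notation Im := (@complex.Im R).
Local Notation HP := (@upper_half_plane R).

Hypothesis gamma_measurable : forall t, 0 <= t ->
  measurable_fun setT (fun w => Re (gamma t w)) /\
  measurable_fun setT (fun w => Im (gamma t w)).
Hypothesis gamma_cont : forall w,
  {within `[0, +oo[, continuous (fun t => gamma t w)}.

Definition hit (S : set C) : set T := [set w | exists2 t, 0 < t & S (gamma t w)].

(** [U] is a countable union of rational boxes, whose preimages are measurable coordinate by
    coordinate. *)
Lemma measurable_open_at (U : set C) t : open U -> 0 <= t ->
  measurable [set w | U (gamma t w)].
Proof.
move=> /cplx_openP oU t0; have [mRe mIm] := gamma_measurable t0.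
pose box (a b c e : rat) : set C :=
  [set z | ratr a < Re z < ratr b /\ ratr c < Im z < ratr e].
have -> : [set w | U (gamma t w)] = \bigcup_a \bigcup_b \bigcup_c \bigcup_e
    (if pselect (box a b c e `<=` U) then
       ((fun w => Re (gamma t w)) @^-1` `]ratr a, ratr b[%classic `&`
        (fun w => Im (gamma t w)) @^-1` `]ratr c, ratr e[%classic)
     else set0).
  apply/seteqP; split => w /=; last first.
    move=> [a _ [b _ [c _ [e _]]]]; case: pselect => // h [/= h1 h2]; apply: h.
    by rewrite /box /=; move: h1 h2; rewrite !in_itv.
  move=> /oU [r r0 hr]; set z := gamma t w in hr *.
  have r2 : 0 < r / 2 by rewrite divr_gt0.
  have lo (x : R) : x - r / 2 < x by rewrite ltrBlDr ltrDl.
  have hi (x : R) : x < x + r / 2 by rewrite ltrDl.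
  have [a ha] := rat_in_itvoo (lo (Re z)); have [b hb] := rat_in_itvoo (hi (Re z)).
  have [c hc] := rat_in_itvoo (lo (Im z)); have [e he] := rat_in_itvoo (hi (Im z)).
  move: ha hb hc he; rewrite !in_itv /= => /andP[a1 a2] /andP[b1 b2] /andP[c1 c2] /andP[e1 e2].
  exists a => //; exists b => //; exists c => //; exists e => //.
  case: pselect => [h|h]; first by split; rewrite /= in_itv /= -/z ?a2 ?c2.
  case: h => u [/andP[u1 u2] /andP[u3 u4]]; apply: hr.
  apply: le_lt_trans (cabs_le_ReIm _) _; rewrite cReD cImD cReN cImN (splitr r).
  by rewrite ltrD // ltr_norml; apply/andP; split; lra.
apply: bigcupT_measurable_rat => a; apply: bigcupT_measurable_rat => b.
apply: bigcupT_measurable_rat => c; apply: bigcupT_measurable_rat => e.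
case: (pselect (box a b c e `<=` U)) => [h|h]; last exact: measurable0.
apply: measurableI.
  by rewrite -[X in measurable X]setTI; apply: mRe => //; exact: measurable_itv.
by rewrite -[X in measurable X]setTI; apply: mIm => //; exact: measurable_itv.
Qed.

Lemma gamma_near w t e : 0 <= t -> 0 < e -> exists2 r : R, 0 < r &
  forall t', 0 <= t' -> `|t' - t| < r -> cabs (gamma t' w - gamma t w) < e.
Proof.
move=> t0 e0; have t_in : `[0, +oo[%classic t by rewrite /= in_itv /= t0.
have := (cplx_continuousP _ _).1 (@gamma_cont w) t t_in e e0.
rewrite near_withinE => /nbhs_normP[r /= r0 hr]; exists r => // t' t'0 tt.
by apply: hr; [rewrite /= distrC|rewrite /= in_itv /= t'0].
Qed.

(** On a compact interval of times, the closed set is met if and only if, for every k, some rational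
    time brings the curve within 1/(k+1) of it. This replaces an uncountable union over times by
    countable operations. *)
Lemma measurable_hit_closed (K : set C) : closed K -> measurable (hit K).
Proof.
move=> /closed_cplxP cK.
pose I n : set R := `[n.+1%:R^-1, n.+2%:R]%classic.
have Igt0 n t : I n t -> 0 < t by rewrite /I /= in_itv /= => /andP[h _]; apply: lt_le_trans h.
have -> : hit K = \bigcup_n [set w | exists2 t, I n t & K (gamma t w)].
  apply/seteqP; split => [w [t t0 Kt]|w [n _ [t /Igt0 t0 Kt]]]; last by exists t.
  have [n hn] : exists n : nat, t^-1 < n.+1%:R /\ t < n.+2%:R.
    pose n := maxn (Num.truncn t^-1) (Num.truncn t); exists n; split.
      apply: lt_le_trans (truncnS_gt _) _; rewrite ler_nat ltnS leq_maxl //.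
    apply: lt_le_trans (truncnS_gt _) _; rewrite ler_nat ltnS; apply: leq_trans (leq_maxr _ _) _; exact: leqnSn.
  exists n => //; exists t => //; rewrite /I /= in_itv /= (ltW hn.2) andbT.
  by rewrite -[t]invrK lef_pV2 ?posrE ?invr_gt0 // ltW // hn.1.
apply: bigcupT_measurable => n.
pose O k : set C := [set z | exists2 u, K u & cabs (u - z) < k.+1%:R^-1].
have oO k : open (O k).
  apply/cplx_openP => z [u Ku uz]; exists (k.+1%:R^-1 - cabs (u - z)); first by rewrite subr_gt0.
  move=> v vz; exists u => //; rewrite -(subrK z u) -addrA.
  by apply: le_lt_trans (cabsD _ _) _; rewrite -[z - v]opprB cabsN -ltrBrDl.
suff -> : [set w | exists2 t, I n t & K (gamma t w)] = \bigcap_k \bigcup_(q : rat)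
    (if pselect (I n (ratr q)) then [set w | O k (gamma (ratr q) w)] else set0).
  apply: bigcapT_measurable => k; apply: bigcupT_measurable_rat => q.
  case: (pselect (I n (ratr q))) => [hq|hq]; last exact: measurable0.
  exact: measurable_open_at (oO k) (ltW (Igt0 _ _ hq)).
have Ilt : n.+1%:R^-1 < n.+2%:R :> R.
  by apply: lt_le_trans (_ : n.+2%:R^-1 * n.+2%:R * n.+2%:R <= _);
    rewrite mulVf ?mul1r // (le_lt_trans (_ : _ <= 1)) ?ltr1n // invf_le1 // ler1n.
apply/seteqP; split => w.
  move=> [t It Kt] k _.
  have k0 : 0 < k.+1%:R^-1 :> R by rewrite invr_gt0.
  have [r r0 hr] := gamma_near w (ltW (Igt0 _ _ It)) k0.
  move: (It); rewrite /I /= in_itv /= => /andP[t1 t2].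
  have : Num.max n.+1%:R^-1 (t - r) < Num.min n.+2%:R (t + r).
    move: t1 t2 Ilt; move: (n.+1%:R^-1) (n.+2%:R) => A B At tB AB.
    rewrite gt_max !lt_min AB /=; apply/and3P; split; lra.
  move=> /rat_in_itvoo[q]; rewrite in_itv /= gt_max lt_min => /andP[/andP[q1 q2] /andP[q3 q4]].
  exists q => //; case: pselect => [Iq|]; last by case; rewrite /I /= in_itv /= !ltW.
  exists (gamma t w) => //; rewrite -[_ - _]opprB cabsN; apply: hr; first exact: ltW (Igt0 _ _ Iq).
  by rewrite ltr_norml; apply/andP; split; lra.
move=> hw; apply: contrapT => nK.
have KO t : I n t -> ~ K (gamma t w) by move=> It Kt; apply: nK; exists t.
(* Compactness gives a single k such that the curve keeps distance at least 1/(k+1) from K over the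
   whole interval, which contradicts the rational time for this k. *)
have := @segment_compact R n.+1%:R^-1 n.+2%:R; rewrite compact_near_coveringP.
pose Q (k : nat) (t : R) := I n t -> ~ O k (gamma t w).
move=> /(_ nat \oo Q _)[].
  move=> t It; have [r r0 hr] := cK _ (KO t It).
  have r2 : 0 < r / 2 by rewrite divr_gt0.
  have [s s0 hs] := gamma_near w (ltW (Igt0 _ _ It)) r2.
  exists (ball t s, [set k | k.+1%:R^-1 < r / 2]) => /=.
    split; first exact: nbhsx_ballx.
    exact: near_infty_natSinv_lt (PosNum r2).
  move=> [t' k] /= [tt kr] It' [u Ku ut]; apply: (hr u) => //.
  rewrite -(subrK (gamma t' w) u) -addrA; apply: le_lt_trans (cabsD _ _) _.
  rewrite (splitr r) ltrD //; first exact: lt_trans ut kr.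
  by apply: hs; [exact: ltW (Igt0 _ _ It')|rewrite distrC].
move=> k _ /(_ k (leqnn k)) hk; have [q _] := hw k Logic.I.
by case: (pselect (I n (ratr q))) => [Iq|nq] //= h; exact: (hk _ Iq Iq h).
Qed.

Definition relclosed (S : set C) : Prop := S `<=` HP /\ open (HP `\` S).

(** Hulls accumulate on the real line and are not compact, whereas the hitting sigma-algebra is
    generated by compact sets; these slices exhaust them. *)
Definition slice (S : set C) (n : nat) : set C :=
  S `&` [set z | n.+1%:R^-1 <= Im z /\ cabs z <= n.+1%:R].

Lemma slice_closed S n : relclosed S -> closed (slice S n).
Proof.
move=> [SH oS]; apply/closed_cplxP => z hz.
have [Sz|Sz] := pselect (S z).
  have [iz|iz] := ltP (Im z) n.+1%:R^-1.
    exists (n.+1%:R^-1 - Im z); first by rewrite subr_gt0.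
    move=> u uz [_ [iu _]]; have := le_lt_trans (Im_le_cabs _) uz.
    rewrite cImD cImN ltr_norml; move: iz iu; move: (n.+1%:R^-1) => k iz iu /andP[_]; lra.
  have cz : n.+1%:R < cabs z by rewrite ltNge; apply/negP => h; apply: hz.
  exists (cabs z - n.+1%:R); first by rewrite subr_gt0.
  move=> u uz [_ [_ cu]]; have := cabsD (- (u - z)) u.
  by rewrite cabsN opprB subrK; lra.
have [z0|z0] := ltP 0 (Im z).
  have [r r0 hr] := (cplx_openP _).1 oS z (conj z0 Sz).
  by exists r => // u uz [Su _]; have [] := hr u uz.
exists n.+1%:R^-1; first by rewrite invr_gt0.
move=> u uz [_ [iu _]]; have := le_lt_trans (Im_le_cabs _) uz.
rewrite cImD cImN ltr_norml; move: iu; move: (n.+1%:R^-1) => k iu /andP[_]; lra.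
Qed.

Lemma slice_compact S n : relclosed S -> compact (slice S n).
Proof.
move=> hS; apply: (@bounded_closed_cplx_compact _ _ n.+1%:R); first exact: slice_closed.
by move=> z [_ []].
Qed.

Lemma bigcup_slice S : S `<=` HP -> S = \bigcup_n slice S n.
Proof.
move=> SH; apply/seteqP; split => z; last by move=> [n _ []].
move=> Sz; have z0 := SH _ Sz; rewrite /upper_half_plane /= in z0.
pose n := maxn (Num.truncn (Im z)^-1) (Num.truncn (cabs z)); exists n => //; split=> //; split.
  rewrite -[Im z]invrK lef_pV2 ?posrE ?invr_gt0 //.
  by apply: ltW; apply: lt_le_trans (truncnS_gt _) _; rewrite ler_nat ltnS leq_maxl.
by apply: ltW; apply: lt_le_trans (truncnS_gt _) _; rewrite ler_nat ltnS leq_maxr.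
Qed.

Lemma hit_bigcup (F : nat -> set C) : hit (\bigcup_n F n) = \bigcup_n hit (F n).
Proof.
apply/seteqP; split => w; first by move=> [t t0 [n _ h]]; exists n => //; exists t.
by move=> [n _ [t t0 h]]; exists t => //; exists n.
Qed.

Lemma measurable_hit S : relclosed S -> measurable (hit S).
Proof.
move=> hS; rewrite (bigcup_slice hS.1) hit_bigcup; apply: bigcupT_measurable => n.
exact/measurable_hit_closed/slice_closed.
Qed.

Fixpoint relcloseds (Ss : seq (set C)) : Prop :=
  if Ss is A :: Ss' then relclosed A /\ relcloseds Ss' else True.

Definition hits (Ss : seq (set C)) : set T := foldr (fun S A => hit S `&` A) setT Ss.
Definition misses (Ss : seq (set C)) : set T := foldr (fun S A => ~` hit S `&` A) setT Ss.

Lemma measurable_hits Ss : relcloseds Ss -> measurable (hits Ss).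
Proof.
elim: Ss => [_|S Ss IH [hS /IH h]] /=; first exact: measurableT.
by apply: measurableI => //; exact: measurable_hit.
Qed.

Lemma measurable_misses Ss : relcloseds Ss -> measurable (misses Ss).
Proof.
elim: Ss => [_|S Ss IH [hS /IH h]] /=; first exact: measurableT.
by apply: measurableI => //; apply: measurableC; exact: measurable_hit.
Qed.

Definition hitX (S : set C) : set (set C) := [set X | X `&` S !=set0].
Definition hitsX (Ss : seq (set C)) : set (set C) :=
  foldr (fun S A => hitX S `&` A) setT Ss.
Definition missesX (Ss : seq (set C)) : set (set C) :=
  foldr (fun S A => ~` hitX S `&` A) setT Ss.

Definition hitG : set (set (set C)) :=
  [set E | exists2 K : set C, compact K & E = [set X : set C | X `&` K !=set0]].

Lemma hitX_measurable S : relclosed S -> (<<s hitG >>) (hitX S).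
Proof.
move=> hS; have -> : hitX S = \bigcup_n hitX (slice S n).
  rewrite {1}(bigcup_slice hS.1); apply/seteqP; split => X.
    by move=> [z [Xz [n _ h]]]; exists n => //; exists z.
  by move=> [n _ [z [Xz h]]]; exists z; split=> //; exists n.
apply: sigma_algebra_bigcup => n; apply: sub_sigma_algebra.
by exists (slice S n) => //; exact: slice_compact.
Qed.

Lemma hitting_sigma_hitsX Ss Ts : relcloseds Ss -> relcloseds Ts ->
  hitting_sigma_algebra (hitsX Ss `&` missesX Ts).
Proof.
have sC A : (<<s hitG >>) A -> (<<s hitG >>) (~` A).
  by rewrite -setTD; exact: sigma_algebraCD.
have s0 : (<<s hitG >>) set0 by exact: sigma_algebra0.
have sT : (<<s hitG >>) setT by have := sC _ s0; rewrite setC0.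
have sI A B : (<<s hitG >>) A -> (<<s hitG >>) B -> (<<s hitG >>) (A `&` B).
  move=> hA hB; have h := @sigma_algebra_bigcup _ setT hitG (bigcup2 (~` A) (~` B)).
  suff hU : (<<s hitG >>) (\bigcup_i bigcup2 (~` A) (~` B) i).
    by have := sC _ hU; rewrite bigcup2E -setCI setCK.
  by apply: h => -[|[|k]] /=; [exact: (sC _ hA)|exact: (sC _ hB)|exact: s0].
have hS : forall Us, relcloseds Us -> (<<s hitG >>) (hitsX Us).
  elim=> [//|U Us IH] /= [hU /IH h]; exact: (sI _ _ (hitX_measurable hU) h).
have hM : forall Us, relcloseds Us -> (<<s hitG >>) (missesX Us).
  elim=> [//|U Us IH] /= [hU /IH h]; exact: (sI _ _ (sC _ (hitX_measurable hU)) h).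
by move=> /hS h1 /hM h2; exact: (sI _ _ h1 h2).
Qed.

Lemma hitsX_trace Ss w : hitsX Ss (open_trace gamma w) <-> hits Ss w.
Proof.
elim: Ss => [//|S Ss IH] /=; split=> -[h1 h2]; split; try exact/IH.
  by have [z [[t /= + <-] Sz]] := h1; rewrite in_itv /= andbT => t0; exists t.
have [t t0 St] := h1; exists (gamma t w); split=> //.
by exists t; rewrite //= in_itv /= t0.
Qed.

Lemma missesX_trace Ss w : missesX Ss (open_trace gamma w) <-> misses Ss w.
Proof.
have hE S : hitX S (open_trace gamma w) <-> hit S w.
  have [h1 h2] := hitsX_trace [:: S] w.
  by split=> h; [case: (h1 (conj h Logic.I))|case: (h2 (conj h Logic.I))].
by elim: Ss => [//|S Ss IH] /=; split=> -[h1 h2]; split; try exact/IH;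
  move=> h; apply: h1; exact/hE.
Qed.

Definition pull (m : emap R) (S : set C) : set C := [set z | HP z /\ S (ePhi m z)].

Lemma relclosed_pull m S : evalid m -> relclosed S -> relclosed (pull m S).
Proof.
move=> hm [SH /cplx_openP oS]; split; first by move=> z [].
apply/cplx_openP => z [z0 hz].
have [h1 _ _] := ePhi_HP hm z0.
have [|r r0 hr] := oS (ePhi m z); first by split=> // h; apply: hz.
have [e e0 he] := ePhi_cont hm z0 r0.
exists (Num.min e (Im z)); first by rewrite lt_min e0.
move=> u; rewrite lt_min => /andP[u1 u2].
have u0 : HP u.
  have := le_lt_trans (Im_le_cabs _) u2; rewrite cImD cImN ltr_norml => /andP[].
  by rewrite /upper_half_plane /=; lra.
by split=> // -[_ h]; have [_] := hr _ (he u u1).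
Qed.

Lemma relcloseds_pull m Ss : evalid m -> relcloseds Ss -> relcloseds (map (pull m) Ss).
Proof. by move=> hm; elim: Ss => [//|S Ss IH] /= [hS /IH h]; split=> //; exact: relclosed_pull. Qed.

Lemma relclosed_hull m : evalid m -> relclosed (hull m).
Proof.
move=> hm; split; last exact: edom_open.
move=> z; rewrite /hull; case: m hm => x s [/= s0 hx]; last first.
  by move=> [/(HP_subR _ x)].
by move=> [_ /andP[h _]]; apply/(HP_subR _ x).
Qed.

Lemma hitsX_pull m Ss w :
  hitsX Ss (ePhi m @` (open_trace gamma w `&` HP)) <-> hits (map (pull m) Ss) w.
Proof.
elim: Ss => [//|S Ss IH] /=; split=> -[h1 h2]; split; try exact/IH.
  have [_ [[z [[t /= + <-] z0] <-] Sz]] := h1.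
  by rewrite in_itv /= andbT => t0; exists t.
have [t t0 [z0 Sz]] := h1; exists (ePhi m (gamma t w)); split=> //.
by exists (gamma t w) => //; split=> //; exists t; rewrite //= in_itv /= t0.
Qed.

Lemma missesX_pull m Ss w :
  missesX Ss (ePhi m @` (open_trace gamma w `&` HP)) <-> misses (map (pull m) Ss) w.
Proof.
have hE S : hitX S (ePhi m @` (open_trace gamma w `&` HP)) <-> hit (pull m S) w.
  have [h1 h2] := hitsX_pull m [:: S] w.
  by split=> h; [case: (h1 (conj h Logic.I))|case: (h2 (conj h Logic.I))].
by elim: Ss => [//|S Ss IH] /=; split=> -[h1 h2]; split; try exact/IH;
  move=> h; apply: h1; exact/hE.
Qed.

Variable alpha : R.
Hypothesis restr : conformal_restriction P alpha gamma.

Definition pr (A : set T) : R := fine (P A).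

Lemma prob_fin (A : set T) : measurable A -> P A \is a fin_num.
Proof. by move=> mA; exact: fin_num_measure. Qed.

Lemma pr_ge0 A : 0 <= pr A. Proof. exact: fine_ge0. Qed.

Lemma pr_le (A B : set T) : measurable A -> measurable B -> A `<=` B -> pr A <= pr B.
Proof. by move=> mA mB AB; rewrite fine_le ?prob_fin // le_measure ?inE. Qed.

Lemma pr_setD (A B : set T) : measurable A -> measurable B ->
  pr A = pr (A `&` B) + pr (A `&` ~` B).
Proof.
move=> mA mB; have mAB := measurableI _ _ mA mB.
have mAC := measurableI _ _ mA (measurableC mB).
rewrite /pr -fineD ?prob_fin // -measureU //.
  by rewrite -setIUr setUCr setIT.
by rewrite setIACA setICr setI0.
Qed.

Lemma pr_setT : pr setT = 1.
Proof. by rewrite /pr probability_setT. Qed.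

Definition stays : set T := [set w | open_trace gamma w `<=` HP].

Lemma HP_simply_connected : restriction_domain HP.
Proof.
split=> //.
- apply/cplx_openP => z z0; exists (Im z) => // u uz; rewrite /upper_half_plane /= in z0 *.
  have := le_lt_trans (Im_le_cabs _) uz; rewrite cImD cImN ltr_norml => /andP[]; lra.
- apply: (@simply_connected_image _ _ id id) => // z z0 e e0; by exists e.
- by rewrite setDv; exists 0; split; [exact: real0|move=> x _ z].
- by exists 1 => // z; rewrite setDv.
Qed.

Lemma measurable_stays : measurable stays.
Proof.
have -> : stays = ~` hit (~` HP).
  apply/seteqP; split => w.
    by move=> h [t t0]; apply; apply: h; exists t; rewrite //= in_itv /= t0.
  move=> h z [t /= + <-]; rewrite in_itv /= andbT => t0.
  by apply: contrapT => h'; apply: h; exists t.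
apply: measurableC; apply: measurable_hit_closed; rewrite closedC.
by have [] := HP_simply_connected.
Qed.

(** The instance of restriction in which H is the half-plane, Phi the identity and Phi'(0) = 1. *)
Lemma pr_stays : P stays = 1%E.
Proof.
have rm : restriction_map HP (id : C -> C).
  split.
  - split; last by move=> z _; exact: derivable_id.
    by split=> // z z0; exists z.
  - by move=> A A0; apply: filterS A0 => z + _.
  - move=> A /nbhs_singleton A1; exists 0 => z; rewrite cabsE ltcR => z0 _.
    by rewrite /= mulfV // -cabs_gt0.
have bd : boundary_derivative0 (id : C -> C) (1 : R).
  move=> A /nbhs_singleton A1.
  apply: (@filterS _ (nbhs (0 : C)) _ setT) => [z _ z0|]; last exact: filterT.
  by rewrite /= mulfV //; apply: HP_neq0.
have [_] := restr HP_simply_connected rm bd.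
by rewrite powR1.
Qed.

Lemma stays_pr (A : set T) : measurable A -> pr (A `&` stays) = pr A.
Proof.
move=> mA; rewrite [RHS](pr_setD mA measurable_stays) -[LHS]addr0; congr (_ + _).
have mC := measurableC measurable_stays.
apply/eqP; rewrite eq_le pr_ge0 /=.
apply: le_trans (pr_le (measurableI _ _ mA mC) mC (@subIsetr _ _ _)) _.
rewrite /pr (probability_setC _ measurable_stays) pr_stays.
by rewrite subee.
Qed.

(** The map onto the complement of the hull has derivative 1 / [ed m 0] at 0, so its power - alpha
    is the power alpha of [ed m 0]. The condition of staying in the half-plane has full
    probability. *)
Lemma pr_misses_hull m : evalid m -> pr (~` hit (hull m)) = ed m 0 `^ alpha.
Proof.
move=> hm; have [_] := restr (edom_restriction hm) (edom_restriction_map hm)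
  (edom_boundary_derivative hm).
have -> : [set w | open_trace gamma w `<=` edom m] = ~` hit (hull m) `&` stays.
  apply/seteqP; split => w.
    move=> h; split; last by move=> z /h [].
    by move=> [t t0 ht]; have [|_] := h (gamma t w); first by exists t; rewrite //= in_itv /= t0.
  move=> [h1 h2] z [t /= + <-]; rewrite in_itv /= andbT => t0; split.
    by apply: h2; exists t; rewrite //= in_itv /= t0.
  by move=> ht; apply: h1; exists t.
rewrite -(stays_pr (measurableC (measurable_hit (relclosed_hull hm)))) /pr => ->.
have e0 := ltW (ed_gt0 hm (eok0 hm)).
by rewrite /= powRN -(powR_inv1 e0) -powRrM mulN1r powRN invrK.
Qed.

(** The equality of laws is applied to the event of hitting [Ss] and missing [Ts], then multiplied
    by the positive probability of the conditioning event. Seen through [ePhi m], each set becomes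
    its preimage [pull m]. *)
Theorem restriction_hits m Ss Ts : evalid m -> relcloseds Ss -> relcloseds Ts ->
  pr (hits Ss `&` misses (hull m :: Ts))
  = ed m 0 `^ alpha * pr (hits (map (pull m) Ss) `&` misses (map (pull m) Ts)).
Proof.
move=> hm hS hT; have mh := measurable_hit (relclosed_hull hm).
have [+ Peq] := restr (edom_restriction hm) (edom_restriction_map hm)
  (edom_boundary_derivative hm).
move=> /(_ _ (hitting_sigma_hitsX hS hT)).
have -> : [set w | (hitsX Ss `&` missesX Ts) (open_trace gamma w)] = hits Ss `&` misses Ts.
  apply/seteqP; split => w [h1 h2]; split.
  - exact/hitsX_trace.
  - exact/missesX_trace.
  - exact/hitsX_trace.
  - exact/missesX_trace.
have -> : [set w | (hitsX Ss `&` missesX Ts) (ePhi m @` (open_trace gamma w `&` HP))]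
   = hits (map (pull m) Ss) `&` misses (map (pull m) Ts).
  apply/seteqP; split => w [h1 h2]; split.
  - exact/hitsX_pull.
  - exact/missesX_pull.
  - exact/hitsX_pull.
  - exact/missesX_pull.
have eH : [set w | open_trace gamma w `<=` edom m] = ~` hit (hull m) `&` stays.
  apply/seteqP; split => w.
    move=> h; split; last by move=> z /h [].
    by move=> [t t0 ht]; have [|_] := h (gamma t w); first by exists t; rewrite //= in_itv /= t0.
  move=> [h1 h2] z [t /= + <-]; rewrite in_itv /= andbT => t0; split.
    by apply: h2; exists t; rewrite //= in_itv /= t0.
  by move=> ht; apply: h1; exists t.
have -> : fine (P [set w | open_trace gamma w `<=` edom m]) = ed m 0 `^ alpha.
  rewrite eH; exact: etrans (stays_pr (measurableC mh)) (pr_misses_hull hm).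
have -> : fine (P (hits Ss `&` misses Ts `&` [set w | open_trace gamma w `<=` edom m]))
    = pr (hits Ss `&` misses (hull m :: Ts)).
  rewrite eH !setIA -/(pr _) stays_pr.
    by rewrite /= -!setIA [misses Ts `&` _]setIC.
  by do 2 (apply: measurableI; last by [exact: measurableC|exact: measurable_misses]);
    exact: measurable_hits.
have e0 : ed m 0 `^ alpha != 0 by rewrite gt_eqF // powR_gt0 // ed_gt0 //; exact: eok0.
by move=> e; rewrite [in RHS]/pr -e mulrC divfK.
Qed.

End CurveEvents.

(** * Limits at 0 taken one variable at a time *)

Section IteratedLimits.
Variable R : realType.
Implicit Types (e : R) (es : seq R).

Definition near0 (Q : R -> Prop) : Prop :=
  exists2 d : R, 0 < d & forall e, 0 < e -> e < d -> Q e.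

Lemma near0_mono (Q Q' : R -> Prop) :
  (forall e, 0 < e -> Q e -> Q' e) -> near0 Q -> near0 Q'.
Proof. by move=> h [d d0 hd]; exists d => // e e0 ed; apply: h => //; exact: hd. Qed.

Lemma near0_and (Q Q' : R -> Prop) :
  near0 Q -> near0 Q' -> near0 (fun e => Q e /\ Q' e).
Proof.
move=> [d d0 hd] [d' d'0 hd']; exists (Num.min d d'); first by rewrite lt_min d0.
by move=> e e0; rewrite lt_min => /andP[? ?]; split; [exact: hd|exact: hd'].
Qed.

Lemma near0_ex (Q : R -> Prop) : near0 Q -> exists2 e, 0 < e & Q e.
Proof.
move=> [d d0 hd]; have d2 : 0 < d / 2 by rewrite divr_gt0.
by exists (d / 2) => //; apply: hd => //; rewrite ltr_pdivrMr // ltr_pMr // ltr1n.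
Qed.

Lemma near0_lt (c : R) : 0 < c -> near0 (fun e => e < c).
Proof. by exists c. Qed.

Lemma near0_scale (a : R) (Q : R -> Prop) : 0 < a -> near0 Q -> near0 (fun e => Q (a * e)).
Proof.
move=> a0 [d d0 hd]; exists (d / a); first by rewrite divr_gt0.
by move=> e e0 ed; apply: hd; [rewrite mulr_gt0|rewrite mulrC -ltr_pdivlMr].
Qed.

(* Limits taken one variable at a time: the first variable is fixed before the
   following ones tend to [0]. *)
Fixpoint near_iter (n : nat) (A : seq R -> Prop) : Prop :=
  if n is k.+1 then near0 (fun e => near_iter k (fun es => A (e :: es))) else A [::].

Definition posn (n : nat) es : Prop := size es = n /\ forall e, e \in es -> 0 < e.

Lemma near_iter_mono n (A B : seq R -> Prop) :
  (forall es, posn n es -> A es -> B es) -> near_iter n A -> near_iter n B.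
Proof.
elim: n A B => [|n IH] A B h /=; first by apply: h; split.
apply: near0_mono => e e0; apply: IH => es [se ep]; apply: h; split=> /=; first by rewrite se.
by move=> e'; rewrite inE => /orP[/eqP->|/ep].
Qed.

Lemma near_iter_and n (A B : seq R -> Prop) :
  near_iter n A -> near_iter n B -> near_iter n (fun es => A es /\ B es).
Proof.
elim: n A B => [|n IH] A B /=; first by split.
by move=> hA hB; apply: near0_mono (near0_and hA hB) => e _ [? ?]; exact: IH.
Qed.

(** Extracts from an iterated limit an estimate from which the small heights have cancelled. *)
Lemma near_iter_const n (Q : Prop) : near_iter n (fun _ => Q) -> Q.
Proof. by elim: n => [//|n IH] /= /near0_ex[e _ /IH]. Qed.

Lemma near_iterT n (A : seq R -> Prop) :
  (forall es, posn n es -> A es) -> near_iter n A.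
Proof.
move=> h; have : near_iter n (fun _ => True) by elim: n {h} => [//|n IH] /=; exists 1.
by apply: near_iter_mono => es hes _; exact: h.
Qed.

Fixpoint mulseq (s es : seq R) : seq R :=
  match s, es with a :: s', e :: es' => a * e :: mulseq s' es' | _, _ => [::] end.

Lemma near_iter_scale (s : seq R) (A : seq R -> Prop) : (forall a, a \in s -> 0 < a) ->
  near_iter (size s) A -> near_iter (size s) (fun es => A (mulseq s es)).
Proof.
elim: s A => [//|a s IH] A /= hs.
have a0 : 0 < a by apply: hs; rewrite inE eqxx.
move=> /(near0_scale a0); apply: near0_mono => e e0; apply: IH => b bs.
by apply: hs; rewrite inE bs orbT.
Qed.

Definition prodsq es : R := \prod_(e <- es) e ^+ 2.

Lemma prodsq_cons e es : prodsq (e :: es) = e ^+ 2 * prodsq es.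
Proof. by rewrite /prodsq big_cons. Qed.

Lemma prodsq_ge0 es : 0 <= prodsq es.
Proof. by apply: prodr_ge0 => e _; exact: sqr_ge0. Qed.

Lemma prodsq_gt0 n es : posn n es -> 0 < prodsq es.
Proof.
move=> [_ hes]; rewrite /prodsq; elim: es hes => [|e es IH] h; first by rewrite big_nil.
rewrite big_cons; apply: mulr_gt0; first by rewrite exprn_gt0 // h // inE eqxx.
by apply: IH => e' e's; apply: h; rewrite inE e's orbT.
Qed.

Lemma prodsq_mulseq s es : size s = size es ->
  prodsq (mulseq s es) = prodsq s * prodsq es.
Proof.
elim: s es => [|a s IH] [|e es] //= h; first by rewrite /prodsq big_nil mulr1.
by rewrite !prodsq_cons IH; [rewrite exprMn; ring|case: h].
Qed.
End IteratedLimits.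

Section RealEstimates.
Variable R : realType.

Lemma bernoulli_le (t : R) (k : nat) : 0 <= t <= 1 -> 1 - k%:R * t <= (1 - t) ^+ k.
Proof.
move=> /andP[t0 t1]; elim: k => [|k IH]; first by rewrite mul0r subr0 expr0.
rewrite exprS -natr1; apply: le_trans (_ : (1 - t) * (1 - k%:R * t) <= _); last first.
  by rewrite ler_wpM2l // subr_ge0.
have : 0 <= k%:R * t * t by rewrite !mulr_ge0.
move: (k%:R) => q; nra.
Qed.

(** Replaces the real exponent alpha by an integer, to which [bernoulli_le] applies. *)
Lemma powR_ge_expr (t a : R) (N : nat) : 0 < t <= 1 -> a <= N%:R -> t ^+ N <= t `^ a.
Proof.
move=> /andP[t0 t1] aN; rewrite -powR_mulrn ?(ltW t0) //.
by apply: ger_powR => //; rewrite t0.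
Qed.
End RealEstimates.

(** * Displacement and distortion of boundary points by the elementary maps *)

Section SlitDiscEstimates.
Variable R : realType.
Implicit Types (x y h c r u rho : R).

Lemma sqrt_add_sqr_bounds u h : 0 <= h ->
  `|u| <= Num.sqrt (u ^+ 2 + h ^+ 2) <= `|u| + h.
Proof.
move=> h0; rewrite -{1}sqrtr_sqr ler_wsqrtr ?lerDl ?sqr_ge0 //=.
rewrite -[X in _ <= X]ger0_norm ?addr_ge0 // -sqrtr_sqr ler_wsqrtr //.
by rewrite sqrrD real_normK ?num_real // addrAC lerDl mulrn_wge0 // mulr_ge0.
Qed.

Lemma sqrt_shiftR_close u h : u != 0 -> 0 <= h -> `|sqrt_shiftR (h ^+ 2) u - u| <= h.
Proof.
move=> u0 h0; rewrite /sqrt_shiftR.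
have -> : Num.sg u * Num.sqrt (u ^+ 2 + h ^+ 2) - u
    = Num.sg u * (Num.sqrt (u ^+ 2 + h ^+ 2) - `|u|) by rewrite mulrBr -numEsg.
rewrite normrM normr_sg u0 mul1r.
have /andP[h1 h2] := sqrt_add_sqr_bounds u h0.
by rewrite ger0_norm ?subr_ge0 // lerBlDl.
Qed.

Lemma d0_slit_bounds y h u : 0 < h -> u != 0 -> 0 < d0 (Slit y h) u <= 1.
Proof.
move=> h0 u0; rewrite /= /sqrt_shiftR invfM mulrA.
have -> : u / Num.sg u = `|u| by rewrite {1}[u]numEsg mulrAC mulfV ?mul1r // sgr_eq0.
have s0 : 0 < Num.sqrt (u ^+ 2 + h ^+ 2) by rewrite sqrtr_gt0 ltr_wpDl ?sqr_ge0 // exprn_gt0.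
rewrite divr_gt0 ?normr_gt0 //= ler_pdivrMr // mul1r.
by have /andP[] := sqrt_add_sqr_bounds u (ltW h0).
Qed.

Lemma ef_slit_close y h x : x != y -> y != 0 -> 0 < h -> `|ef (Slit y h) x - x| <= 2 * h.
Proof.
move=> xy y0 h0; rewrite /ef /=.
have a1 : `|sqrt_shiftR (h ^+ 2) (x - y) - (x - y)| <= h.
  by apply: sqrt_shiftR_close; rewrite ?subr_eq0 // ltW.
have a2 : `|sqrt_shiftR (h ^+ 2) (- y) - (- y)| <= h.
  by apply: sqrt_shiftR_close; rewrite ?oppr_eq0 // ltW.
move: (sqrt_shiftR _ _) (sqrt_shiftR _ _) a1 a2 => A B a1 a2.
have -> : B - A - x = (B - (x - y)) - (A - - y) by ring.
by apply: le_trans (ler_normB _ _) _; rewrite mulr_natl mulr2n lerD.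
Qed.

(** The displacement is O(r^2), the order at which the hitting probability of the disc is to be
    bounded. For a slit the cruder [ef_slit_close] is enough. *)
Lemma ef_disc_close c r x rho : 0 < rho -> rho <= `|x - c| -> rho <= `|c| ->
  `|ef (Disc c r) x - x| <= 2 * r ^+ 2 / rho.
Proof.
move=> rho0 xc c0; rewrite /ef /=.
have n1 : 0 < `|x - c| := lt_le_trans rho0 xc.
have n2 : 0 < `|c| := lt_le_trans rho0 c0.
have -> : x - c + r ^+ 2 / (x - c) - (- c + r ^+ 2 / - c) - x
   = r ^+ 2 / (x - c) + r ^+ 2 / c.
  by rewrite invrN mulrN; ring.
apply: le_trans (ler_normD _ _) _.
rewrite !normf_div (ger0_norm (sqr_ge0 r)).
have -> : 2 * r ^+ 2 / rho = r ^+ 2 / rho + r ^+ 2 / rho by ring.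
by rewrite lerD // ler_wpM2l ?sqr_ge0 // lef_pV2 ?posrE.
Qed.

Lemma d0_disc_bounds c r u rho : 0 < rho -> rho <= `|u| -> r ^+ 2 <= rho ^+ 2 ->
  0 <= 1 - r ^+ 2 / rho ^+ 2 <= d0 (Disc c r) u /\ d0 (Disc c r) u <= 1.
Proof.
move=> rho0 ur rr; have u0 : 0 < `|u| := lt_le_trans rho0 ur.
have r2 : 0 < rho ^+ 2 by rewrite exprn_gt0.
have u2 : rho ^+ 2 <= u ^+ 2 by rewrite -[u ^+ 2]real_normK ?num_real // ler_pXn2r // nnegrE ltW.
have u20 : 0 < u ^+ 2 := lt_le_trans r2 u2.
rewrite /= subr_ge0 ler_pdivrMr // mul1r rr /= lerD2l lerN2; split.
  by rewrite ler_wpM2l ?sqr_ge0 // lef_pV2.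
by rewrite gerBl divr_ge0 ?sqr_ge0.
Qed.
End SlitDiscEstimates.

(** * Slits pulled back by conformal maps *)

Section TwoScale.
Variables (R : realType) (d : measure_display) (T : measurableType d)
  (P : probability T R) (gamma : R -> T -> cplx R) (alpha : R).
Local Notation C := (cplx R).
Local Notation Re := (@complex.Re R).
Local Notation Im := (@complex.Im R).
Local Notation HP := (@upper_half_plane R).
Implicit Types (ms : seq (emap R)) (xs ys zs es : seq R) (x y e h r c : R).

Hypothesis gm : forall t, 0 <= t ->
  measurable_fun setT (fun w => Re (gamma t w)) /\
  measurable_fun setT (fun w => Im (gamma t w)).
Hypothesis gc : forall w, {within `[0, +oo[, continuous (fun t => gamma t w)}.
Hypothesis restr : conformal_restriction P alpha gamma.

Local Notation pr := (pr P).
Local Notation hit := (hit gamma).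
Local Notation hits := (hits gamma).
Local Notation misses := (misses gamma).

Definition pulls ms (A : set C) : set C := foldr (@pull R) A ms.

Lemma relclosed_pulls ms A : valids ms -> relclosed A -> relclosed (pulls ms A).
Proof. by elim: ms => [//|m ms IH] /= [hm hms] hA; apply: relclosed_pull => //; exact: IH. Qed.

Lemma relcloseds_pulls ms Ss : valids ms -> relcloseds Ss -> relcloseds (map (pulls ms) Ss).
Proof. by move=> hm; elim: Ss => [//|S Ss IH] /= [hS /IH h]; split=> //; exact: relclosed_pulls. Qed.

(** With the factor sqrt 2 the square root is u + h^2 / u to second order in h, so that no numerical
    factor appears in [jet_sqrt_shift]. *)
Definition slit x h : set C := hull (Slit x (h * Num.sqrt 2)).

Fixpoint slits xs es : seq (set C) :=
  match xs, es with x :: xs', e :: es' => slit x e :: slits xs' es' | _, _ => [::] end.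

Definition conf xs : Prop := uniq xs /\ 0 \notin xs.

Lemma conf_cons x xs : conf (x :: xs) -> [/\ x != 0, x \notin xs & conf xs].
Proof.
by rewrite /conf /= inE negb_or => -[/andP[h1 h2] /andP[h3 h4]]; split; rewrite // eq_sym.
Qed.

Lemma sqrt2_gt0 : 0 < Num.sqrt 2 :> R. Proof. by rewrite sqrtr_gt0. Qed.

Lemma relclosed_slit x e : x != 0 -> 0 < e -> relclosed (slit x e).
Proof. by move=> x0 e0; apply: relclosed_hull; split=> //=; rewrite mulr_gt0 // sqrt2_gt0. Qed.

Lemma relcloseds_slits xs es : conf xs -> posn (size xs) es -> relcloseds (slits xs es).
Proof.
elim: xs es => [[]//|x xs IH] [//|e es] /conf_cons[x0 _ hxs] [/= [se] he].
split; first by apply: relclosed_slit => //; apply: he; rewrite inE eqxx.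
by apply: IH => //; split=> // e' h; apply: he; rewrite inE h orbT.
Qed.

Lemma pr_hit_cons A Ss : relclosed A -> relcloseds Ss ->
  pr (hits (A :: Ss)) = pr (hits Ss) - pr (hits Ss `&` misses [:: A]).
Proof.
move=> hA hS; rewrite (pr_setD P (measurable_hits gm gc hS) (measurable_hit gm gc hA)).
by rewrite /= setIT addrK setIC.
Qed.

Lemma restriction_hits1 m Ss : evalid m -> relcloseds Ss ->
  pr (hits Ss `&` misses [:: hull m]) = ed m 0 `^ alpha * pr (hits (map (@pull R m) Ss)).
Proof.
by move=> hm hS; rewrite (restriction_hits gm gc restr hm hS (Ts := [::]) Logic.I) /= setIT.
Qed.

Lemma avoid_le1 m : evalid m -> ed m 0 `^ alpha <= 1.
Proof.
move=> hm; rewrite -(pr_misses_hull gm gc restr hm) -(pr_setT P); apply: pr_le => //.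
by apply: measurableC; apply: (measurable_hit gm gc); exact: relclosed_hull.
Qed.

Definition oks_all ms xs : Prop := forall x, x \in xs -> oks ms x.

(** Factor of conformal covariance: heights are multiplied by [ds ms x], and each point carries the
    exponent 2. *)
Definition wt ms xs : R := \prod_(x <- xs) ds ms x ^+ 2.

Lemma wt_cons m ms xs : wt (m :: ms) xs = \prod_(x <- xs) ed m (fs ms x) ^+ 2 * wt ms xs.
Proof. by rewrite /wt -big_split; apply: eq_bigr => x _ /=; rewrite exprMn. Qed.

Fixpoint entry_close (delta : R) xs ys : Prop :=
  match xs, ys with
  | x :: xs', y :: ys' => `|y - x| <= delta /\ entry_close delta xs' ys'
  | [::], [::] => True
  | _, _ => False
  end.

Lemma close_map (f : R -> R) delta xs :
  (forall x, x \in xs -> `|f x - x| <= delta) -> entry_close delta xs (map f xs).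
Proof.
elim: xs => [//|x xs IH] h /=; split; first by apply: h; rewrite inE eqxx.
by apply: IH => y ys; apply: h; rewrite inE ys orbT.
Qed.

Lemma close_trans a b xs ys zs : entry_close a xs ys -> entry_close b ys zs -> entry_close (a + b) xs zs.
Proof.
elim: xs ys zs => [|x xs IH] [|y ys] [|z zs] //= [h1 h2] [h3 h4]; split; last exact: IH h2 h4.
by rewrite -(subrK y z) -addrA addrC; apply: le_trans (ler_normD _ _) _; rewrite lerD.
Qed.

Lemma close_le a b xs ys : a <= b -> entry_close a xs ys -> entry_close b xs ys.
Proof.
move=> ab; elim: xs ys => [|x xs IH] [|y ys] //= [h1 h2]; split; last exact: IH.
exact: le_trans h1 ab.
Qed.

Lemma close_refl a xs : 0 <= a -> entry_close a xs xs.
Proof. by move=> a0; elim: xs => [//|x xs IH] /=; rewrite subrr normr0. Qed.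

Variable corr : seq R -> R.

Definition loclip xs : Prop := exists L delta, [/\ 0 <= L, 0 < delta &
  forall ys zs eta, entry_close delta xs ys -> entry_close delta xs zs -> 0 <= eta ->
    entry_close eta ys zs -> `|corr zs - corr ys| <= L * eta].

(* Slits of small heights [es] at [xs], pulled back by the maps [ms], are hit with the
   probability of slits at the images [fs ms x] of heights [ds ms x * e]. *)
Definition pull_asymp ms xs : Prop := forall eta, 0 < eta ->
  near_iter (size xs) (fun es =>
    `|pr (hits (map (pulls ms) (slits xs es)))
      - wt ms xs * corr (map (fs ms) xs) * prodsq es| <= eta * prodsq es).

Lemma separation y ys : y \notin ys ->
  exists2 rho : R, 0 < rho & forall z, z \in ys -> rho <= `|z - y|.
Proof.
elim: ys => [|z ys IH]; first by exists 1.
rewrite inE negb_or => /andP[yz /IH[rho rho0 h]]; exists (Num.min rho `|z - y|).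
  by rewrite lt_min rho0 normr_gt0 subr_eq0 eq_sym.
move=> u; rewrite inE => /orP[/eqP->|/h hu]; first by rewrite ge_min lexx orbT.
by rewrite ge_min hu.
Qed.

Lemma prod_sqr_bounds (I : eqType) (s : seq I) (f : I -> R) (t : R) : 0 <= t <= 1 ->
  (forall i, i \in s -> 1 - t <= f i <= 1) ->
  (1 - t) ^+ (2 * size s) <= \prod_(i <- s) f i ^+ 2 <= 1.
Proof.
move=> /andP[t0 t1]; elim: s => [|i s IH] h; first by rewrite big_nil muln0 expr0 lexx.
have /andP[f1 f2] : 1 - t <= f i <= 1 by apply: h; rewrite inE eqxx.
have /andP[h1 h2] : (1 - t) ^+ (2 * size s) <= \prod_(j <- s) f j ^+ 2 <= 1.
  by apply: IH => j js; apply: h; rewrite inE js orbT.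
have g0 : 0 <= 1 - t by rewrite subr_ge0.
have f0 : 0 <= f i by apply: le_trans f1.
rewrite big_cons /= mulnS exprD; apply/andP; split.
  by apply: ler_pM; rewrite ?exprn_ge0 // ler_pXn2r ?nnegrE.
by rewrite mulr_ile1 ?sqr_ge0 ?exprn_ile1 // prodr_ge0 // => j _; exact: sqr_ge0.
Qed.

(* By restriction the disc is hit with the difference of the probabilities for the
   configuration and for its image under the removal of the disc, which is
   O(r^2)-close to the identity. *)
Lemma disc_bound ms xs y : valids ms -> conf xs -> oks_all ms xs ->
  y != 0 -> y \notin map (fs ms) xs -> loclip (map (fs ms) xs) ->
  (forall ms', valids ms' -> oks_all ms' xs -> pull_asymp ms' xs) ->
  exists K delta, [/\ 0 <= K, 0 < delta & forall h c r,
    0 < h < delta -> `|c - y| < delta -> 0 < r < delta ->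
    evalid (Disc c r) /\ near_iter (size xs) (fun es =>
      pr (hits (hull (Disc c r) :: map (pulls (Slit y h :: ms)) (slits xs es)))
      <= K * r ^+ 2 * prodsq es)].
Proof.
move=> hms cxs okxs y0 yxs [L [dl [L0 dl0 hL]]] happ.
have [rho1 rho10 hrho1] := separation yxs.
(* A quarter of the distances from y to 0 and to the image points: even after the center moves to c
   and the points move by 2 h, a distance rho is left. *)
pose rho := Num.min rho1 `|y| / 4.
have rho0 : 0 < rho by rewrite divr_gt0 // lt_min rho10 normr_gt0.
have rhoy : 4 * rho <= `|y| by rewrite mulrC divfK // ge_min lexx orbT.
have rhoz x : x \in xs -> 4 * rho <= `|fs ms x - y|.
  move=> xxs; rewrite mulrC divfK //; apply: le_trans (hrho1 _ (map_f _ xxs)).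
  by rewrite ge_min lexx.
pose n := size xs.
have [N aN] : exists N : nat, alpha <= N%:R.
  by exists (Num.truncn alpha).+1; exact: ltW (truncnS_gt _).
pose Ms := corr (map (fs ms) xs).
pose W0 := wt ms xs.
have W00 : 0 <= W0 by apply: prodr_ge0 => x _; exact: sqr_ge0.
(* The term L 2 / rho accounts for the displacement of the points by the disc map. The next one
   accounts for the covariance and avoidance factors A Q, which are 1 up to (N + 2 n) r^2 / rho^2,
   times a bound on [corr]. The final 2 collects two asymptotic errors of size r^2. *)
pose K := W0 * (L * 2 / rho + (N + 2 * n)%:R / rho ^+ 2 * (`|Ms| + L * dl)) + 2.
exists K, (Num.min rho (dl / 4)); split.
- rewrite addr_ge0 // mulr_ge0 // addr_ge0 // ?mulr_ge0 // ?addr_ge0 ?mulr_ge0 ?invr_ge0 ?exprn_ge0 //; exact: ltW.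
- by rewrite lt_min rho0 divr_gt0.
move=> h c r; rewrite !lt_min => /and3P[h0 hrho hdl] /andP[crho cdl] /and3P[r0 rrho rdl].
pose m := Slit y h; pose D := Disc c r.
have vm : evalid m by split.
have cbig : rho <= `|c|.
  have := ler_normD c (- (c - y)); rewrite normrN opprB addrC subrK; lra.
have vD : evalid D by split=> //=; apply: lt_le_trans cbig.
split=> //.
have zy x : x \in xs -> fs ms x != y.
  by move=> xxs; apply: contraNneq yxs => <-; exact: map_f.
have efm x : x \in xs -> `|ef m (fs ms x) - fs ms x| <= 2 * h.
  by move=> xxs; apply: ef_slit_close => //; exact: zy.
have Ybig x : x \in xs -> rho <= `|ef m (fs ms x) - c|.
  move=> xxs; have := rhoz x xxs; have := efm x xxs.
  have -> : fs ms x - y = (ef m (fs ms x) - c) + (c - y) - (ef m (fs ms x) - fs ms x) by ring.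
  move: (ef m (fs ms x) - c) (c - y) (ef m (fs ms x) - fs ms x) crho hrho => p q s.
  have := ler_normD (p + q) (- s); have := ler_normD p q; rewrite normrN; lra.
have ok1 : oks_all (m :: ms) xs.
  by move=> x xxs; split; [rewrite /eok /= subr_eq0; exact: zy|exact: okxs].
have ok2 : oks_all (D :: m :: ms) xs.
  move=> x xxs; split; last exact: ok1.
  by rewrite /eok /=; apply: lt_le_trans (Ybig x xxs).
have r20 : 0 < r ^+ 2 by rewrite exprn_gt0.
(* The accuracy r^2 may be requested because r and h are fixed before the heights [es]. *)
have := near_iter_and (happ (m :: ms) (conj vm hms) ok1 _ r20)
  (happ (D :: m :: ms) (conj vD (conj vm hms)) ok2 _ r20).
apply: near_iter_mono => es hes [a1 a2].
have hsl := relcloseds_slits cxs hes.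
have hp1 : relcloseds (map (pulls (m :: ms)) (slits xs es)).
  by apply: relcloseds_pulls => //; split.
rewrite pr_hit_cons; last exact: hp1; last exact: relclosed_hull.
rewrite restriction_hits1 // -map_comp.
have -> : @pull R D \o pulls (m :: ms) = pulls (D :: m :: ms) by [].
have pes := prodsq_ge0 es.
pose A := ed D 0 `^ alpha.
pose Y1 := map (fs (m :: ms)) xs; pose Y2 := map (fs (D :: m :: ms)) xs.
rewrite -/Y1 -/Y2 in a1 a2.
have Y1E : Y1 = map (ef m) (map (fs ms) xs) by rewrite /Y1 -map_comp.
have Y2E : Y2 = map (ef D) Y1 by rewrite /Y2 /Y1 -map_comp.
have c01 : entry_close (dl / 2) (map (fs ms) xs) Y1.
  rewrite Y1E; apply: close_map => _ /mapP[x xxs ->].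
  apply: le_trans (efm x xxs) _; lra.
pose eta := 2 * r ^+ 2 / rho.
have eta0 : 0 <= eta.
  by apply: divr_ge0; [apply: mulr_ge0 => //; exact: sqr_ge0|exact: ltW].
have etadl : eta <= dl / 2.
  rewrite /eta ler_pdivrMr // expr2; move: rrho rdl r0 rho0 dl0; nra.
have c12 : entry_close eta Y1 Y2.
  rewrite Y2E; apply: close_map => _ /mapP[x xxs ->].
  by apply: ef_disc_close => //; exact: Ybig.
have c01' : entry_close dl (map (fs ms) xs) Y1 by apply: close_le c01; lra.
have c02 : entry_close dl (map (fs ms) xs) Y2.
  by have := close_trans c01 c12; apply: close_le; lra.
have l12 := hL _ _ _ c01' c02 eta0 c12.
have l02 := hL _ _ _ (close_refl (map (fs ms) xs) (ltW dl0)) c02 (ltW dl0) c02.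
pose t := r ^+ 2 / rho ^+ 2.
have rho2 : 0 < rho ^+ 2 by rewrite exprn_gt0.
have rr : r ^+ 2 <= rho ^+ 2 by rewrite ler_pXn2r // ?nnegrE ltW.
have t01 : 0 <= t <= 1 by rewrite divr_ge0 ?sqr_ge0 //= ler_pdivrMr // mul1r.
pose Q := \prod_(x <- xs) ed D (fs (m :: ms) x) ^+ 2.
have /andP[Q1 Q2] : (1 - t) ^+ (2 * n) <= Q <= 1.
  apply: prod_sqr_bounds => // x xxs.
  by have [/andP[_ ->] ->] := d0_disc_bounds c rho0 (Ybig x xxs) rr.
have A1 : (1 - t) ^+ N <= A.
  have [] := d0_disc_bounds c (u := 0 - c) rho0 _ rr; first by rewrite sub0r normrN.
  move=> /andP[e1 e2] e3; have e4 : 0 < ed D 0 by apply: ed_gt0 => //; exact: eok0.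
  apply: le_trans (powR_ge_expr _ aN); last by rewrite e4.
  by apply: lerXn2r; rewrite ?nnegrE // ltW.
have A2 : A <= 1.
  exact: avoid_le1.
have A0 : 0 <= A by exact: powR_ge0.
have AQ : 1 - A * Q <= (N + 2 * n)%:R * t.
  have b := bernoulli_le (N + 2 * n) t01; rewrite exprD in b.
  have g0 : 0 <= 1 - t by rewrite subr_ge0; case/andP: t01.
  have : (1 - t) ^+ N * (1 - t) ^+ (2 * n) <= A * Q by rewrite ler_pM // exprn_ge0.
  by move=> /(le_trans b); rewrite !lerBlDl addrC.
have AQ0 : 0 <= 1 - A * Q.
  have Q0 : 0 <= Q by apply: le_trans Q1; rewrite exprn_ge0 // subr_ge0; case/andP: t01.
  by rewrite subr_ge0 mulr_ile1.
(* The slit map has boundary derivative at most 1, which makes the constant independent of h. *)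
have W1 : wt (m :: ms) xs <= W0.
  rewrite wt_cons ler_piMl //.
  have := @prod_sqr_bounds _ xs (fun x => ed m (fs ms x)) 1.
  rewrite ler01 lexx /= subrr => /(_ isT) h1.
  apply: (proj2 (andP (h1 _))) => x xxs.
  have hne : fs ms x - y != 0 by rewrite subr_eq0; exact: zy.
  have /andP[q1 q2] := d0_slit_bounds y h0 hne.
  by apply/andP; split; [exact: ltW|].
have W10 : 0 <= wt (m :: ms) xs by apply: prodr_ge0 => x _; exact: sqr_ge0.
have corrB : `|corr Y2| <= `|Ms| + L * dl.
  by have := ler_normD (corr Y2 - Ms) Ms; rewrite subrK => hh; move: l02; rewrite -/Ms; lra.
have main : `|corr Y1 - A * Q * corr Y2| <=
    (L * 2 / rho + (N + 2 * n)%:R / rho ^+ 2 * (`|Ms| + L * dl)) * r ^+ 2.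
  have -> : corr Y1 - A * Q * corr Y2 = - (corr Y2 - corr Y1) + (1 - A * Q) * corr Y2 by ring.
  apply: le_trans (ler_normD _ _) _; rewrite normrN normrM (ger0_norm AQ0) [X in _ <= X]mulrDl lerD //.
    by apply: le_trans l12 _; rewrite /eta le_eqVlt; apply/orP; left; apply/eqP; ring.
  have -> : (N + 2 * n)%:R / rho ^+ 2 * (`|Ms| + L * dl) * r ^+ 2
     = (N + 2 * n)%:R * t * (`|Ms| + L * dl) by rewrite /t; ring.
  by apply: ler_pM.
have wE : wt (D :: m :: ms) xs = Q * wt (m :: ms) xs by exact: wt_cons.
rewrite wE in a2; rewrite -/A.
set p1 := pr _ in a1 *; set p2 := pr _ in a2 *.
have b1 : p1 - wt (m :: ms) xs * corr Y1 * prodsq es <= r ^+ 2 * prodsq es.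
  by apply: le_trans a1; exact: ler_norm.
have b2 : A * (Q * wt (m :: ms) xs * corr Y2 * prodsq es - p2) <= r ^+ 2 * prodsq es.
  apply: le_trans (_ : A * (r ^+ 2 * prodsq es) <= _).
    by rewrite ler_wpM2l //; apply: le_trans a2; rewrite distrC; exact: ler_norm.
  by rewrite ler_piMl // mulr_ge0 // ltW.
have b3 : wt (m :: ms) xs * (corr Y1 - A * Q * corr Y2) <=
    W0 * ((L * 2 / rho + (N + 2 * n)%:R / rho ^+ 2 * (`|Ms| + L * dl)) * r ^+ 2).
  apply: le_trans (_ : wt (m :: ms) xs * `|corr Y1 - A * Q * corr Y2| <= _).
    by rewrite ler_wpM2l // ler_norm.
  by rewrite ler_pM.
have b4 := ler_wpM2r pes b3.
have -> : K * r ^+ 2 * prodsq es = W0 * ((L * 2 / rho + (N + 2 * n)%:R / rho ^+ 2 *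
   (`|Ms| + L * dl)) * r ^+ 2) * prodsq es + (r ^+ 2 * prodsq es + r ^+ 2 * prodsq es).
  by rewrite /K; ring.
have -> : p1 - A * p2 = wt (m :: ms) xs * (corr Y1 - A * Q * corr Y2) * prodsq es
   + ((p1 - wt (m :: ms) xs * corr Y1 * prodsq es)
   + A * (Q * wt (m :: ms) xs * corr Y2 * prodsq es - p2)) by ring.
by rewrite lerD // lerD.
Qed.

Definition box y a c : set C := [set z | [/\ HP z, `|Re z - y| <= a & Im z <= c]].

Lemma relclosed_box y a c : relclosed (box y a c).
Proof.
split; first by move=> z [].
apply/cplx_openP => z [z0 hz]; rewrite /upper_half_plane /= in z0.
have [rz|rz] := leP `|Re z - y| a; last first.
  exists (Num.min (Im z) (`|Re z - y| - a)); first by rewrite lt_min z0 subr_gt0.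
  move=> u; rewrite lt_min => /andP[u1 u2]; split.
    have := le_lt_trans (Im_le_cabs _) u1; rewrite cImD cImN ltr_norml /upper_half_plane /= => /andP[]; lra.
  move=> [_ + _]; have := le_lt_trans (Re_le_cabs _) u2; rewrite cReD cReN.
  have := ler_normD (Re u - y) (- (Re u - Re z)); rewrite normrN.
  have -> : Re u - y - (Re u - Re z) = Re z - y by ring.
  lra.
have [iz|iz] := leP (Im z) c; first by case: hz; split.
exists (Num.min (Im z) (Im z - c)); first by rewrite lt_min z0 subr_gt0.
move=> u; rewrite lt_min => /andP[u1 u2]; split.
  have := le_lt_trans (Im_le_cabs _) u1; rewrite cImD cImN ltr_norml /upper_half_plane /= => /andP[]; lra.
move=> [_ _]; have := le_lt_trans (Im_le_cabs _) u2; rewrite cImD cImN ltr_norml => /andP[]; lra.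
Qed.

(* Under [v = sqrt (u^2 + h^2)] the part of the box above the slit, where
   [Im u] exceeds [h] by at most [a], lands at height O(sqrt (h a)). *)
Lemma pull_box y h a w : y != 0 -> 0 < h -> 0 <= a ->
  pull (Slit y h) (box y a (h + a)) w ->
  [/\ 0 < Im w, Im w ^+ 2 <= 2 * (2 * h * a + a ^+ 2) &
      `|Re w + sqrt_shiftR (h ^+ 2) (- y)| <= 2 * (h + a)].
Proof.
move=> y0 h0 a0 [w0 hb]; have vm : evalid (Slit y h) by split.
have [z0 _] := ePhi_HP vm w0; case: hb; set z := ePhi _ _ in z0 * => _ rz iz ez.
pose u := z - y%:C%C; pose v := sqrt_shift (h ^+ 2) u.
have ev : w = v - (sqrt_shiftR (h ^+ 2) (- y))%:C%C by rewrite -ez.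
have rv : Re v = Re w + sqrt_shiftR (h ^+ 2) (- y) by rewrite ev cReD cReN /= subrK.
have iv : Im v = Im w by rewrite ev cImD cImN /= subr0.
have e1 := sqrt_shift_Re (h ^+ 2) u; have e2 := sqrt_shift_Im (h ^+ 2) u.
rewrite -/v rv iv in e1 e2.
have ru : Re u = Re z - y by rewrite cReD cReN.
have iu : Im u = Im z by rewrite cImD cImN /= subr0.
rewrite iu in e1 e2; rewrite /upper_half_plane /= in w0 z0.
set t := Re w + _ in e1 e2 *; set s := Im w in w0 e1 e2 *.
rewrite -ru in rz; set p := Re u in rz e1 e2; set q := Im z in iz z0 e1 e2.
have ts : `|t| * s <= 2 * h * a + a ^+ 2.
  rewrite -(gtr0_norm w0) -normrM e2 normrM (gtr0_norm z0).
  apply: le_trans (_ : a * (h + a) <= _); first by rewrite ler_pM // ltW.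
  by rewrite mulrDr expr2 lerD2r mulrC; move: h0 a0; nra.
have qh : q ^+ 2 <= (h + a) ^+ 2 by rewrite ler_pXn2r // ?nnegrE ?ltW // ltr_wpDr.
have tt : t ^+ 2 = `|t| ^+ 2 by rewrite real_normK ?num_real.
have pp : p ^+ 2 <= a ^+ 2 by rewrite -[p ^+ 2]real_normK ?num_real // ler_pXn2r // nnegrE.
(* If s <= |t| then s^2 <= |t| s. Otherwise t^2 <= |t| s, and the real part of v^2 = u^2 + h^2
   bounds s^2 by t^2 + q^2 - h^2. *)
have s2 : s ^+ 2 <= 2 * (2 * h * a + a ^+ 2).
  have t0 := normr_ge0 t; have p2 := sqr_ge0 p.
  have [ts'|ts'] := leP s `|t|.
    have : s ^+ 2 <= `|t| * s by rewrite expr2 ler_wpM2r // ltW.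
    have : 0 <= 2 * h * a + a ^+ 2 by rewrite addr_ge0 ?sqr_ge0 // !mulr_ge0 // ltW.
    lra.
  have : `|t| ^+ 2 <= `|t| * s by rewrite expr2 ler_wpM2l // ltW.
  move: e1 qh ts p2; rewrite tt sqrrD; lra.
split=> //; rewrite -(@ler_pXn2r _ 2) ?nnegrE ?mulr_ge0 ?addr_ge0 ?(ltW h0) //.
have : 0 <= h * a by rewrite mulr_ge0 // ltW.
have : 0 <= q ^+ 2 by exact: sqr_ge0.
have -> : (2 * (h + a)) ^+ 2 = 4 * h ^+ 2 + 8 * (h * a) + 4 * a ^+ 2 by ring.
have e3 : 2 * h * a = 2 * (h * a) by ring.
rewrite -tt; move: e1 pp s2 (sqr_ge0 h) (sqr_ge0 a); rewrite e3; lra.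
Qed.

Lemma pr_cover (I : eqType) (E : set T) (F : I -> set T) (cs : seq I) (M : R) :
  measurable E -> (forall i, i \in cs -> measurable (F i)) ->
  (forall w, E w -> exists2 i, i \in cs & F i w) ->
  (forall i, i \in cs -> pr (F i) <= M) -> pr E <= (size cs)%:R * M.
Proof.
elim: cs E => [|i cs IH] E mE mF cov hM.
  have -> : E = set0 by apply/seteqP; split => w // /cov[].
  by rewrite /pr measure0 mul0r.
have mc : measurable (F i) by apply: mF; rewrite inE eqxx.
rewrite (pr_setD P mE mc) /= -natr1 mulrDl mul1r addrC lerD //.
  apply: IH.
  - by apply: measurableI => //; exact: measurableC.
  - by move=> i' h; apply: mF; rewrite inE h orbT.
  - move=> w [/cov[i' + Fc'] nF]; rewrite inE => /orP[/eqP e|h]; last by exists i'.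
    by case: nF; rewrite -e.
  - by move=> i' h; apply: hM; rewrite inE h orbT.
apply: le_trans (hM i _); last by rewrite inE eqxx.
by apply: pr_le => //; exact: measurableI.
Qed.

Lemma near_iter_all (I : eqType) n (cs : seq I) (A : I -> seq R -> Prop) :
  (forall i, i \in cs -> near_iter n (A i)) ->
  near_iter n (fun es => forall i, i \in cs -> A i es).
Proof.
elim: cs => [|i cs IH] h; first exact: near_iterT.
have h1 : near_iter n (fun es => forall i', i' \in cs -> A i' es).
  by apply: IH => i' h'; apply: h; rewrite inE h' orbT.
apply: near_iter_mono (near_iter_and (h i _) h1); last by rewrite inE eqxx.
by move=> es _ [a1 a2] i'; rewrite inE => /orP[/eqP->|/a2].
Qed.

Lemma box_bound ms xs y b K : valids ms -> conf xs -> oks_all ms xs ->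
  y != 0 -> y \notin map (fs ms) xs -> loclip (map (fs ms) xs) ->
  (forall ms', valids ms' -> oks_all ms' xs -> pull_asymp ms' xs) ->
  0 < b -> 0 <= K -> exists2 M, 0 <= M & near0 (fun e => near_iter (size xs) (fun es =>
    pr (hits (box y (K * e ^+ 2) (b * e * Num.sqrt 2 + K * e ^+ 2)
              :: map (pulls ms) (slits xs es)) `&` misses [:: slit y (b * e)])
    <= M * (e ^+ 2 * Num.sqrt e) * prodsq es)).
Proof.
move=> hms cxs okxs y0 yxs hL happ b0 K0.
have [Kd [delta [Kd0 dl0 hd]]] := disc_bound hms cxs okxs y0 yxs hL happ.
pose b' := b * Num.sqrt 2; have b'0 : 0 < b' by rewrite mulr_gt0 // sqrt2_gt0.
(* Chosen so that [rho] = c e^(3/2) exceeds the height of the pulled-back box, whose square is at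
   most 2 (2 h a + a^2) with h = b' e and a = K e^2. The summand 1 ensures c <= c^2. *)
pose c := 1 + 2 * (2 * b' * K + K ^+ 2).
have K1 : 0 <= 2 * b' * K + K ^+ 2 by rewrite addr_ge0 ?sqr_ge0 // !mulr_ge0 // ltW.
have c0 : 0 < c by rewrite ltr_wpDr // mulr_ge0.
pose K2 := 2 * (b' + K); have K20 : 0 < K2 by rewrite mulr_gt0 // ltr_wpDr.
have cK : 0 <= Kd * 4 * c ^+ 2 by apply: mulr_ge0; [exact: mulr_ge0|exact: sqr_ge0].
exists ((2 * K2 / c + 3) * (Kd * 4 * c ^+ 2)).
  apply: mulr_ge0 => //.
  by apply: addr_ge0 => //; apply: divr_ge0; [apply: mulr_ge0 => //|]; exact: ltW.
(* Collects what has to stay below delta: the height of the slit, the offset of the centers and the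
   radius of the discs. *)
pose q := b' + K2 + 2 * c + 1; have q0 : 0 < q.
  by apply: addr_gt0 => //; apply: addr_gt0; [exact: addr_gt0|exact: mulr_gt0].
have nd : near0 (fun e => e < Num.min 1 (delta / q)).
  by apply: near0_lt; rewrite lt_min ltr01 divr_gt0.
apply: near0_mono nd => e e0; rewrite lt_min => /andP[e1 eq].
have qe : q * e < delta by rewrite mulrC -ltr_pdivlMr.
pose s := Num.sqrt e; have s0 : 0 < s by rewrite sqrtr_gt0.
have ss : s ^+ 2 = e by rewrite sqr_sqrtr // ltW.
have s1 : s <= 1 by rewrite -sqrtr1 ler_wsqrtr // ltW.
pose h := b' * e; have h0 : 0 < h by rewrite mulr_gt0.
have hE : b * e * Num.sqrt 2 = h by rewrite /h /b'; ring.
pose a := K * e ^+ 2; have a0 : 0 <= a by rewrite mulr_ge0 // sqr_ge0.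
have aKe : a <= K * e by rewrite ler_wpM2l // expr2 ler_piMl ?ltW.
have qe' : h + K2 * e + 2 * (c * e) + e < delta.
  by have -> : h + K2 * e + 2 * (c * e) + e = q * e by rewrite /q /h; ring.
have ce0 : 0 < c * e by exact: mulr_gt0.
have Ke0 : 0 < K2 * e by exact: mulr_gt0.
pose rho := c * e * s; have rho0 : 0 < rho by rewrite !mulr_gt0.
have rhoe : rho <= c * e by rewrite ler_piMr // mulr_ge0 // ltW.
(* N steps of length rho cover the half-width K2 e of the pulled-back box and overshoot by at most
   rho. *)
pose N := (Num.truncn (K2 * e / rho)).+1.
have N1 : K2 * e <= N%:R * rho by rewrite -ler_pdivrMr //; exact: ltW (truncnS_gt _).
have N2 : N%:R * rho <= K2 * e + rho.
  rewrite -natr1 mulrDl mul1r lerD2r -ler_pdivlMr // truncn_le //.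
  by apply/ltW/divr_gt0.
pose F := sqrt_shiftR (h ^+ 2) (- y).
have Fy : `|F + y| <= h.
  by rewrite -[y in F + y]opprK; apply: sqrt_shiftR_close; rewrite ?oppr_eq0 // ltW.
(* Centers at spacing rho about - F. The radius 2 rho leaves rho for the horizontal rounding and rho
   for the height of the box. *)
pose ctr (k : nat) : R := (k%:R - N%:R) * rho - F.
pose ks := iota 0 (2 * N).+1.
have ctry k : k \in ks -> `|ctr k - y| < delta.
  rewrite mem_iota add0n ltnS => /andP[_ kN].
  have kN' : (k%:R <= 2 * N%:R :> R) by rewrite -natrM ler_nat.
  have -> : ctr k - y = (k%:R - N%:R) * rho - (F + y) by rewrite /ctr; ring.
  apply: le_lt_trans (ler_normB _ _) _.
  apply: le_lt_trans (_ : N%:R * rho + h < delta).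
    rewrite lerD // normrM (gtr0_norm rho0) ler_wpM2r ?(ltW rho0) // ler_norml.
    by have := ler0n R k; lra.
  move: qe' N2 rhoe ce0 Ke0 e0; move: (c * e) (K2 * e) (h : R) (rho : R) => A B D E.
  move: (N%:R * E) => G; lra.
have hdel : 0 < h < delta.
  rewrite h0 /=; move: qe' ce0 Ke0 e0; move: (c * e) (K2 * e) (h : R) => A B D; lra.
have rdel : 0 < 2 * rho < delta.
  rewrite mulr_gt0 //=; move: qe' h0 Ke0 e0 rhoe; move: (c * e) (K2 * e) (h : R) (rho : R) => A B D E; lra.
pose m := Slit y h; have vm : evalid m by split.
have hk k : k \in ks -> near_iter (size xs) (fun es =>
    pr (hits (hull (Disc (ctr k) (2 * rho)) :: map (pulls (m :: ms)) (slits xs es)))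
      <= Kd * (2 * rho) ^+ 2 * prodsq es).
  by move=> kk; have [_] := hd h (ctr k) (2 * rho) hdel (ctry k kk) rdel.
have vD k : k \in ks -> evalid (Disc (ctr k) (2 * rho)).
  by move=> kk; have [] := hd h (ctr k) (2 * rho) hdel (ctry k kk) rdel.
have := near_iter_all hk; apply: near_iter_mono => es hes hB.
rewrite /slit hE -/m -/a.
have hsl := relcloseds_slits cxs hes.
have hp1 : relcloseds (map (pulls ms) (slits xs es)) by exact: relcloseds_pulls.
have rb := relclosed_box y a (h + a).
rewrite restriction_hits1 //=.
rewrite -map_comp.
have rc : relcloseds (map (@pull R m \o pulls ms) (slits xs es)).
  by rewrite map_comp; exact: relcloseds_pull.
(* The avoidance probability produced by restriction is bounded by 1. *)
apply: le_trans (ler_piMl _ (avoid_le1 vm)) _; first exact: pr_ge0.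
have := @pr_cover _ (hits (pull m (box y a (h + a)) :: map (pulls (m :: ms)) (slits xs es)))
  (fun k => hits (hull (Disc (ctr k) (2 * rho)) :: map (pulls (m :: ms)) (slits xs es))) ks
  (Kd * (2 * rho) ^+ 2 * prodsq es).
move=> /(_ _ _ _ hB) cov; apply: le_trans (cov _ _ _) _.
- by apply: (measurable_hits gm gc); split=> //; exact: relclosed_pull.
- move=> k kk; apply: (measurable_hits gm gc); split=> //; apply: relclosed_hull; exact: vD.
- move=> w [[t t0 ht] hr].
  have [v0 v1 v2] := pull_box y0 h0 a0 ht.
  rewrite -/F in v2; set z := gamma t w in ht v0 v1 v2.
  have zr : Im z <= rho.
    rewrite -(@ler_pXn2r _ 2) ?nnegrE ?(ltW v0) ?(ltW rho0) //; apply: le_trans v1 _.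
    have -> : rho ^+ 2 = c ^+ 2 * e ^+ 3 by rewrite /rho !exprMn ss; ring.
    have cc : c <= c ^+ 2 by rewrite expr2 ler_peMl ?(ltW c0) // lerDl mulr_ge0.
    apply: le_trans (_ : c * e ^+ 3 <= _); last by rewrite ler_wpM2r // exprn_ge0 // ltW.
    have e3 : 0 < e ^+ 3 by rewrite exprn_gt0.
    have : K ^+ 2 * e ^+ 4 <= K ^+ 2 * e ^+ 3.
      by rewrite ler_wpM2l ?sqr_ge0 // exprS ler_piMl ?(ltW e3) // ltW.
    rewrite /c /h /a; move: e3; set X := K ^+ 2 * e ^+ 4 => e3 hX.
    have -> : 2 * (2 * (b' * e) * (K * e ^+ 2) + (K * e ^+ 2) ^+ 2)
      = 2 * (2 * b' * K) * e ^+ 3 + 2 * X by rewrite /X; ring.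
    lra.
  have v3 : `|Re z + F| <= N%:R * rho.
    apply: le_trans v2 (le_trans _ N1); rewrite /K2 -mulrA ler_wpM2l // mulrDl lerD2l.
    exact: aKe.
  pose X := (Re z + F + N%:R * rho) / rho.
  have X0 : 0 <= X by apply: divr_ge0; [move: v3; rewrite ler_norml; lra|exact: ltW].
  have /andP[k1 k2] := truncn_itv X0; set k := Num.truncn X in k1 k2.
  rewrite ler_pdivlMr // in k1; rewrite ltr_pdivrMr // in k2.
  exists k.
    rewrite mem_iota add0n /= ltnS -(ler_nat R) natrM -(ler_pM2r rho0).
    apply: le_trans k1 _; move: v3; rewrite ler_norml; lra.
  split=> //; exists t => //=; rewrite -/z.
  split; first by apply/HP_subR.
  apply: le_trans (cabs_le_ReIm _) _; rewrite cReD cReN cImD cImN /= subr0 (gtr0_norm v0).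
  have : `|Re z - ctr k| <= rho.
    rewrite /ctr ler_norml; move: k1 k2; rewrite -natr1 mulrDl mul1r mulrBl; lra.
  lra.
- rewrite size_iota -natr1 natrM.
  have pes := prodsq_ge0 es.
  rewrite [X in X <= _]mulrA; apply: ler_wpM2r => //.
  have e2s : e ^+ 2 * s ^+ 2 <= e ^+ 2 * s.
    by rewrite ler_wpM2l ?sqr_ge0 // expr2 ler_piMl // ltW.
  have -> : (2 * N%:R + 1) * (Kd * (2 * rho) ^+ 2) =
    (2 * (N%:R * rho) + rho) * (Kd * 4 * rho) by ring.
  apply: le_trans (_ : (2 * (K2 * e + rho) + rho) * (Kd * 4 * rho) <= _).
    apply: ler_wpM2r; last by rewrite lerD2r ler_wpM2l.
    by apply: mulr_ge0 (ltW rho0); exact: mulr_ge0.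
  have -> : (2 * (K2 * e + rho) + rho) * (Kd * 4 * rho) =
     2 * K2 / c * (Kd * 4 * c ^+ 2) * (e ^+ 2 * s) + 3 * (Kd * 4 * c ^+ 2) * (e ^+ 2 * s ^+ 2).
    by rewrite /rho; field; rewrite gt_eqF.
  rewrite -/s [X in _ <= X * _]mulrDl [X in _ <= X]mulrDl lerD2l.
  by apply: ler_wpM2l => //; apply: mulr_ge0.
Qed.
End TwoScale.

(** * Replacing pulled-back slits by slits at the image points *)

Section Approximation.
Variables (R : realType) (d : measure_display) (T : measurableType d)
  (P : probability T R) (gamma : R -> T -> cplx R) (alpha : R).
Local Notation C := (cplx R).
Local Notation Re := (@complex.Re R).
Local Notation Im := (@complex.Im R).
Local Notation HP := (@upper_half_plane R).
Implicit Types (ms : seq (emap R)) (xs ys zs es : seq R) (x y e h r c : R).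

Hypothesis gm : forall t, 0 <= t ->
  measurable_fun setT (fun w => Re (gamma t w)) /\
  measurable_fun setT (fun w => Im (gamma t w)).
Hypothesis gc : forall w, {within `[0, +oo[, continuous (fun t => gamma t w)}.
Hypothesis restr : conformal_restriction P alpha gamma.

Local Notation pr := (pr P).
Local Notation hit := (hit gamma).
Local Notation hits := (hits gamma).
Local Notation misses := (misses gamma).
Variable corr : seq R -> R.
Local Notation loclip := (loclip corr).
Local Notation pull_asymp := (pull_asymp P gamma corr).

Lemma pullsE ms A z : valids ms -> A `<=` HP ->
  pulls ms A z <-> HP z /\ A (Phis ms z).
Proof.
move=> + AH; elim: ms z => [|m ms IH] z /=.
  by move=> _; split; [move=> h; split=> //; exact: AH|case].
move=> [hm hms]; split; first by move=> [z0 /(IH _ hms)[]].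
by move=> [z0 h]; split=> //; apply/IH => //; split=> //; have [] := ePhi_HP hm z0.
Qed.

(** By restriction, pulling back by one map costs the factor [ed m 0] to the power - alpha and adds
    the condition of missing the hull, which is then dropped. *)
Lemma pulls_le ms : valids ms -> exists2 k : R, 0 <= k & forall Ss Ts : seq (set C),
  relcloseds Ss -> relcloseds Ts ->
  pr (hits (map (pulls ms) Ss) `&` misses (map (pulls ms) Ts))
  <= k * pr (hits Ss `&` misses Ts).
Proof.
elim: ms => [_|m ms IH [hm /[dup] hms /IH[k k0 hk]]].
  by exists 1 => // Ss Ts _ _; rewrite !map_id mul1r.
have A0 : 0 < ed m 0 `^ alpha by rewrite powR_gt0 // ed_gt0 //; exact: eok0.
exists ((ed m 0 `^ alpha)^-1 * k); first by rewrite mulr_ge0 // invr_ge0 ltW.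
move=> Ss Ts hS hT; have hS' := relcloseds_pulls hms hS; have hT' := relcloseds_pulls hms hT.
rewrite -mulrA -ler_pdivrMl ?invr_gt0 // invrK.
apply: le_trans (hk _ _ hS hT).
rewrite -[X in pr (hits X `&` _)]/(map (pull m \o pulls ms) Ss).
rewrite -[X in misses X]/(map (pull m \o pulls ms) Ts) !(map_comp (@pull R m) (pulls ms)).
rewrite -(restriction_hits gm gc restr hm hS' hT').
apply: pr_le.
- apply: measurableI; first exact: (measurable_hits gm gc).
  by apply: (measurable_misses gm gc); split=> //; exact: relclosed_hull.
- by apply: measurableI; [exact: (measurable_hits gm gc)|exact: (measurable_misses gm gc)].
- by move=> w [h1 [_ h2]].
Qed.

Lemma slitP x e z : slit x e z <-> Re z = x /\ 0 < Im z <= e * Num.sqrt 2.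
Proof.
rewrite /slit /hull /= cReD cReN cImD cImN /= subr0.
by split=> -[h ->]; split=> //; [apply/eqP; rewrite -subr_eq0 h|rewrite h subrr].
Qed.

Lemma cabs_slit (t : R) z : Re z = 0 -> 0 < Im z <= t -> cabs z = Im z.
Proof.
by move=> rz /andP[i0 _]; rewrite /cabs rz expr0n add0r sqrtr_sqr gtr0_norm.
Qed.

Lemma sqr_sqrt2 e : (e * Num.sqrt 2) ^+ 2 = 2 * e ^+ 2 :> R.
Proof. by rewrite exprMn sqr_sqrtr // mulrC. Qed.

(** At the scale of the slit the composite map is multiplication by [ds ms x] up to k |u|^2 <= 2 k
    e^2. This bounds both the deviation from the vertical and the excess over the height of the
    image slit. *)
Lemma pulls_slit_box ms x : valids ms -> oks ms x -> exists2 K, 0 <= K &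
  near0 (fun e => pulls ms (slit x e) `<=`
    box (fs ms x) (K * e ^+ 2) (ds ms x * e * Num.sqrt 2 + K * e ^+ 2)).
Proof.
move=> hms okx; have a0 := ds_gt0 hms okx.
have [k [dl dl0 [k0 H]]] := expands_phis hms okx.
exists (k * 2); first exact: mulr_ge0.
have : near0 (fun e => e * Num.sqrt 2 < dl).
  by exists (dl / Num.sqrt 2); [rewrite divr_gt0 // sqrt2_gt0|move=> e _; rewrite ltr_pdivlMr // sqrt2_gt0].
apply: near0_mono => e e0 edl z /pullsE -/(_ hms) [|z0 /slitP[rz iz]].
  by move=> w /slitP[_ /andP[]].
have [_ ez] := Phis_HP hms z0; set v := Phis ms z in rz iz ez.
pose u : C := v - x%:C%C.
have ru : Re u = 0 by rewrite cReD cReN rz subrr.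
have iu : Im u = Im v by rewrite cImD cImN /= subr0.
rewrite -iu in iz; have /andP[i0 i1] := iz.
have cu := cabs_slit ru iz.
have [|_] := H u i0 _; first by rewrite cu; exact: le_lt_trans edl.
have -> : x%:C%C + u = v by rewrite addrC subrK.
rewrite ez => hz.
have {}hz : cabs (z - (fs ms x)%:C%C - (ds ms x)%:C%C * u) <= k * 2 * e ^+ 2.
  apply: le_trans hz _; rewrite -mulrA ler_wpM2l // -sqr_sqrt2 cu ler_pXn2r // nnegrE.
  exact: ltW.
  exact: le_trans (ltW i0) i1.
split=> //.
  have := le_trans (Re_le_cabs _) hz.
  by rewrite !cReD !cReN cReM /= ru mulr0 mul0r subrr subr0.
have := le_trans (Im_le_cabs _) hz; rewrite !cImD !cImN cImM /= ru mulr0 addr0 subr0.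
rewrite ler_norml => /andP[_].
have : ds ms x * Im u <= ds ms x * (e * Num.sqrt 2) by rewrite ler_wpM2l // ltW.
by rewrite mulrA; move: (k * 2 * e ^+ 2) => q; lra.
Qed.

(** The converse inclusion, from the expansion of the inverse map [Phis ms]: here the box stands in
    the source. *)
Lemma slit_pulls_box ms x : valids ms -> oks ms x -> exists2 K, 0 <= K &
  near0 (fun e => slit (fs ms x) (ds ms x * e) `<=`
    pulls ms (box x (K * e ^+ 2) (e * Num.sqrt 2 + K * e ^+ 2))).
Proof.
move=> hms okx; have a0 := ds_gt0 hms okx; set a := ds ms x in a0 *.
have [k [dl dl0 [k0 H]]] := expands_Phis hms okx.
exists (k * 2 * a ^+ 2); first by apply: mulr_ge0; [exact: mulr_ge0|exact: sqr_ge0].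
have : near0 (fun e => a * e * Num.sqrt 2 < dl).
  exists (dl / (a * Num.sqrt 2)); first by rewrite divr_gt0 // mulr_gt0 // sqrt2_gt0.
  by move=> e _; rewrite ltr_pdivlMr ?mulr_gt0 ?sqrt2_gt0 // mulrCA mulrA.
apply: near0_mono => e e0 edl z /slitP[rz iz].
pose u : C := z - (fs ms x)%:C%C.
have ru : Re u = 0 by rewrite cReD cReN rz subrr.
have iu : Im u = Im z by rewrite cImD cImN /= subr0.
rewrite -iu in iz; have /andP[i0 i1] := iz.
have z0 : HP z by rewrite /upper_half_plane /= -iu.
have cu := cabs_slit ru iz.
apply/(pullsE _ hms); first by move=> w [].
split=> //.
have [|h1] := H u i0 _; first by rewrite cu; exact: le_lt_trans edl.
have -> : (fs ms x)%:C%C + u = z by rewrite addrC subrK.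
set v := Phis ms z => hz.
have {}hz : cabs (v - x%:C%C - (a^-1)%:C%C * u) <= k * 2 * a ^+ 2 * e ^+ 2.
  have -> : k * 2 * a ^+ 2 * e ^+ 2 = k * (a * e * Num.sqrt 2) ^+ 2 by rewrite sqr_sqrt2; ring.
  apply: le_trans hz _; rewrite ler_wpM2l // cu ler_pXn2r // nnegrE.
  exact: ltW.
  exact: le_trans (ltW i0) i1.
split.
- by have [] := Phis_HP hms z0.
- have := le_trans (Re_le_cabs _) hz.
  by rewrite !cReD !cReN cReM /= ru mulr0 mul0r subrr subr0.
have := le_trans (Im_le_cabs _) hz; rewrite !cImD !cImN cImM /= ru mulr0 addr0 subr0.
rewrite ler_norml => /andP[_].
have : a^-1 * Im u <= e * Num.sqrt 2 by rewrite mulrC ler_pdivrMr // [_ * a]mulrC mulrA.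
by move: (k * 2 * a ^+ 2 * e ^+ 2) => q; lra.
Qed.

(* The path telling the two slits apart meets a box above one of them and misses that
   one, either in the image or in the source of [phis ms]. *)
Lemma sym_bound ms x xs : valids ms -> conf (x :: xs) -> oks_all ms (x :: xs) ->
  loclip xs -> loclip (map (fs ms) xs) ->
  (forall ms', valids ms' -> oks_all ms' xs -> pull_asymp ms' xs) ->
  exists2 M, 0 <= M & near0 (fun e => near_iter (size xs) (fun es =>
    forall G, measurable G ->
    `|pr (G `&` hits (map (pulls ms) (slits (x :: xs) (e :: es))))
      - pr (G `&` hits (slit (fs ms x) (ds ms x * e) :: map (pulls ms) (slits xs es)))|
    <= M * (e ^+ 2 * Num.sqrt e) * prodsq es)).
Proof.
move=> hms /[dup] hc /conf_cons[x0 xxs cxs] oka l1 l2 happ.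
have okx : oks ms x by apply: oka; rewrite inE eqxx.
have okxs : oks_all ms xs by move=> u us; apply: oka; rewrite inE us orbT.
have a0 := ds_gt0 hms okx.
have [K1 K10 n1] := pulls_slit_box hms okx.
have [K2 K20 n2] := slit_pulls_box hms okx.
have y0 : fs ms x != 0.
  apply: contraNneq x0 => h; apply/eqP/(fs_inj hms okx (oks0 hms)).
  by rewrite h fs0.
have yxs : fs ms x \notin map (fs ms) xs.
  apply: contra xxs => /mapP[u us] /(fs_inj hms okx (okxs _ us)) ->; exact: us.
have [M1 M10 b1] := box_bound gm gc restr hms cxs okxs y0 yxs l2 happ a0 K10.
have [k k0 hk] := pulls_le hms.
(* The same estimate in the source, where no map has been applied; [pulls_le] transports it to the
   image. *)
have [M2 M20 b2] : exists2 M, 0 <= M & near0 (fun e => near_iter (size xs) (fun es =>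
    pr (hits (box x (K2 * e ^+ 2) (1 * e * Num.sqrt 2 + K2 * e ^+ 2)
              :: slits xs es) `&` misses [:: slit x (1 * e)])
    <= M * (e ^+ 2 * Num.sqrt e) * prodsq es)).
  have := box_bound gm gc restr (ms := [::]) Logic.I cxs _ x0 _ _ happ ltr01 K20.
  rewrite (_ : map (fs [::]) xs = xs); last exact: map_id.
  move=> /(_ _ xxs l1)[//|M M0 b]; exists M => //.
  apply: near0_mono b => e _; apply: near_iter_mono => es _.
  by rewrite (_ : map (pulls [::]) (slits xs es) = slits xs es) //; exact: map_id.
exists (M1 + k * M2); first by rewrite addr_ge0 // mulr_ge0.
have := near0_and (near0_and n1 n2) (near0_and b1 b2).
apply: near0_mono => e e0 [[s1 s2] [{}b1 {}b2]].
apply: near_iter_mono (near_iter_and b1 b2) => es hes [{}b1 {}b2] G mG.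
rewrite mul1r in b2.
have hsl := relcloseds_slits cxs hes.
have rs := relcloseds_pulls hms hsl.
have rx := relclosed_slit x0 e0.
have rpx := relclosed_pulls hms rx.
have ry : relclosed (slit (fs ms x) (ds ms x * e)) by apply: relclosed_slit => //; exact: mulr_gt0.
set S := pulls ms (slit x e) in rpx s1 *; set Y := slit (fs ms x) _ in ry s2 b1 *.
rewrite /= -/S.
set Q := map (pulls ms) (slits xs es) in rs b1 *.
have mS := measurable_hit gm gc rpx; have mY := measurable_hit gm gc ry.
have mQ := measurable_hits gm gc rs.
have c1 : pr (G `&` (hit S `&` hits Q)) <= pr (G `&` (hit Y `&` hits Q)) +
    M1 * (e ^+ 2 * Num.sqrt e) * prodsq es.
  rewrite (pr_setD P (measurableI _ _ mG (measurableI _ _ mS mQ)) mY) lerD //.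
    apply: pr_le; try by repeat apply: measurableI.
    by move=> w [[? [? ?]] ?].
  have rb := relclosed_box (fs ms x) (K1 * e ^+ 2) (ds ms x * e * Num.sqrt 2 + K1 * e ^+ 2).
  apply: le_trans b1; apply: pr_le.
  - by apply: measurableI; [repeat apply: measurableI|exact: measurableC].
  - apply: measurableI; first by apply: (measurable_hits gm gc).
    by apply: (measurable_misses gm gc).
  - move=> w [[_ [[t t0 /s1 ht] hq]] hn]; split; last by split.
    by split=> //; exists t.
have c2 : pr (G `&` (hit Y `&` hits Q)) <= pr (G `&` (hit S `&` hits Q)) +
    k * M2 * (e ^+ 2 * Num.sqrt e) * prodsq es.
  rewrite (pr_setD P (measurableI _ _ mG (measurableI _ _ mY mQ)) mS) lerD //.
    apply: pr_le; try by repeat apply: measurableI.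
    by move=> w [[? [? ?]] ?].
  have rb := relclosed_box x (K2 * e ^+ 2) (e * Num.sqrt 2 + K2 * e ^+ 2).
  have -> : k * M2 * (e ^+ 2 * Num.sqrt e) * prodsq es
    = k * (M2 * (e ^+ 2 * Num.sqrt e) * prodsq es) by ring.
  have hk' := hk (_ :: slits xs es) [:: slit x e] (conj rb hsl) (conj rx Logic.I).
  apply: le_trans (le_trans hk' (ler_wpM2l k0 b2)).
  apply: pr_le.
  - by apply: measurableI; [repeat apply: measurableI|exact: measurableC].
  - apply: measurableI; first by apply: (measurable_hits gm gc); split=> //; exact: relclosed_pulls.
    by apply: (measurable_misses gm gc).
  - move=> w [[_ [[t t0 /s2 ht] hq]] hn]; split; last by split.
    by split=> //; exists t.
have q0 : 0 <= e ^+ 2 * Num.sqrt e by apply: mulr_ge0; [exact: sqr_ge0|exact: sqrtr_ge0].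
have p1 : 0 <= M1 * (e ^+ 2 * Num.sqrt e) * prodsq es.
  by apply: mulr_ge0 (prodsq_ge0 _); exact: mulr_ge0.
have p2 : 0 <= k * M2 * (e ^+ 2 * Num.sqrt e) * prodsq es.
  by apply: mulr_ge0 (prodsq_ge0 _); apply: mulr_ge0 => //; exact: mulr_ge0.
rewrite !mulrDl ler_norml; move: c1 c2 p1 p2.
by move: (M1 * _ * _) (k * M2 * _ * _) => q1 q2; lra.
Qed.

Hypothesis corr_lim : forall xs, conf xs -> forall eta, 0 < eta ->
  near_iter (size xs) (fun es =>
    `|pr (hits (slits xs es)) - corr xs * prodsq es| <= eta * prodsq es).

Lemma conf_map_fs ms xs : valids ms -> oks_all ms xs -> conf xs -> conf (map (fs ms) xs).
Proof.
move=> hms oka [ux x0]; split.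
  by rewrite map_inj_in_uniq // => u v us vs; apply: fs_inj; [exact: hms|exact: oka|exact: oka].
apply: contra x0 => /mapP[u us e].
by rewrite (fs_inj hms (oks0 hms) (oka _ us) (etrans (fs0 ms) e)).
Qed.

(** The pulled-back slits are exchanged one at a time for slits at the image points, each at the
    cost O(e^(5/2)) of [sym_bound]. What remains is the limit defining [corr] at these points, with
    rescaled heights. *)
Theorem pull_asymp_all xs : conf xs ->
  (forall ys, conf ys -> (size ys < size xs)%N -> loclip ys) ->
  forall ms, valids ms -> oks_all ms xs -> pull_asymp ms xs.
Proof.
(* The induction carries an arbitrary event [G]: once the first slit has been exchanged, hitting its
   replacement is absorbed into [G] while the others are treated. *)
suff main : conf xs ->
  (forall ys, conf ys -> (size ys < size xs)%N -> loclip ys) ->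
  forall ms, valids ms -> oks_all ms xs ->
  pull_asymp ms xs /\ forall eta, 0 < eta ->
  near_iter (size xs) (fun es => forall G, measurable G ->
    `|pr (G `&` hits (map (pulls ms) (slits xs es)))
      - pr (G `&` hits (slits (map (fs ms) xs) (mulseq (map (ds ms) xs) es)))|
    <= eta * prodsq es).
  by move=> cxs hl ms hms oka; have [] := main cxs hl ms hms oka.
elim: xs => [|x xs IH].
  move=> _ _ ms hms _; split; last first.
    by move=> eta eta0 /= G _; rewrite subrr normr0 mulr_ge0 ?prodsq_ge0 // ltW.
  move=> eta eta0 /=; have := corr_lim (xs := [::]) (conj erefl erefl) eta0.
  by rewrite /= /wt big_nil mul1r.
move=> /[dup] hc /conf_cons[x0 xxs cxs] hl ms hms oka.
have okx : oks ms x by apply: oka; rewrite inE eqxx.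
have okxs : oks_all ms xs by move=> u us; apply: oka; rewrite inE us orbT.
have hl' ys : conf ys -> (size ys < size xs)%N -> loclip ys.
  by move=> cy sy; apply: hl => //=; exact: ltnW.
have happ ms' : valids ms' -> oks_all ms' xs -> pull_asymp ms' xs.
  by move=> v o; have [] := IH cxs hl' ms' v o.
have l1 : loclip xs by exact: hl.
have l2 : loclip (map (fs ms) xs).
  by apply: hl; [exact: conf_map_fs|rewrite size_map].
have [M M0 hM] := sym_bound hms hc oka l1 l2 happ.
have [_ hT] := IH cxs hl' ms hms okxs.
have main eta : 0 < eta -> near_iter (size (x :: xs)) (fun es => forall G, measurable G ->
    `|pr (G `&` hits (map (pulls ms) (slits (x :: xs) es)))
      - pr (G `&` hits (slits (map (fs ms) (x :: xs)) (mulseq (map (ds ms) (x :: xs)) es)))|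
    <= eta * prodsq es).
  (* The extra factor sqrt e beyond e^2 absorbs the constant M. *)
  move=> eta0; have nM : near0 (fun e => M * Num.sqrt e <= eta / 2).
    have q0 : 0 < eta / 2 / (M + 1) by rewrite !divr_gt0 // ltr_wpDl.
    exists ((eta / 2 / (M + 1)) ^+ 2); first by rewrite exprn_gt0.
    move=> e e0 /ltW he; rewrite -(divfK (lt0r_neq0 (_ : 0 < M + 1)) (eta / 2)); last by rewrite ltr_wpDl.
    rewrite [_ * (M + 1)]mulrC; apply: ler_pM => //; first by rewrite lerDl.
    by rewrite -[X in _ <= X]ger0_norm ?(ltW q0) // -sqrtr_sqr ler_wsqrtr.
  apply: near0_mono (near0_and nM hM) => e e0 [hMe hs].
  have e2 : 0 < e ^+ 2 by rewrite exprn_gt0.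
  (* The height e being fixed, the remaining slits are exchanged with accuracy eta / 2 times e^2. *)
  have := near_iter_and hs (hT (eta / 2 * e ^+ 2) (mulr_gt0 (divr_gt0 eta0 (ltr0Sn R 1)) e2)).
  apply: near_iter_mono => es hes [h1 h2] G mG.
  have a0 := ds_gt0 hms okx.
  have ry : relclosed (slit (fs ms x) (ds ms x * e)).
    apply: relclosed_slit; last exact: mulr_gt0.
    by have [] := conf_cons (conf_map_fs hms oka hc).
  have mY := measurable_hit gm gc ry.
  have := h1 G mG; have := h2 _ (measurableI _ _ mG mY).
  rewrite -!setIA /= prodsq_cons.
  set A := pr _; set B := pr _; set D := pr _ => k1 k2.
  have -> : D - B = (D - A) + (A - B) by ring.
  apply: le_trans (ler_normD _ _) _.
  have k3 : M * (e ^+ 2 * Num.sqrt e) * prodsq es <= eta / 2 * (e ^+ 2 * prodsq es).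
    have -> : M * (e ^+ 2 * Num.sqrt e) * prodsq es = M * Num.sqrt e * (e ^+ 2 * prodsq es) by ring.
    by apply: ler_wpM2r => //; apply: mulr_ge0 (prodsq_ge0 _); exact: sqr_ge0.
  have -> : eta * (e ^+ 2 * prodsq es) = eta / 2 * (e ^+ 2 * prodsq es) + eta / 2 * e ^+ 2 * prodsq es.
    by field.
  by rewrite lerD // (le_trans k2).
split=> // eta eta0.
have cy := conf_map_fs hms oka hc; set ys := map (fs ms) (x :: xs) in cy *.
pose w := wt ms (x :: xs).
have w0 : 0 <= w by apply: prodr_ge0 => u _; exact: sqr_ge0.
have eta' : 0 < eta / 2 / (w + 1) by rewrite !divr_gt0 // ltr_wpDl.
have hpos a : a \in map (ds ms) (x :: xs) -> 0 < a.
  by move=> /mapP[u us ->]; apply: ds_gt0 => //; exact: oka.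
have sz : size ys = size (map (ds ms) (x :: xs)) by rewrite !size_map.
(* The heights at the image points are those of [es] multiplied by the derivatives; their squares
   contribute the factor [wt]. *)
have := corr_lim cy eta'; rewrite sz => /(near_iter_scale hpos); rewrite size_map => h1.
have := near_iter_and h1 (main _ (divr_gt0 eta0 (ltr0Sn R 1))); apply: near_iter_mono => es hes [{}h1 h2].
have := h2 _ measurableT; rewrite !setTI -/ys.
have wE : prodsq (mulseq (map (ds ms) (x :: xs)) es) = w * prodsq es.
  by rewrite prodsq_mulseq ?size_map ?hes.1 // /prodsq big_map.
move: h1; rewrite wE -/w; set A := pr _; set B := pr _ => h1 {}h2.
have -> : B - w * corr ys * prodsq es = (B - A) + (A - corr ys * (w * prodsq es)) by ring.
apply: le_trans (ler_normD _ _) _.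
have -> : eta * prodsq es = eta / 2 * prodsq es + eta / 2 * prodsq es by field.
rewrite lerD //; apply: le_trans h1 _; rewrite mulrA ler_wpM2r ?prodsq_ge0 //.
by rewrite mulrAC ler_pdivrMr ?ltr_wpDl // ler_wpM2l ?lerDl // ltW // divr_gt0.
Qed.
End Approximation.

(** * The Ward identity *)

Section Jets.
Variable R : realType.
Implicit Types (g f : R -> R) (a b c x y e h : R).

(* First-order expansion [g delta = a + b delta^2 + o(delta^2)] as [delta] tends to [0+]. *)
Definition jet g a b : Prop := forall eta, 0 < eta ->
  near0 (fun e => `|g e - a - b * e ^+ 2| <= eta * e ^+ 2).

Lemma jet_cst a : jet (fun _ => a) a 0.
Proof.
move=> eta eta0; exists 1 => // e _ _.
by rewrite subrr mul0r subrr normr0 mulr_ge0 ?sqr_ge0 // ltW.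
Qed.

Lemma jet_sqr : jet (fun e => e ^+ 2) 0 1.
Proof.
move=> eta eta0; exists 1 => // e _ _.
by rewrite subr0 mul1r subrr normr0 mulr_ge0 ?sqr_ge0 // ltW.
Qed.

Lemma jet_near g f a b : near0 (fun e => f e = g e) -> jet f a b -> jet g a b.
Proof. by move=> fg hf eta /hf; move/(near0_and fg); apply: near0_mono => e _ [->]. Qed.

Lemma jetD f g a b a' b' : jet f a b -> jet g a' b' ->
  jet (fun e => f e + g e) (a + a') (b + b').
Proof.
move=> hf hg eta eta0; have e2 : 0 < eta / 2 by rewrite divr_gt0.
apply: near0_mono (near0_and (hf _ e2) (hg _ e2)) => e _ [h1 h2].
have -> : f e + g e - (a + a') - (b + b') * e ^+ 2
  = (f e - a - b * e ^+ 2) + (g e - a' - b' * e ^+ 2) by ring.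
apply: le_trans (ler_normD _ _) _; have -> : eta = eta / 2 + eta / 2 by field.
by rewrite mulrDl lerD.
Qed.

Lemma jet_lip g a b : jet g a b ->
  near0 (fun e => `|g e - a| <= (`|b| + 1) * e ^+ 2).
Proof.
move=> /(_ 1 ltr01); apply: near0_mono => e e0 h.
rewrite -(subrK (b * e ^+ 2) (g e - a)); apply: le_trans (ler_normD _ _) _.
by rewrite mulrDl addrC lerD // normrM (ger0_norm (sqr_ge0 _)).
Qed.

Lemma near0_sqr_lt c : 0 < c -> near0 (fun e => e ^+ 2 < c).
Proof.
move=> c0; exists (Num.sqrt c); first by rewrite sqrtr_gt0.
move=> e e0 ec; rewrite -(sqr_sqrtr (ltW c0)) ltr_pXn2r // ?nnegrE ?sqrtr_ge0 //.
exact: ltW.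
Qed.

Lemma near0_sqr_mul_lt k c : 0 <= k -> 0 < c -> near0 (fun e => k * e ^+ 2 < c).
Proof.
move=> k0 c0; have k1 : 0 < k + 1 by rewrite ltr_wpDl.
apply: near0_mono (near0_sqr_lt (divr_gt0 c0 k1)) => e e0.
rewrite ltr_pdivlMr // => h; apply: le_lt_trans h.
by rewrite mulrC ler_wpM2l ?sqr_ge0 // lerDl.
Qed.

Lemma jet_close g a b r : jet g a b -> 0 < r -> near0 (fun e => `|g e - a| < r).
Proof.
move=> /jet_lip h r0; have b1 : 0 <= `|b| + 1 by rewrite addr_ge0.
apply: near0_mono (near0_and h (near0_sqr_mul_lt b1 r0)) => e _ [h1 h2].
exact: le_lt_trans h1 h2.
Qed.

Lemma jet_neq0 g a b : jet g a b -> a != 0 -> near0 (fun e => g e != 0).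
Proof.
move=> hg a0; have := jet_close hg (r := `|a|); rewrite normr_gt0 => /(_ a0).
by apply: near0_mono => e _; apply: contraTneq => ->; rewrite sub0r normrN ltxx.
Qed.

Lemma jet_chain (phi : R -> R) g a b l : is_derive a 1 phi l -> jet g a b ->
  jet (fun e => phi (g e)) (phi a) (l * b).
Proof.
move=> hd hg eta eta0; have b1 : 0 < `|b| + 1 by rewrite ltr_wpDl.
have l1 : 0 < `|l| + 1 by rewrite ltr_wpDl.
pose eta1 := eta / 2 / (`|b| + 1); have e1 : 0 < eta1 by rewrite !divr_gt0.
pose eta2 := eta / 2 / (`|l| + 1); have e2 : 0 < eta2 by rewrite !divr_gt0.
have [r r0 hr] : exists2 r : R, 0 < r & forall u, `|u - a| < r ->
    `|phi u - phi a - l * (u - a)| <= eta1 * `|u - a|.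
  have /derivable_nbhs := @ex_derive _ _ _ _ _ _ _ hd.
  rewrite derive_val => /eqaddoP /(_ _ e1) /nbhs_normP[r /= r0 hr].
  exists r => // u ur; have := hr (u - a); rewrite /= sub0r normrN => /(_ ur).
  rewrite -[X in `|X| <= _ -> _]/(phi ((u - a) * 1 + a) - (phi a + (u - a) * l)).
  by rewrite mulr1 subrK opprD addrA [(u - a) * l]mulrC.
apply: near0_mono (near0_and (near0_and (hg _ e2) (jet_lip hg)) (jet_close hg r0)).
move=> e e0 [[h1 h2] /hr h3].
have -> : phi (g e) - phi a - l * b * e ^+ 2 = (phi (g e) - phi a - l * (g e - a))
  + l * (g e - a - b * e ^+ 2) by ring.
apply: le_trans (ler_normD _ _) _; have -> : eta = eta / 2 + eta / 2 by field.
rewrite mulrDl lerD //.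
  apply: le_trans h3 _; apply: le_trans (ler_wpM2l (ltW e1) h2) _.
  by rewrite mulrA /eta1 divfK ?lt0r_neq0.
rewrite normrM; apply: le_trans (ler_wpM2l (normr_ge0 _) h1) _.
rewrite mulrA ler_wpM2r ?sqr_ge0 // /eta2 mulrA ler_pdivrMr //.
by rewrite [X in _ <= X]mulrC ler_wpM2r ?lerDl // ltW // divr_gt0.
Qed.

Lemma jet_scale c g a b : jet g a b -> jet (fun e => c * g e) (c * a) (c * b).
Proof.
have h := @is_deriveZ R R R id c a 1 1 (is_derive_id _ _).
by move=> /(jet_chain h); rewrite /GRing.scale /= mulr1.
Qed.

Lemma jet_sq g a b : jet g a b -> jet (fun e => g e ^+ 2) (a ^+ 2) (2 * a * b).
Proof.
have := @is_deriveX R R id 2 a 1 1 (is_derive_id _ _).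
rewrite /GRing.scale /= mulr1 expr1 => h.
by move=> /(jet_chain h).
Qed.

Lemma jetN g a b : jet g a b -> jet (fun e => - g e) (- a) (- b).
Proof.
move=> /(jet_scale (-1)); rewrite !mulN1r.
by apply: jet_near; exists 1 => // e _ _; rewrite mulN1r.
Qed.

(* Polarization: a product is a combination of two squares. *)
Lemma jetM f g a b a' b' : jet f a b -> jet g a' b' ->
  jet (fun e => f e * g e) (a * a') (a * b' + b * a').
Proof.
move=> hf hg; have h1 := jet_sq (jetD hf hg); have h2 := jetN (jet_sq (jetD hf (jetN hg))).
have := jet_scale (1 / 4) (jetD h1 h2).
have -> : 1 / 4 * ((a + a') ^+ 2 + - (a + - a') ^+ 2) = a * a' by field.
have -> : 1 / 4 * (2 * (a + a') * (b + b') + - (2 * (a + - a') * (b + - b')))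
  = a * b' + b * a' by field.
by apply: jet_near; exists 1 => // e _ _; field.
Qed.

Lemma jetV g a b : a != 0 -> jet g a b -> jet (fun e => (g e)^-1) a^-1 (- (b / a ^+ 2)).
Proof.
move=> a0; have := @is_deriveV R id a 1 1 a0 (is_derive_id _ _).
by rewrite /GRing.scale /= mulr1 => h /(jet_chain h); rewrite mulNr mulrC.
Qed.

Lemma jet_prod (I : eqType) (s : seq I) (G : I -> R -> R) (B : I -> R) :
  (forall i, i \in s -> jet (G i) 1 (B i)) ->
  jet (fun e => \prod_(i <- s) G i e) 1 (\sum_(i <- s) B i).
Proof.
elim: s => [|i s IH] h.
  rewrite big_nil; apply: jet_near (jet_cst 1); exists 1 => // e _ _; by rewrite big_nil.
have h1 : jet (G i) 1 (B i) by apply: h; rewrite inE eqxx.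
have h2 : jet (fun e => \prod_(j <- s) G j e) 1 (\sum_(j <- s) B j).
  by apply: IH => j js; apply: h; rewrite inE js orbT.
have := jetM h1 h2; rewrite mulr1 mul1r big_cons addrC mulr1 => hh.
by apply: jet_near hh; exists 1 => // e _ _; rewrite big_cons.
Qed.

Lemma jet_uniq c b g : jet g 0 b -> jet (fun e => g e - c * e ^+ 2) 0 0 -> c = b.
Proof.
move=> hg hc; apply/eqP; rewrite eq_sym -subr_eq0; apply/eqP/normr0_eq0/eqP.
rewrite eq_le normr_ge0 andbT; apply/ler_addgt0Pl => eta eta0; rewrite addr0.
have e2 : 0 < eta / 2 by rewrite divr_gt0.
have [e e0 [h1 h2]] := near0_ex (near0_and (hg _ e2) (hc _ e2)).
have ee : 0 < e ^+ 2 by rewrite exprn_gt0.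
rewrite -(ler_pM2r ee) -[X in _ * X <= _](ger0_norm (ltW ee)) -normrM.
have -> : (b - c) * e ^+ 2 = (g e - c * e ^+ 2 - 0 - 0 * e ^+ 2) - (g e - 0 - b * e ^+ 2) by ring.
apply: le_trans (ler_normB _ _) _; have -> : eta * e ^+ 2 = eta / 2 * e ^+ 2 + eta / 2 * e ^+ 2 by field.
by rewrite lerD.
Qed.

(** The radicand is u^2 + 2 e^2, so the root is |u| + e^2 / |u| up to o(e^2); the sign of u turns
    this into u + e^2 / u. *)
Lemma jet_sqrt_shift u : u != 0 ->
  jet (fun e => sqrt_shiftR ((e * Num.sqrt 2) ^+ 2) u) u u^-1.
Proof.
move=> u0; have u2 : 0 < u ^+ 2 by rewrite exprn_even_gt0.
have := jetD (jet_cst (u ^+ 2)) (jet_scale 2 jet_sqr).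
rewrite mulr0 addr0 add0r mulr1 => /(jet_chain (is_derive1_sqrt u2)).
rewrite sqrtr_sqr => /(jet_scale (Num.sg u)).
rewrite -numEsg invfM mulrAC mulVf ?pnatr_eq0 // mul1r.
have -> : Num.sg u * `|u|^-1 = u^-1.
  move: u0; rewrite neq_lt => /orP[] us.
    by rewrite ltr0_sg // ltr0_norm // invrN mulN1r opprK.
  by rewrite gtr0_sg // gtr0_norm // mul1r.
apply: jet_near; exists 1 => // e e0 _.
by rewrite /sqrt_shiftR sqr_sqrt2.
Qed.
End Jets.

(** * The second-order coefficient in the height of one slit *)

Section WardLimit.
Variables (R : realType) (d : measure_display) (T : measurableType d)
  (P : probability T R) (gamma : R -> T -> cplx R) (alpha : R).
Local Notation Re := (@complex.Re R).
Local Notation Im := (@complex.Im R).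
Implicit Types (xs ys es : seq R) (x y e a b : R).

Hypothesis gm : forall t, 0 <= t ->
  measurable_fun setT (fun w => Re (gamma t w)) /\
  measurable_fun setT (fun w => Im (gamma t w)).
Hypothesis gc : forall w, {within `[0, +oo[, continuous (fun t => gamma t w)}.
Hypothesis restr : conformal_restriction P alpha gamma.

Local Notation pr := (pr P).
Local Notation hits := (hits gamma).
Variable corr : seq R -> R.
Hypothesis corr_lim : forall xs, conf xs -> forall eta, 0 < eta ->
  near_iter (size xs) (fun es =>
    `|pr (hits (slits xs es)) - corr xs * prodsq es| <= eta * prodsq es).

Local Notation sl x e := (Slit x (e * Num.sqrt 2)).

(** Hitting x and [xs] is hitting [xs] minus hitting [xs] while avoiding x. At fixed e, division by
    [prodsq es] as these heights tend to 0 replaces all three probabilities by correlation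
    functions, with error o(e^2). *)
Lemma ward_limit x xs : conf (x :: xs) ->
  (forall ys, conf ys -> (size ys < size xs)%N -> loclip corr ys) ->
  jet (fun e => corr xs - ed (sl x e) 0 `^ alpha * (wt [:: sl x e] xs *
                          corr (map (ef (sl x e)) xs)) - corr (x :: xs) * e ^+ 2) 0 0.
Proof.
move=> /[dup] cx /conf_cons[x0 xxs cxs] hl eta eta0.
have eta3 : 0 < eta / 3 by rewrite divr_gt0.
apply: near0_mono (corr_lim cx eta3) => e e0 c1.
have e2 : 0 < e ^+ 2 by rewrite exprn_gt0.
(* The two limits over [xs] alone need accuracy of order e^2 to match the error allowed for the
   limit over all points; this is possible since e is fixed first. *)
have ee : 0 < eta / 3 * e ^+ 2 by exact: mulr_gt0.
pose m := sl x e; have vm : evalid m by split; rewrite //= mulr_gt0 ?sqrt2_gt0.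
have okm : oks_all [:: m] xs.
  by move=> u us; split=> //; rewrite /eok /= subr_eq0; apply: contraNneq xxs => <-.
have a1 := pull_asymp_all gm gc restr corr_lim cxs hl (ms := [:: m]) (conj vm Logic.I) okm ee.
have := near_iter_and c1 (near_iter_and (corr_lim cxs ee) a1).
move=> h; apply: (@near_iter_const _ (size xs)); apply: near_iter_mono h => es hes [{}c1 [c2 {}a1]].
have hsl := relcloseds_slits cxs hes.
have rx : relclosed (slit x e) by exact: relclosed_slit.
move: c1; rewrite [slits _ _]/= (pr_hit_cons P gm gc rx hsl).
rewrite [slit x e]/(hull m) (restriction_hits1 gm gc restr vm hsl).
rewrite -[map (@pull R m) _]/(map (pulls [:: m]) (slits xs es)) -/m prodsq_cons.
rewrite -[map (ef m) xs]/(map (fs [:: m]) xs).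
move: c2 a1; have pes := prodsq_gt0 hes; have A1 := avoid_le1 gm gc restr vm.
have A0 : 0 <= ed m 0 `^ alpha by exact: powR_ge0.
move: (ed m 0 `^ alpha) A0 A1 => A A0 A1.
set p1 := pr _; set p2 := pr _; set w := wt _ _; set c' := corr (map _ _).
move=> c2 a1 c1; rewrite subr0 mul0r subr0.
rewrite -(ler_pM2r pes) -[X in _ * X <= _](ger0_norm (ltW pes)) -normrM.
have -> : (corr xs - A * (w * c') - corr (x :: xs) * e ^+ 2) * prodsq es =
  (p1 - A * p2 - corr (x :: xs) * (e ^+ 2 * prodsq es))
  - (p1 - corr xs * prodsq es) + A * (p2 - w * c' * prodsq es) by ring.
apply: le_trans (ler_normD _ _) _.
have -> : eta * e ^+ 2 * prodsq es = (eta / 3 * (e ^+ 2 * prodsq es)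
  + eta / 3 * e ^+ 2 * prodsq es) + eta / 3 * e ^+ 2 * prodsq es by field.
apply: lerD.
  by apply: le_trans (ler_normB _ _) _; rewrite lerD.
rewrite normrM (ger0_norm A0); apply: le_trans a1.
by rewrite ler_piMl.
Qed.

Lemma jet_d0_slit x u : u != 0 -> jet (fun e => d0 (sl x e) u) 1 (- u ^- 2).
Proof.
move=> u0; have := jet_scale u (jetV u0 (jet_sqrt_shift u0)).
rewrite mulfV //; have -> : u * - (u^-1 / u ^+ 2) = - u ^- 2 by field.
by apply: jet_near; exists 1.
Qed.

Lemma jet_avoid x : x != 0 ->
  jet (fun e => ed (sl x e) 0 `^ alpha) 1 (- (alpha / x ^+ 2)).
Proof.
move=> x0; have nx : 0 - x != 0 by rewrite sub0r oppr_eq0.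
have := jet_chain (is_derive1_powR alpha ltr01) (jet_d0_slit x nx).
rewrite !powR1 mulr1 sub0r sqrrN mulrN.
by apply: jet_near; exists 1 => // e _ _; rewrite /ed /= sub0r.
Qed.

(** Uniqueness of the e^2-coefficient. The contribution of the moving points is kept abstract as
    [b]; it becomes a sum of derivatives once the correlation of [xs] is known to be rational. *)
Theorem ward_identity x xs b : conf (x :: xs) ->
  (forall ys, conf ys -> (size ys < size xs)%N -> loclip corr ys) ->
  jet (fun e => corr (map (ef (sl x e)) xs)) (corr xs) b ->
  corr (x :: xs) = alpha / x ^+ 2 * corr xs
    + \sum_(y <- xs) 2 / (y - x) ^+ 2 * corr xs - b.
Proof.
move=> /[dup] cx /conf_cons[x0 xxs cxs] hl hb.
have hA := jet_avoid x0.
have hw : jet (fun e => wt [:: sl x e] xs) 1 (\sum_(y <- xs) - (2 / (y - x) ^+ 2)).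
  apply: (jet_prod (G := fun y e => (ds [:: sl x e] y) ^+ 2)) => y ys.
  have nyx : y - x != 0 by rewrite subr_eq0; apply: contraNneq xxs => <-.
  have := jet_sq (jet_d0_slit x nyx); rewrite expr1n mulr1 mulrN.
  by apply: jet_near; exists 1 => // e _ _ /=; rewrite mulr1.
have := jetD (jet_cst (corr xs)) (jetN (jetM hA (jetM hw hb))).
rewrite !mul1r subrr => hj; rewrite (jet_uniq hj (ward_limit cx hl)).
rewrite sumrN -mulr_suml; ring.
Qed.
End WardLimit.

(** * Stability of local Lipschitz continuity under field operations *)

Section LocalLipschitz.
Variable R : realType.
Implicit Types (G H : seq R -> R) (xs ys zs : seq R) (x y a delta eta : R).

Lemma loclip_cst a xs : loclip (fun _ => a) xs.
Proof. by exists 0, 1; split=> // ys zs eta _ _ _ _; rewrite subrr normr0 mul0r. Qed.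

Lemma close_nth delta xs ys i : 0 <= delta -> entry_close delta xs ys -> `|ys`_i - xs`_i| <= delta.
Proof.
move=> d0; elim: xs ys i => [|x xs IH] [|y ys] [|i] //=; rewrite ?subrr ?normr0 //.
- by move=> [].
- by move=> [_ /IH].
Qed.

Lemma close_size delta xs ys : entry_close delta xs ys -> size ys = size xs.
Proof. by elim: xs ys => [|x xs IH] [|y ys] //= [_ /IH ->]. Qed.

Lemma loclip_nth xs i : loclip (fun ys => ys`_i) xs.
Proof.
by exists 1, 1; split=> // ys zs eta _ _ eta0 h; rewrite mul1r; exact: close_nth.
Qed.

Lemma loclip_bounded G xs : loclip G xs -> exists M delta, [/\ 0 <= M, 0 < delta &
  forall ys, entry_close delta xs ys -> `|G ys| <= M].
Proof.
move=> [L [dl [L0 dl0 h]]]; exists (`|G xs| + L * dl), dl; split=> //.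
  by rewrite addr_ge0 // mulr_ge0 // ltW.
move=> ys hy; have := h xs ys dl (close_refl xs (ltW dl0)) hy (ltW dl0) hy.
by have := ler_normD (G ys - G xs) (G xs); rewrite subrK; lra.
Qed.

Lemma loclipD G H xs : loclip G xs -> loclip H xs -> loclip (fun ys => G ys + H ys) xs.
Proof.
move=> [L [dl [L0 dl0 h]]] [L' [dl' [L'0 dl'0 h']]].
exists (L + L'), (Num.min dl dl'); split; rewrite ?addr_ge0 ?lt_min ?dl0 //.
move=> ys zs eta hy hz eta0 hyz.
have m1 : Num.min dl dl' <= dl by rewrite ge_min lexx.
have m2 : Num.min dl dl' <= dl' by rewrite ge_min lexx orbT.
rewrite opprD addrACA mulrDl; apply: le_trans (ler_normD _ _) _.
by apply: lerD; [apply: h|apply: h'] => //; apply: close_le; eauto.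
Qed.

Lemma loclipM G H xs : loclip G xs -> loclip H xs -> loclip (fun ys => G ys * H ys) xs.
Proof.
move=> hG hH; have [M [d1 [M0 d10 b1]]] := loclip_bounded hG.
have [M' [d2 [M'0 d20 b2]]] := loclip_bounded hH.
have [L [dl [L0 dl0 h]]] := hG; have [L' [dl' [L'0 dl'0 h']]] := hH.
pose dm := Num.min (Num.min d1 d2) (Num.min dl dl').
have dm1 : dm <= d1 by rewrite !ge_min lexx.
have dm2 : dm <= d2 by rewrite !ge_min lexx orbT.
have dm3 : dm <= dl by rewrite !ge_min lexx !orbT.
have dm4 : dm <= dl' by rewrite !ge_min lexx !orbT.
exists (M * L' + M' * L), dm; split; first by rewrite addr_ge0 // mulr_ge0.
  by rewrite !lt_min d10 d20 dl0.
move=> ys zs eta hy hz eta0 hyz.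
have -> : G zs * H zs - G ys * H ys = G zs * (H zs - H ys) + H ys * (G zs - G ys) by ring.
apply: le_trans (ler_normD _ _) _; rewrite !normrM mulrDl -!mulrA.
apply: lerD; apply: ler_pM => //.
- by apply: b1; exact: close_le hz.
- by apply: h' => //; [exact: close_le hy|exact: close_le hz].
- by apply: b2; exact: close_le hy.
- by apply: h => //; [exact: close_le hy|exact: close_le hz].
Qed.

Lemma loclip_lower G xs : loclip G xs -> G xs != 0 -> exists c delta, [/\ 0 < c, 0 < delta &
  forall ys, entry_close delta xs ys -> c <= `|G ys|].
Proof.
move=> [L [dl [L0 dl0 h]]] g0; have n0 : 0 < `|G xs| by rewrite normr_gt0.
have L1 : 0 < L + 1 by rewrite ltr_wpDl.
pose dm := Num.min dl (`|G xs| / 2 / (L + 1)).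
have dm0 : 0 < dm by rewrite lt_min dl0 !divr_gt0.
have dm1 : dm <= dl by rewrite ge_min lexx.
exists (`|G xs| / 2), dm; split=> //; first by rewrite divr_gt0.
move=> ys hy.
have := h xs ys dm (close_refl xs (ltW dl0)) (close_le dm1 hy) (ltW dm0) hy.
have : L * dm <= `|G xs| / 2.
  apply: le_trans (_ : (L + 1) * dm <= _); first by rewrite ler_wpM2r ?lerDl // ltW.
  by rewrite mulrC -ler_pdivlMr // ge_min lexx orbT.
have := ler_normD (G ys) (- (G ys - G xs)); rewrite normrN opprB addrC subrK.
move: `|_ - _| => t; lra.
Qed.

Lemma loclipV G xs : loclip G xs -> G xs != 0 -> loclip (fun ys => (G ys)^-1) xs.
Proof.
move=> hG g0; have [c [d1 [c0 d10 hc]]] := loclip_lower hG g0.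
have [L [dl [L0 dl0 h]]] := hG.
pose dm := Num.min d1 dl.
have dm1 : dm <= d1 by rewrite ge_min lexx.
have dm2 : dm <= dl by rewrite ge_min lexx orbT.
exists (L / c ^+ 2), dm; split; first by rewrite divr_ge0 ?sqr_ge0.
  by rewrite lt_min d10.
move=> ys zs eta hy hz eta0 hyz.
have cy := hc _ (close_le dm1 hy); have cz := hc _ (close_le dm1 hz).
have gy : G ys != 0 by rewrite -normr_gt0; exact: lt_le_trans cy.
have gz : G zs != 0 by rewrite -normr_gt0; exact: lt_le_trans cz.
have -> : (G zs)^-1 - (G ys)^-1 = - (G zs - G ys) * (G zs * G ys)^-1.
  by field; rewrite gy gz.
rewrite normrM normrN mulrAC; apply: ler_pM => //.
  by apply: h => //; [exact: close_le hy|exact: close_le hz].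
rewrite normfV normrM lef_pV2 ?posrE ?exprn_gt0 ?mulr_gt0 ?normr_gt0 //.
by rewrite expr2 ler_pM // ltW.
Qed.

Lemma loclip_ext G H xs delta : 0 < delta -> (forall ys, entry_close delta xs ys -> G ys = H ys) ->
  loclip G xs -> loclip H xs.
Proof.
move=> d0 e [L [dl [L0 dl0 h]]]; exists L, (Num.min delta dl); split=> //.
  by rewrite lt_min d0.
have m1 : Num.min delta dl <= delta by rewrite ge_min lexx.
have m2 : Num.min delta dl <= dl by rewrite ge_min lexx orbT.
move=> ys zs eta hy hz; rewrite -(e _ (close_le m1 hy)) -(e _ (close_le m1 hz)).
by apply: h; [exact: close_le hy|exact: close_le hz].
Qed.

Lemma close_mem delta xs ys y : entry_close delta xs ys -> y \in ys ->
  exists2 x, x \in xs & `|y - x| <= delta.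
Proof.
elim: xs ys => [|x xs IH] [|z ys] //= [h1 h2]; rewrite inE => /orP[/eqP->|/(IH _ h2)[u us hu]].
  by exists x; rewrite // inE eqxx.
by exists u; rewrite // inE us orbT.
Qed.

Lemma conf_near xs : conf xs -> exists2 delta, 0 < delta & forall ys, entry_close delta xs ys -> conf ys.
Proof.
elim: xs => [|x xs IH] h; first by exists 1 => // -[|y ys] // _; split.
have [x0 xxs /IH[dl dl0 hdl]] := conf_cons h.
have [rho rho0 hrho] := separation xxs.
have n0 : 0 < `|x| by rewrite normr_gt0.
pose dm := Num.min dl (Num.min (rho / 4) (`|x| / 2)).
have dm1 : dm <= dl by rewrite ge_min lexx.
have dm2 : dm <= rho / 4 by rewrite !ge_min lexx orbT.
have dm3 : dm <= `|x| / 2 by rewrite !ge_min lexx !orbT.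
exists dm; first by rewrite !lt_min dl0 !divr_gt0.
move=> [//|y ys] [h1 h2]; have [uy zy] := hdl _ (close_le dm1 h2).
split; last first.
  rewrite inE negb_or zy andbT; apply: contraTneq h1 => <-; rewrite sub0r normrN -ltNge.
  by apply: le_lt_trans dm3 _; rewrite ltr_pdivrMr // ltr_pMr // ltr1n.
rewrite /= uy andbT; apply/negP => yys; have [u us hu] := close_mem h2 yys.
have := hrho u us; have := ler_normD (u - y) (y - x); rewrite addrA subrK [X in _ <= X + _]distrC; lra.
Qed.
End LocalLipschitz.

(** * Evaluation of rational functions and of their derivatives along jets *)

Section Values.
Variable R : realType.

Definition pt n (xs : seq R) : 'I_n -> R := fun i => xs`_i.

Lemma rf_value_poly n (p : mpoly n R) x : rf_value (rf_poly p) x (meval x p).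
Proof. by exists p, 1; rewrite rf_poly1 divr1 meval1 divr1; split=> //; exact: oner_neq0. Qed.

Lemma meval_neq0 n (q : mpoly n R) x : meval x q != 0 -> q != 0.
Proof. by apply: contraNneq => ->; rewrite meval0. Qed.

Lemma rf_value_uniq n (f : ratfun R n) p q x v : f = rf_poly p / rf_poly q ->
  meval x q != 0 -> rf_value f x v -> v = meval x p / meval x q.
Proof.
move=> -> q0 [p' [q' [e q'0 ->]]].
move/(rf_div_eq _ _ (meval_neq0 q0) (meval_neq0 q'0)): e => /(congr1 (meval x)).
rewrite !mevalM => e; apply/eqP; rewrite eqr_div //; apply/eqP.
by rewrite e.
Qed.

Lemma rf_valueD n (f g : ratfun R n) x v w : rf_value f x v -> rf_value g x w ->
  rf_value (f + g) x (v + w).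
Proof.
move=> [p [q [-> q0 ->]]] [p' [q' [-> q'0 ->]]]; exists (p * q' + p' * q), (q * q').
rewrite !addf_div ?rf_poly_eq0 ?(meval_neq0 (x := x)) //.
by rewrite mevalM mevalD !mevalM mulf_neq0 //; rewrite rf_polyD !rf_polyM.
Qed.

Lemma rf_valueM n (f g : ratfun R n) x v w : rf_value f x v -> rf_value g x w ->
  rf_value (f * g) x (v * w).
Proof.
move=> [p [q [-> q0 ->]]] [p' [q' [-> q'0 ->]]]; exists (p * p'), (q * q').
by rewrite !mulf_div !mevalM mulf_neq0 // !rf_polyM.
Qed.

Lemma rf_valueV n (f : ratfun R n) x v : rf_value f x v -> v != 0 -> rf_value f^-1 x v^-1.
Proof.
move=> [p [q [-> q0 ->]]]; rewrite mulf_eq0 negb_or => /andP[p0 _].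
by exists q, p; rewrite !invf_div.
Qed.

Lemma rf_value_const n a (x : 'I_n -> R) : rf_value (rf_const n a) x a.
Proof. by rewrite -{2}(mevalC x a); exact: rf_value_poly. Qed.

Lemma rf_value_var n (j : 'I_n) (x : 'I_n -> R) : rf_value (rf_var R j) x (x j).
Proof. by rewrite -(mevalXU x j); exact: rf_value_poly. Qed.

Lemma rf_value_nat n k (x : 'I_n -> R) : rf_value k%:R x k%:R.
Proof.
have -> : k%:R = rf_const n (k%:R : R).
  by rewrite /rf_const /rf_poly mpolyC_nat rmorph_nat.
exact: rf_value_const.
Qed.

Lemma rf_valueN n (f : ratfun R n) x v : rf_value f x v -> rf_value (- f) x (- v).
Proof.
move=> [p [q [-> q0 ->]]]; exists (- p), q.
by rewrite mevalN rf_polyN !mulNr.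
Qed.

Lemma rf_value_sum n m (F : 'I_m -> ratfun R n) x (v : 'I_m -> R) :
  (forall j, rf_value (F j) x (v j)) -> rf_value (\sum_(j < m) F j) x (\sum_(j < m) v j).
Proof.
move=> h; elim/big_ind2: _ => // [|f w g u h1 h2]; last exact: rf_valueD.
exact: (rf_value_nat 0).
Qed.

Lemma meval_shift n x0 (xs : seq R) (p : mpoly n R) :
  meval (pt (x0 :: xs)) (mpoly_shift p) = meval (pt xs) p.
Proof.
elim/mpoly_ring_ind: p => [c|j|p q ep eq|p q ep eq].
- by rewrite mpoly_shiftC !mevalC.
- by rewrite mpoly_shiftX !mevalXU /pt lift0.
- by rewrite mpoly_shiftD !mevalD ep eq.
- by rewrite mpoly_shiftM !mevalM ep eq.
Qed.

Lemma rf_value_shift n x0 (xs : seq R) (f : ratfun R n) v : rf_value f (pt xs) v ->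
  rf_value (rf_shift f) (pt (x0 :: xs)) v.
Proof.
move=> [p [q [-> q0 ->]]]; exists (mpoly_shift p), (mpoly_shift q).
by rewrite !meval_shift rf_shift_div ?(meval_neq0 q0).
Qed.

Lemma rf_value_deriv n j (p q : mpoly n R) x : meval x q != 0 ->
  rf_value (rf_deriv j (rf_poly p / rf_poly q)) x
    ((meval x (mderiv j p) * meval x q - meval x p * meval x (mderiv j q)) / meval x q ^+ 2).
Proof.
move=> q0; exists (mderiv j p * q - p * mderiv j q), (q ^+ 2).
rewrite rf_deriv_div ?(meval_neq0 q0) // rf_polyXn.
have -> : meval x (q ^+ 2) = meval x q ^+ 2 by rewrite !expr2 mevalM.
by rewrite expf_neq0 // mevalB !mevalM.
Qed.

Lemma jet_meval n (p : mpoly n R) (y : 'I_n -> R -> R) (x v : 'I_n -> R) :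
  (forall j, jet (y j) (x j) (v j)) ->
  jet (fun e => meval (fun j => y j e) p) (meval x p)
    (\sum_(j < n) v j * meval x (mderiv j p)).
Proof.
move=> hy; elim/mpoly_ring_ind: p => [c|i|p q hp hq|p q hp hq].
- rewrite mevalC big1; last by move=> j _; rewrite mderivC meval0 mulr0.
  by apply: jet_near (jet_cst c); exists 1 => // e _ _; rewrite mevalC.
- have -> : \sum_(j < n) v j * meval x (mderiv j (mpolyX R (mnm1 i))) = v i.
    have dE j : mderiv j (mpolyX R (mnm1 i)) = (j == i)%:R.
      apply: rf_poly_inj; rewrite -rf_deriv_poly rf_deriv_var.
      by case: eqP => _; rewrite ?rf_poly1 ?rf_poly0.
    rewrite (bigD1 i) //= big1 => [|j ji]; rewrite dE.
      by rewrite eqxx meval1 mulr1 addr0.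
    by rewrite (negbTE ji) meval0 mulr0.
  by rewrite mevalXU; apply: jet_near (hy i); exists 1 => // e _ _; rewrite mevalXU.
- rewrite mevalD; have := jetD hp hq; rewrite -big_split /=.
  under eq_bigr do rewrite -mulrDr -mevalD -mderivD.
  by apply: jet_near; exists 1 => // e _ _; rewrite mevalD.
rewrite mevalM; have := jetM hp hq.
have -> : meval x p * \sum_(j < n) v j * meval x (mderiv j q)
   + (\sum_(j < n) v j * meval x (mderiv j p)) * meval x q
  = \sum_(j < n) v j * meval x (mderiv j (p * q)).
  rewrite mulr_sumr mulr_suml -big_split /=; apply: eq_bigr => j _.
  by rewrite mderivM mevalD !mevalM; ring.
by apply: jet_near; exists 1 => // e _ _; rewrite mevalM.
Qed.

Lemma loclip_meval n (p : mpoly n R) xs : loclip (fun ys => meval (pt ys) p) xs.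
Proof.
elim/mpoly_ring_ind: p => [c|i|p q hp hq|p q hp hq].
- by apply: loclip_ext (loclip_cst c xs) => [|ys _]; [exact: ltr01|rewrite mevalC].
- by apply: loclip_ext (loclip_nth xs i) => [|ys _]; [exact: ltr01|rewrite mevalXU].
- by apply: loclip_ext (loclipD hp hq) => [|ys _]; [exact: ltr01|rewrite mevalD].
- by apply: loclip_ext (loclipM hp hq) => [|ys _]; [exact: ltr01|rewrite mevalM].
Qed.

(** [rf_value] allows the fraction to vary with the point. The fraction valid at [xs] has a
    denominator that stays nonzero nearby, and it therefore computes [corr] there. *)
Lemma loclip_rational n (f : ratfun R n) (corr : seq R -> R) xs :
  (forall ys, conf ys -> size ys = n -> rf_value f (pt ys) (corr ys)) ->
  conf xs -> size xs = n -> loclip corr xs.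
Proof.
move=> hf cxs sx; have [p [q [fE q0 _]]] := hf xs cxs sx.
have [dl dl0 hdl] := conf_near cxs.
have [c [d1 [c0 d10 hc]]] := loclip_lower (loclip_meval q xs) q0.
have hpq := loclipM (loclip_meval p xs) (loclipV (loclip_meval q xs) q0).
apply: (@loclip_ext _ _ _ _ (Num.min dl d1) _ _ hpq) => [|ys hy].
  by rewrite lt_min dl0.
have m1 : Num.min dl d1 <= dl by rewrite ge_min lexx.
have m2 : Num.min dl d1 <= d1 by rewrite ge_min lexx orbT.
have cy := hdl _ (close_le m1 hy).
have qy : meval (pt ys) q != 0.
  by rewrite -normr_gt0; apply: lt_le_trans (hc _ (close_le m2 hy)).
by rewrite (rf_value_uniq fE qy (hf ys cy _)) // (close_size hy).
Qed.
End Values.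

Section WardValue.
Variables (R : realType) (d : measure_display) (T : measurableType d)
  (P : probability T R) (gamma : R -> T -> cplx R) (alpha : R).
Local Notation Re := (@complex.Re R).
Local Notation Im := (@complex.Im R).
Implicit Types (xs ys es : seq R) (x y e a b : R).

Hypothesis gm : forall t, 0 <= t ->
  measurable_fun setT (fun w => Re (gamma t w)) /\
  measurable_fun setT (fun w => Im (gamma t w)).
Hypothesis gc : forall w, {within `[0, +oo[, continuous (fun t => gamma t w)}.
Hypothesis restr : conformal_restriction P alpha gamma.

Variable corr : seq R -> R.
Hypothesis corr_lim : forall xs, conf xs -> forall eta, 0 < eta ->
  near_iter (size xs) (fun es =>
    `|pr P (hits gamma (slits xs es)) - corr xs * prodsq es| <= eta * prodsq es).

(** Induction step for rationality: if [f] has the n-point correlations as values, then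
    [ward alpha f] has the (n + 1)-point ones. *)
Lemma ward_value n (f : ratfun R n) x xs :
  (forall ys, conf ys -> size ys = n -> rf_value f (pt ys) (corr ys)) ->
  conf (x :: xs) -> size xs = n ->
  (forall ys, conf ys -> (size ys < n)%N -> loclip corr ys) ->
  rf_value (ward alpha f) (pt (x :: xs)) (corr (x :: xs)).
Proof.
move=> hf /[dup] cx /conf_cons[x0 xxs cxs] sx hl.
have [p [q [fE q0 cE]]] := hf xs cxs sx.
have nyx (j : 'I_n) : xs`_j - x != 0.
  rewrite subr_eq0; apply: contraNneq xxs => <-.
  by apply: mem_nth; rewrite sx.
pose sl e := Slit x (e * Num.sqrt 2).
pose y (j : 'I_n) e := ef (sl e) xs`_j.
(* The e^2-coefficient of the displacement of x_j when the slit at x is removed; the summand 1/x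
   comes from the translation that keeps 0 fixed. *)
pose v (j : 'I_n) := (xs`_j - x)^-1 + x^-1.
have jy j : jet (y j) (pt xs j) (v j).
  have nx : - x != 0 by rewrite oppr_eq0.
  have := jetD (jet_sqrt_shift (nyx j)) (jetN (jet_sqrt_shift nx)).
  by rewrite opprK subrK invrN opprK.
pose D (j : 'I_n) := (meval (pt xs) (mderiv j p) * meval (pt xs) q
  - meval (pt xs) p * meval (pt xs) (mderiv j q)) / meval (pt xs) q ^+ 2.
have hD j : rf_value (rf_deriv j f) (pt xs) (D j) by rewrite fE; exact: rf_value_deriv.
have jpq : jet (fun e => corr (map (ef (sl e)) xs)) (corr xs) (\sum_(j < n) v j * D j).
  have jq := jet_meval q jy.
  have := jetM (jet_meval p jy) (jetV q0 jq); rewrite -cE.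
  have -> : meval (pt xs) p *
      - ((\sum_(j < n) v j * meval (pt xs) (mderiv j q)) / meval (pt xs) q ^+ 2)
     + (\sum_(j < n) v j * meval (pt xs) (mderiv j p)) * (meval (pt xs) q)^-1
     = \sum_(j < n) v j * D j.
    rewrite /D; move: (meval (pt xs) p) (meval (pt xs) q) q0 => A B B0.
    rewrite mulrN !mulr_suml mulr_sumr -sumrN -big_split /=; apply: eq_bigr => j _.
    by field.
  (* For small e the displaced points remain where the denominator q is nonzero, so the fraction
     chosen at [xs] still gives the correlations. *)
  apply: jet_near; apply: near0_mono (jet_neq0 jq q0) => e e0 qe.
  have vm : evalid (sl e) by split; rewrite //= mulr_gt0 ?sqrt2_gt0.
  have okm : oks_all [:: sl e] xs.
    by move=> u us; split=> //; rewrite /eok /= subr_eq0; apply: contraNneq xxs => <-.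
  have := hf _ (conf_map_fs (ms := [:: sl e]) (conj vm Logic.I) okm cxs).
  rewrite size_map => /(_ sx) /(rf_value_uniq fE).
  have -> : pt (map (fs [:: sl e]) xs) = (fun j : 'I_n => y j e).
    by apply/funext => j; rewrite /pt (nth_map 0) // sx.
  by move=> /(_ qe).
rewrite (ward_identity gm gc restr corr_lim cx _ jpq); last by rewrite sx.
pose X : ratfun R n.+1 := rf_var R ord0.
have vX : rf_value X (pt (x :: xs)) x by exact: (rf_value_var ord0 (pt (x :: xs))).
have hc := hf xs cxs sx.
have h1 : rf_value (X ^ (- 2) * rf_shift (rf_const n alpha * f)) (pt (x :: xs))
    ((x * x)^-1 * (alpha * corr xs)).
  apply: rf_valueM; last first.
    by apply: rf_value_shift; apply: rf_valueM hc; exact: rf_value_const.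
  by apply: rf_valueV (rf_valueM vX vX) _; rewrite mulf_neq0.
have h2 (j : 'I_n) : rf_value ((rf_shift (rf_var R j) - X)^-1) (pt (x :: xs)) (xs`_j - x)^-1.
  apply: rf_valueV (nyx j); apply: rf_valueD (rf_valueN vX).
  by apply: rf_value_shift; exact: (rf_value_var j (pt xs)).
have h3 (j : 'I_n) := rf_valueM (rf_value_shift x (rf_valueM (rf_value_nat 2 (pt xs)) hc))
  (rf_valueM (h2 j) (h2 j)).
have h4 (j : 'I_n) : rf_value (- (rf_shift (rf_deriv j f) *
    ((rf_shift (rf_var R j) - X)^-1 + X ^ (-1) * rf_shift 1))) (pt (x :: xs))
    (- (D j * ((xs`_j - x)^-1 + x^-1 * 1))).
  apply: rf_valueN; apply: rf_valueM; first exact: rf_value_shift.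
  apply: rf_valueD => //; apply: rf_valueM; first exact: rf_valueV.
  by apply: rf_value_shift; exact: (rf_value_nat 1).
have := rf_valueD h1 (rf_value_sum (fun j => rf_valueD (h4 j) (h3 j))).
have -> : (x * x)^-1 * (alpha * corr xs) + \sum_(j < n) (- (D j * ((xs`_j - x)^-1 + x^-1 * 1))
    + 2 * corr xs * ((xs`_j - x)^-1 * (xs`_j - x)^-1))
  = alpha / x ^+ 2 * corr xs + \sum_(y <- xs) 2 / (y - x) ^+ 2 * corr xs - \sum_(j < n) v j * D j.
  rewrite (big_nth 0) sx big_mkord -addrA; congr (_ + _); first by field.
  rewrite -sumrN -big_split /=; apply: eq_bigr => j _; rewrite /v addrC.
  by have := nyx j; move: (xs`_j) => u hu; field; rewrite hu x0.
by congr rf_value; rewrite /ward -/X; congr (_ + _); apply: eq_bigr => j _.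
Qed.
End WardValue.

(** * Correlation functions *)

Section HittingLimits.
Variables (R : realType) (d : measure_display) (T : measurableType d)
  (P : probability T R) (gamma : R -> T -> cplx R) (kappa alpha : R).
Local Notation C := (cplx R).
Local Notation Re := (@complex.Re R).
Local Notation Im := (@complex.Im R).
Implicit Types (xs ys es : seq R) (x y e a b : R).

Hypothesis gm : forall t, 0 <= t ->
  measurable_fun setT (fun w => Re (gamma t w)) /\
  measurable_fun setT (fun w => Im (gamma t w)).
Hypothesis gc : forall w, {within `[0, +oo[, continuous (fun t => gamma t w)}.
Hypothesis g0 : forall w, gamma 0 w = 0.
Hypothesis restr : conformal_restriction P alpha gamma.
Hypothesis alpha0 : 0 < alpha.

Local Notation pr := (pr P).
Local Notation hit := (hit gamma).
Local Notation hits := (hits gamma).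
Local Notation trace w := [set gamma t w | t in `[0, +oo[].

Lemma hits_slits xs es w : size es = size xs ->
  hits (slits xs es) w <-> forall i, (i < size xs)%N -> hit (slit xs`_i es`_i) w.
Proof.
elim: xs es => [|x xs IH] [|e es] //= [se]; split.
  by move=> [h1 /(IH _ se) h2] [|i] //= hi; exact: h2.
by move=> h; split; [exact: (h 0%N)|apply/(IH _ se) => i hi; exact: (h i.+1)].
Qed.

Lemma trace_segment x e w : x != 0 ->
  (trace w `&` vertical_segment x e !=set0) <-> hit (vertical_segment x e) w.
Proof.
move=> x0; split.
  move=> [z [[t /= + <-] hz]]; rewrite in_itv /= andbT le_eqVlt => /orP[/eqP t0|t0]; last by exists t.
  by case: hz => + _; rewrite -t0 g0 /= => xx; rewrite -xx eqxx in x0.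
by move=> [t t0 hz]; exists (gamma t w); split=> //; exists t; rewrite //= in_itv /= ltW.
Qed.

Lemma closed_segment x e : closed (vertical_segment x e : set C).
Proof.
apply/closed_cplxP => z hz.
have [rz|rz] := eqVneq (Re z) x; last first.
  exists `|Re z - x|; first by rewrite normr_gt0 subr_eq0.
  move=> u uz [ru _]; have := le_lt_trans (Re_le_cabs _) uz.
  by rewrite cReD cReN ru distrC ltxx.
have [iz|iz] := ltP (Im z) 0.
  exists (- Im z); first by rewrite oppr_gt0.
  move=> u uz [_ /andP[iu _]]; have := le_lt_trans (Im_le_cabs _) uz.
  by rewrite cImD cImN ltr_norml => /andP[_]; lra.
have [jz|jz] := leP (Im z) (e * Num.sqrt 2); first by case: hz; split=> //; rewrite iz.
exists (Im z - e * Num.sqrt 2); first by rewrite subr_gt0.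
move=> u uz [_ /andP[_ iu]]; have := le_lt_trans (Im_le_cabs _) uz.
by rewrite cImD cImN ltr_norml => /andP[]; lra.
Qed.

Lemma hit_segment x e w : stays gamma w -> hit (vertical_segment x e) w <-> hit (slit x e) w.
Proof.
move=> hw; split=> -[t t0]; last first.
  by move=> /slitP[h1 /andP[h2 h3]]; exists t => //; split=> //; rewrite ltW.
move=> [h1 /andP[_ h2]]; exists t => //; apply/slitP; split=> //; rewrite h2 andbT.
by apply: (hw (gamma t w)); exists t; rewrite //= in_itv /= t0.
Qed.

(** The definition uses the full trace and closed segments with their feet, the estimates use
    positive times and slits without feet. The start 0 lies on no segment, and almost surely the
    curve is in the half-plane at positive times. *)
Lemma pr_segments xs es : conf xs -> posn (size xs) es ->
  fine (P (\bigcap_(j in [set: 'I_(size xs)])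
    [set w | trace w `&` vertical_segment (xs`_j) (es`_j) !=set0]))
  = pr (hits (slits xs es)).
Proof.
move=> cxs hes.
have xn0 (j : 'I_(size xs)) : xs`_j != 0.
  by have [_] := cxs; apply: contraNneq => <-; exact: mem_nth.
rewrite -/(pr _); set E := \bigcap_(j in _) _.
have mE : measurable E.
  apply: fin_bigcap_measurable; first exact: finite_finset.
  move=> j _; have -> : [set w | trace w `&` vertical_segment (xs`_j) (es`_j) !=set0]
      = hit (vertical_segment xs`_j es`_j).
    by apply/seteqP; split => w /(trace_segment _ _ (xn0 j)).
  by apply: measurable_hit_closed => //; exact: closed_segment.
have mH : measurable (hits (slits xs es)).
  by apply: (measurable_hits gm gc); exact: relcloseds_slits.
rewrite -(stays_pr gm gc restr mE) -(stays_pr gm gc restr mH); congr (pr _).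
apply/seteqP; split => w [h1 h2]; split=> //.
  apply/(hits_slits _ hes.1) => i hi; apply/(hit_segment _ _ h2)/trace_segment.
    exact: (xn0 (Ordinal hi)).
  exact: (h1 (Ordinal hi)).
move=> j _; apply/(trace_segment _ _ (xn0 j))/(hit_segment _ _ h2).
exact: (hits_slits _ hes.1).1.
Qed.

Definition corr xs : R := correlation P kappa gamma (pt xs : 'I_(size xs) -> R).
Let s : R := 8 / kappa - 1.

Hypothesis limits : forall n (x : 'I_n -> R), configuration x ->
  cvg (rescaled_hitting_prob P kappa gamma x e @[e --> @positive_to0 R n]).

Lemma conf_configuration xs : conf xs -> configuration (pt xs : 'I_(size xs) -> R).
Proof.
move=> [ux x0]; split.
  by move=> i j /eqP; rewrite nth_uniq // => /eqP/val_inj.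
by move=> j; apply: contraNneq x0 => <-; exact: mem_nth.
Qed.

Lemma rescaled_limit xs : conf xs -> forall eta, 0 < eta -> exists2 r : R, 0 < r &
  forall es, posn (size xs) es -> (forall e, e \in es -> e < r) ->
  `|\prod_(e <- es) e `^ (- s) * pr (hits (slits xs es)) - corr xs| <= eta.
Proof.
case: xs => [|x xs] cxs eta eta0.
  exists 1 => // -[_ _|e es [//]]; rewrite /corr big_nil mul1r /= (pr_setT P) subrr normr0.
  exact: ltW.
have := limits (conf_configuration cxs); set n := size (x :: xs).
set F := rescaled_hitting_prob _ _ _ _ => hF.
have : (F @ @positive_to0 R n) (ball (corr (x :: xs)) eta).
  by apply: hF; exact: nbhsx_ballx.
rewrite /positive_to0 /= => /nbhs_ballP[r r0 hr]; exists r => // es hes esr.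
pose e : 'rV[R]_n := \row_j es`_j.
have es_in (j : 'I_n) : es`_j \in es by apply: mem_nth; rewrite hes.1.
have := hr e; rewrite /= => h.
have : ball (corr (x :: xs)) eta (F e).
  apply: h.
    split=> // i j; rewrite /ball /= !mxE sub0r normrN gtr0_norm; first exact: esr.
    exact: hes.2.
  by move=> j; rewrite mxE; exact: hes.2.
rewrite /ball /= distrC => /ltW; congr (`| _ - _ | <= _).
rewrite /F /rescaled_hitting_prob; congr (_ * _).
  rewrite [RHS](big_nth 0) hes.1 big_mkord; apply: eq_bigr => j _; by rewrite mxE.
rewrite -(pr_segments cxs hes); congr (fine (P _)).
by apply: eq_bigcapr => j _; rewrite mxE.
Qed.

Lemma near_iter_lt n r (A : seq R -> Prop) : 0 < r ->
  (forall es, posn n es -> (forall e, e \in es -> e < r) -> A es) -> near_iter n A.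
Proof.
move=> r0; elim: n A => [|n IH] A h /=; first by apply: h.
exists r => // e e0 er; apply: IH => es [se hes] hr; apply: h.
  by split=> [|e']; rewrite /= ?se // inE => /orP[/eqP->|/hes].
by move=> e'; rewrite inE => /orP[/eqP->|/hr].
Qed.

Lemma near0_powR_lt a b : 0 < a -> 0 < b -> near0 (fun e => e `^ a < b).
Proof.
move=> a0 b0; exists (b `^ a^-1); first by rewrite powR_gt0.
move=> e e0 he; have -> : b = (b `^ a^-1) `^ a by rewrite -powRrM mulVf ?gt_eqF // powRr1 // ltW.
by apply: gt0_ltr_powR; rewrite ?nnegrE ?powR_ge0 // ltW.
Qed.

Lemma powR_mul_sqr e a : 0 < e -> e `^ a * e ^+ 2 = e `^ (2 + a).
Proof.
by move=> e0; rewrite -(powR_mulrn 2 (ltW e0)) -powRD ?(gt_eqF e0) ?implybT // addrC.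
Qed.

(** One minus the avoidance probability, which restriction gives exactly. The coefficient alpha /
    x^2 is positive, and this fixes the exponent 2. *)
Lemma jet_hit x : x != 0 -> jet (fun e => pr (hit (slit x e))) 0 (alpha / x ^+ 2).
Proof.
move=> x0; have := jetD (jet_cst 1) (jetN (jet_avoid alpha x0)).
rewrite subrr add0r opprK; apply: jet_near; exists 1 => // e e0 _.
have vm : evalid (Slit x (e * Num.sqrt 2)) by split; rewrite //= mulr_gt0 ?sqrt2_gt0.
have := pr_setD P measurableT (measurable_hit gm gc (relclosed_hull vm)).
rewrite !setTI pr_setT => h1; apply/eqP; rewrite -(pr_misses_hull gm gc restr vm) subr_eq.
exact/eqP.
Qed.

(** If s > 2, then e^(-s) times the probability of hitting the slit at 1 is at least (alpha / 2)
    e^(2 - s), which is unbounded and contradicts the existence of the one-point limit. *)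
Lemma exponent_le2 : s <= 2.
Proof.
rewrite leNgt; apply/negP => s2.
have c1 : conf [:: 1 : R] by split; rewrite //= inE eq_sym oner_neq0.
have [r r0 hr] := rescaled_limit c1 ltr01.
have a2 : 0 < alpha / 2 by rewrite divr_gt0.
have M0 : 0 < `|corr [:: 1]| + 1 by rewrite ltr_wpDl.
have n1 := jet_hit (oner_neq0 R) a2.
have n2 := near0_powR_lt (_ : 0 < s - 2) (divr_gt0 a2 M0); rewrite subr_gt0 in n2.
have [e e0 [[h1 h2] h3]] := near0_ex (near0_and (near0_and n1 (n2 s2)) (near0_lt r0)).
have p1 : posn (size [:: 1 : R]) [:: e] by split=> // e'; rewrite inE => /eqP->.
have := hr [:: e] p1 _; rewrite big_seq1 /= setIT => h.
have {}h : `|e `^ (- s) * pr (hit (slit 1 e)) - corr [:: 1]| <= 1.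
  by apply: h => e'; rewrite inE => /eqP->.
have {h} := le_trans (ler_norm _) h; rewrite lerBlDr => h.
have u0 : 0 < e `^ (s - 2) by rewrite powR_gt0.
have e2 : 0 < e ^+ 2 by rewrite exprn_gt0.
have esE : e `^ (- s) * e ^+ 2 = (e `^ (s - 2))^-1.
  by rewrite powR_mul_sqr // -powRN; congr powR; ring.
have q1 : alpha / 2 * e ^+ 2 <= pr (hit (slit 1 e)).
  move: h1; rewrite subr0 expr1n divr1 ler_norml => /andP[h1 _]; lra.
have := ler_wpM2l (powR_ge0 e (- s)) q1; rewrite mulrCA esE => h'.
have := le_trans h' h; rewrite leNgt => /negP; apply.
rewrite ltr_pdivlMr //; move: h2; rewrite ltr_pdivlMr // mulrC => h2.
by apply: le_lt_trans h2; rewrite addrC ler_wpM2r ?lerD2r ?ler_norm // ltW.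
Qed.

(** The joint event is contained in hitting the first slit, of probability O(e^2). Letting that
    height alone become small leaves a bound O(e^(2 - s)), which tends to 0. *)
Lemma corr_eq0 xs : s < 2 -> conf xs -> (0 < size xs)%N -> corr xs = 0.
Proof.
case: xs => // x xs s2 /[dup] cx /conf_cons[x0 _ cxs] _.
apply/normr0_eq0/eqP; rewrite eq_le normr_ge0 andbT; apply/ler_addgt0Pl => eta eta0.
rewrite addr0; have e2 : 0 < eta / 2 by rewrite divr_gt0.
have [r r0 hr] := rescaled_limit cx e2.
have rho0 : 0 < r / 2 by rewrite divr_gt0.
(* The other heights stay at r / 2, within the range where the joint limit is already attained up to
   eta / 2. *)
pose ts := nseq (size xs) (r / 2).
have tsE t : t \in ts -> t = r / 2 by rewrite mem_nseq => /andP[_ /eqP].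
pose K := \prod_(t <- ts) t `^ (- s).
have K0 : 0 <= K by apply: prodr_ge0 => t _; exact: powR_ge0.
pose c := `|alpha / x ^+ 2| + 1; have c0 : 0 < c by rewrite ltr_wpDl.
have b0 : 0 < eta / 2 / (K * c + 1) by rewrite divr_gt0 // ltr_wpDl // mulr_ge0 // ltW.
have s0 : 0 < 2 - s by rewrite subr_gt0.
have [e e0 [[h1 h2] h3]] := near0_ex (near0_and (near0_and (jet_lip (jet_hit x0))
  (near0_powR_lt s0 b0)) (near0_lt r0)).
have pes : posn (size (x :: xs)) (e :: ts).
  split; first by rewrite /= size_nseq.
  by move=> t; rewrite inE => /orP[/eqP->|/tsE->].
have pts : posn (size xs) ts by split; [exact: size_nseq|move=> t /tsE->].
have h := hr _ pes _; have {}h : `|\prod_(t <- e :: ts) t `^ (- s) *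
    pr (hits (slits (x :: xs) (e :: ts))) - corr (x :: xs)| <= eta / 2.
  apply: h => t; rewrite inE => /orP[/eqP->//|/tsE->].
  by rewrite ltr_pdivrMr // ltr_pMr // ltr1n.
rewrite big_cons -/K in h; set q := pr _ in h.
have q0 : 0 <= q by exact: pr_ge0.
have rx := relclosed_slit x0 e0.
have hsl := relcloseds_slits cxs pts.
have q1 : q <= c * e ^+ 2.
  apply: le_trans (_ : pr (hit (slit x e)) <= _).
    by apply: pr_le; [exact: (measurable_hits gm gc)|exact: (measurable_hit gm gc)|move=> w []].
  by move: h1; rewrite subr0 => /(le_trans (ler_norm _)).
have q2 : e `^ (- s) * K * q <= eta / 2.
  apply: le_trans (_ : e `^ (- s) * K * (c * e ^+ 2) <= _).
    by rewrite ler_wpM2l // mulr_ge0 // powR_ge0.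
  have -> : e `^ (- s) * K * (c * e ^+ 2) = K * c * (e `^ (2 - s)).
    by rewrite -powR_mul_sqr //; ring.
  have Kc : 0 <= K * c by rewrite mulr_ge0 // ltW.
  apply: le_trans (_ : (K * c + 1) * e `^ (2 - s) <= _).
    by rewrite ler_wpM2r ?powR_ge0 // lerDl.
  by move: h2; rewrite ltr_pdivlMr ?ltr_wpDl // mulrC => /ltW.
have q3 : 0 <= e `^ (- s) * K * q by rewrite !mulr_ge0 // powR_ge0.
move: (e `^ (- s) * K * q) (corr _) h q2 q3 => t u h q2 q3.
have := ler_normB t (t - u); rewrite subKr (ger0_norm q3) => h'.
by apply: le_trans h' _; rewrite (splitr eta); exact: lerD.
Qed.

(** For s = 2 the rescaling is division by [prodsq es], and a joint limit is in particular an
    iterated one. *)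
Lemma corr_lim : s = 2 -> forall xs, conf xs -> forall eta, 0 < eta ->
  near_iter (size xs) (fun es =>
    `|pr (hits (slits xs es)) - corr xs * prodsq es| <= eta * prodsq es).
Proof.
move=> s2 xs cxs eta eta0; have [r r0 hr] := rescaled_limit cxs eta0.
apply: (near_iter_lt r0) => es hes /(hr es hes).
have pes := prodsq_gt0 hes.
have -> : \prod_(e <- es) e `^ (- s) = (prodsq es)^-1.
  rewrite /prodsq -prodfV; apply: eq_big_seq => e /hes.2 e0.
  by rewrite powRN s2 powR_mulrn // ltW.
rewrite -(ler_pM2r pes) -[X in _ * X <= _](ger0_norm (ltW pes)) -normrM mulrBl mulrAC.
by rewrite mulVf ?gt_eqF // mul1r.
Qed.
End HittingLimits.

Section WardSequence.
Variable R : realType.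

(** The candidate for B, defined formally by the recursion, so that the algebraic assertions hold
    before its values are identified with the correlations. *)
Fixpoint ward_seq (a : R) n : ratfun R n :=
  if n is k.+1 then ward a (ward_seq a k) else 1.

Lemma ward0 n (a : R) : ward a (0 : ratfun R n) = 0.
Proof.
rewrite /ward !mulr0 !rmorph0 mulr0 add0r big1 // => j _.
by rewrite (der0 (rf_derivation R j)) rmorph0 !mul0r oppr0 addr0.
Qed.

Lemma ward_seq0 n : ward_seq 0 n.+1 = 0.
Proof.
elim: n => [|n /= ->]; last exact: ward0.
rewrite /= /ward big_ord0 addr0 /rf_const mpolyC0 rf_poly0.
by rewrite mul0r rmorph0 mulr0.
Qed.
End WardSequence.

Theorem proposition2 (R : realType) (d : measure_display)
    (T : measurableType d) (P : probability T R) (kappa alpha : R)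
    (gamma : R -> T -> cplx R)
    (hkappa : 0 < kappa < 8) (halpha : 0 < alpha)
    (hSLE : chordal_SLE P kappa gamma)
    (hrestr : conformal_restriction P alpha gamma)
    (hlim : forall (n : nat) (x : 'I_n -> R), configuration x ->
       cvg (rescaled_hitting_prob P kappa gamma x e
              @[e --> @positive_to0 R n])) :
  exists B : ratseq R,
    (forall (n : nat) (x : 'I_n -> R), configuration x ->
       rf_value (B n) x (correlation P kappa gamma x)) /\
    [/\ forall (Ns : seq int), negative_sorted Ns -> forall n : nat,
          lops Ns B n = foldr (@calL R n) (B n) Ns,
        forall (N : int) (w : ratseq R),
          generated_space B w -> generated_space B (lop N w) &
        forall (M N : int) (w : ratseq R), generated_space B w ->
          forall n : nat,
            lop M (lop N w) n - lop N (lop M w) n =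
            (M - N)%:~R * lop (M + N) w n].
Proof.
have [gm path _ _] := hSLE.
have gc w : {within `[0, +oo[, continuous (fun t => gamma t w)} by have [] := path w.
have g0 w : gamma 0 w = 0 by have [] := path w.
(* The algebra holds for every weight a; it remains to find one for which the values are the
   correlation functions. *)
suff [a ha] : exists a : R, forall xs, conf xs ->
    rf_value (ward_seq a (size xs)) (pt xs) (corr P gamma kappa xs).
  exists (ward_seq a); split; last exact: virasoro_module.
  move=> n x [xi x0].
  pose xs := [seq x i | i <- enum 'I_n].
  have sx : size xs = n by rewrite size_map size_enum_ord.
  have cxs : conf xs.
    split; first by rewrite map_inj_uniq ?enum_uniq.
    by apply/mapP => -[i _ /esym/eqP]; apply/negP; exact: x0.
  have xE (i : 'I_n) : xs`_i = x i.
    by rewrite (nth_map i) ?size_enum_ord // nth_ord_enum.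
  have := ha xs cxs; rewrite /corr.
  move: xs sx cxs xE => xs sx _ xE; subst n.
  by have -> : pt xs = x by apply/funext.
(* s = 2 means kappa = 8/3, where the Ward identity applies with weight alpha. *)
have [s2|s2] := eqVneq (8 / kappa - 1) 2.
  exists alpha => xs.
  have cl := corr_lim gm gc g0 hrestr hlim s2.
  (* Strong induction on the number of points: rationality for fewer points supplies both the value
     at [xs] and the Lipschitz bounds required by the next identity. *)
  have [n] := ubnP (size xs); elim: n xs => [//|n IH] [|x xs]; rewrite ltnS.
    by move=> _ _; exact: (rf_value_nat 1).
  move=> /= sn cx; have [_ _ cxs] := conf_cons cx.
  apply: (ward_value gm gc hrestr cl _ cx erefl) => [ys cy sy|ys cy sy].
    by rewrite -sy; apply: IH => //; rewrite sy.
  apply: (@loclip_rational _ (size ys) (ward_seq alpha (size ys))) => // zs cz sz.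
  by rewrite -sz; apply: IH => //; rewrite sz (ltn_trans sy).
have s_lt : 8 / kappa - 1 < 2.
  by rewrite lt_neqAle s2 (exponent_le2 gm gc g0 hrestr halpha hlim).
(* Probabilities decay like e^2, so the correlations of n >= 1 points vanish. *)
exists 0 => -[|x xs] cx; first exact: (rf_value_nat 1).
rewrite (corr_eq0 gm gc g0 hrestr hlim s_lt cx) //.
by rewrite [ward_seq _ _]ward_seq0; exact: (rf_value_nat 0).
Qed.
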